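(* Let $N\ge5$ and $n\ge2$ be integers and let $a_1,\dots,a_n\in\mathbb{R}^N$ be pairwise distinct points. Define, for $x\in\mathbb{R}^N\setminus\{a_1,\dots,a_n\}$, $$V_n(x):=\sum_{1\le i<j\le n}\frac{|a_i-a_j|^2}{|x-a_i|^2|x-a_j|^2}\left(\sum_{1\le k<l\le n}\frac{\nu_{k,i,j}\,\nu_{l,i,j}\,|a_k-a_l|^2}{|x-a_k|^2|x-a_l|^2}\right),$$ where $\nu_{k,i,j}=\frac{N+2n-4}{N}$ if $k=i$ or $k=j$, and $\nu_{k,i,j}=\frac{N-4}{N}$ otherwise. Then the biharmonic Schrödinger operator $$H_n=\Delta^2-\frac{N^2(N-4)^2}{n^4}V_n$$ is critical in $\mathbb{R}^N$ for all $n\ge2$. Moreover, $H_n$ is positive-critical for $n\ge3$ and null-critical for $n=2$.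
   Context: $C_0^\infty(\mathbb{R}^N)$ denotes the smooth compactly supported functions on $\mathbb{R}^N$, and $D^{2,2}(\mathbb{R}^N)$ is the completion (closure) of $C_0^\infty(\mathbb{R}^N)$ with respect to the norm $\|u\|_{2,2}:=\|\Delta u\|_{L^2(\mathbb{R}^N)}$. For an operator $H=\Delta^2-\lambda V$, write $\langle Hu,u\rangle=\int_{\mathbb{R}^N}|\Delta u|^2dx-\lambda\int_{\mathbb{R}^N}V|u|^2dx$ for $u\in C_0^\infty(\mathbb{R}^N)$; $H\ge0$ means $\langle Hu,u\rangle\ge0$ for all such $u$. Assume $H\ge0$. $H$ is subcritical in $\mathbb{R}^N$ if there exists a nonzero nonnegative continuous function $W$ such that $\langle Hu,u\rangle\ge\int_{\mathbb{R}^N}W|u|^2dx$ for all $u\in C_0^\infty(\mathbb{R}^N)$. Otherwise $H$ is critical in $\mathbb{R}^N$. The sharp constant associated with the potential $V$ is $\lambda^*:=\inf_{u\in D^{2,2}(\mathbb{R}^N)\setminus\{0\}}\frac{\int_{\mathbb{R}^N}|\Delta u|^2dx}{\int_{\mathbb{R}^N}V|u|^2dx}$. A critical operator $H=\Delta^2-\lambda^*V$ is positive-critical in $\mathbb{R}^N$ if the infimum $\lambda^*$ is achieved by some nonzero $u\in D^{2,2}(\mathbb{R}^N)$; otherwise it is null-critical in $\mathbb{R}^N$. *)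

(* Defs.v *)
From HB Require Import structures.
From mathcomp Require Import all_boot all_order all_algebra.
From mathcomp Require Import all_classical all_reals all_analysis.

Set Implicit Arguments.
Unset Strict Implicit.
Unset Printing Implicit Defensive.

Import Order.TTheory GRing.Theory Num.Theory.
Import numFieldNormedType.Exports.

Local Open Scope classical_set_scope.
Local Open Scope ring_scope.

(* R^N is ['rV[R]_N].  Its sigma-algebra is generated by the coordinate maps,
   as the library does for [n.-tuple T]; it is the Borel sigma-algebra. *)

Section measurable_rV.
Context {R : realType} (n : nat).

Let coord (i : 'I_n) (x : 'rV[R]_n) : measurableTypeR R := x ord0 i.

Let rV_set0 : g_sigma_preimage coord set0.
Proof. exact: sigma_algebra0. Qed.

Let rV_setC A : g_sigma_preimage coord A -> g_sigma_preimage coord (~` A).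
Proof. exact: sigma_algebraC. Qed.

Let rV_bigcup (F : (set 'rV[R]_n)^nat) :
  (forall i, g_sigma_preimage coord (F i)) ->
  g_sigma_preimage coord (\bigcup_i (F i)).
Proof. exact: sigma_algebra_bigcup. Qed.

HB.instance Definition _ := @isMeasurable.Build default_measure_display
  'rV[R]_n (g_sigma_preimage coord) rV_set0 rV_setC rV_bigcup.

Lemma measurable_coord (i : 'I_n) :
  measurable_fun [set: 'rV[R]_n] (fun x : 'rV[R]_n => x ord0 i : measurableTypeR R).
Proof.
move=> _ Y mY; rewrite setTI; apply: sub_sigma_algebra => /=.
rewrite -bigcup_seq/=; exists i => /=; first by rewrite mem_index_enum.
by exists Y => //; rewrite setTI.
Qed.

Lemma measurable_fun_rV d (T : measurableType d) (f : T -> 'rV[R]_n) :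
  (forall i, measurable_fun [set: T] (fun t => f t ord0 i : measurableTypeR R)) ->
  measurable_fun [set: T] f.
Proof.
move=> mf _ A mA; rewrite setTI.
have : [set B | measurable (f @^-1` B)] A; last by [].
apply: (smallest_sub _ _ mA); first split => /=.
- by rewrite preimage_set0.
- by move=> B mB; rewrite setTD preimage_setC; exact: measurableC.
- by move=> F mF; rewrite preimage_bigcup; exact: bigcup_measurable.
- move=> B; rewrite -bigcup_seq/= => -[i _ [Y mY <-]] /=.
  by rewrite setTI -[X in measurable X]setTI; exact: mf.
Qed.

End measurable_rV.

Section lebesgue_measure_rV.
Context {R : realType}.
Local Open Scope ereal_scope.

Definition cons_rV n (p : measurableTypeR R * 'rV[R]_n) : 'rV[R]_n.+1 :=
  \row_(i < n.+1) if unlift ord0 i is Some j then p.2 ord0 j else p.1.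

Definition behead_rV n (x : 'rV[R]_n.+1) : measurableTypeR R * 'rV[R]_n :=
  (x ord0 ord0, \row_(j < n) x ord0 (lift ord0 j)).

Lemma cons_rVK n : cancel (@cons_rV n) (@behead_rV n).
Proof.
case=> x y; rewrite /behead_rV; congr pair.
  by rewrite mxE unlift_none.
by apply/rowP => j; rewrite !mxE liftK.
Qed.

Lemma measurable_cons_rV n : measurable_fun setT (@cons_rV n).
Proof.
apply: measurable_fun_rV => i.
under eq_fun do rewrite mxE.
case: (unlift ord0 i) => [j|].
  exact: (measurableT_comp (measurable_coord j) measurable_snd).
exact: measurable_fst.
Qed.

Lemma measurable_behead_rV n : measurable_fun setT (@behead_rV n).
Proof.
apply/measurable_fun_pairP; split => /=; first exact: measurable_coord.
apply: measurable_fun_rV => i; rewrite /comp /=.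
under eq_fun do rewrite mxE.
exact: measurable_coord.
Qed.

Section step.
Context n (m : {sigma_finite_measure set 'rV[R]_n -> \bar R}).

Definition lebesgue_rV_step : set 'rV[R]_n.+1 -> \bar R :=
  pushforward (lebesgue_measure \x m) (@cons_rV n).

Let mpre A : measurable A -> measurable (@cons_rV n @^-1` A).
Proof. by move=> mA; rewrite -[X in measurable X]setTI; exact: measurable_cons_rV. Qed.

Let step0 : lebesgue_rV_step set0 = 0.
Proof. by rewrite /lebesgue_rV_step /pushforward preimage_set0 measure0. Qed.

Let step_ge0 A : 0 <= lebesgue_rV_step A.
Proof. by rewrite /lebesgue_rV_step /pushforward; exact: measure_ge0. Qed.

Let step_sigma_additive : semi_sigma_additive lebesgue_rV_step.
Proof.
move=> F mF tF mUF; rewrite /lebesgue_rV_step /pushforward preimage_bigcup.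
apply: measure_semi_sigma_additive.
- by move=> k; exact: mpre.
- apply/trivIsetP => /= i j _ _ ij; rewrite -preimage_setI.
  by move/trivIsetP : tF => /(_ _ _ _ _ ij) ->//; rewrite preimage_set0.
- by rewrite -preimage_bigcup; exact: mpre.
Qed.

HB.instance Definition _ := isMeasure.Build _ _ _ lebesgue_rV_step
  step0 step_ge0 step_sigma_additive.

Let step_sigma_finite : sigma_finite setT lebesgue_rV_step.
Proof.
have /sigma_finiteP[F [TF ndF Foo]] := sigma_finiteT (@lebesgue_measure R).
have /sigma_finiteP[G [TG ndG Goo]] := sigma_finiteT m.
exists (fun k => @behead_rV n @^-1` (F k `*` G k)).
  rewrite -preimage_bigcup (_ : \bigcup_k _ = setT) ?preimage_setT//.
  apply/seteqP; split => // -[x y] _.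
  have [k _ Fkx] : (\bigcup_i F i) x by rewrite -TF.
  have [l _ Gly] : (\bigcup_i G i) y by rewrite -TG.
  exists (maxn k l) => //; split => /=.
    by move: x Fkx; exact/subsetPset/ndF/leq_maxl.
  by move: y Gly; exact/subsetPset/ndG/leq_maxr.
move=> k; have [mF Fk] := Foo k; have [mG Gk] := Goo k; split.
  rewrite -[X in measurable X]setTI; apply: measurable_behead_rV => //.
  exact: measurableX.
rewrite /lebesgue_rV_step /pushforward -comp_preimage.
rewrite (_ : _ \o _ = id); last by apply/funext => p; exact: cons_rVK.
by rewrite preimage_id product_measure1E// lte_mul_pinfty// ge0_fin_numE.
Qed.

HB.instance Definition _ := Measure_isSigmaFinite.Build _ _ _
  lebesgue_rV_step step_sigma_finite.

End step.

Fixpoint lebesgue_rV n : {sigma_finite_measure set 'rV[R]_n -> \bar R} :=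
  match n with
  | 0%N => \d_(0%R : 'rV[R]_0)
  | k.+1 => lebesgue_rV_step (lebesgue_rV k)
  end.

Lemma lebesgue_rV_box n (A : 'I_n -> set (measurableTypeR R)) :
  (forall i, measurable (A i)) ->
  lebesgue_rV n [set x : 'rV[R]_n | forall i, A i (x ord0 i)] =
  \prod_(i < n) lebesgue_measure (A i).
Proof.
elim: n A => [A _|n IH A mA].
  by rewrite big_ord0 /= diracE mem_set// => -[].
pose B := [set x : 'rV[R]_n | forall i, A (lift ord0 i) (x ord0 i)].
have mB : measurable B.
  rewrite (_ : B = \bigcap_(i in [set: 'I_n])
      ((fun x : 'rV[R]_n => x ord0 i : measurableTypeR R) @^-1` A (lift ord0 i))).
    apply: fin_bigcap_measurable => [|i _]; first exact: finite_finset.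
    by rewrite -[X in measurable X]setTI; exact: measurable_coord.
  by apply/seteqP; split => x /= h i *; exact: h.
rewrite big_ord_recl -(IH (fun i => A (lift ord0 i)))//.
rewrite -(product_measure1E lebesgue_measure (lebesgue_rV n))//=.
rewrite /lebesgue_rV_step /pushforward; congr ((_ \x _) _).
apply/seteqP; split => [[x y] /= h|[x y] [/= h0 h] i].
  split => /=; first by have := h ord0; rewrite mxE unlift_none.
  by move=> i; have := h (lift ord0 i); rewrite mxE liftK.
by rewrite mxE; case: unliftP => [j ->|->]; [exact: h|].
Qed.

End lebesgue_measure_rV.

Section test_functions.
Context {R : realType} {N : nat}.
Implicit Types (u f : 'rV[R]_N -> R) (x : 'rV[R]_N).

Definition partial (i : 'I_N) f x : R := 'D_(delta_mx ord0 i) f x.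

Definition iter_partial (s : seq 'I_N) f : 'rV[R]_N -> R := foldr partial f s.

(* Infinitely differentiable.  [partial] is total, but by induction on [s] every
   derivative occurring in [iter_partial s f] genuinely exists. *)
Definition smooth f := forall (s : seq 'I_N) x, differentiable (iter_partial s f) x.

Definition Cc_infty u := smooth u /\ compact (closure [set x | u x != 0]).

Definition laplacian f x : R := \sum_(i < N) partial i (partial i f) x.

(* Euclidean; the library norm on ['rV_N] is the sup norm. *)
Definition sqnorm x : R := \sum_(i < N) x ord0 i ^+ 2.

End test_functions.

Section critical_operators.
Context {R : realType} {N : nat}.
Implicit Types (u g V W : 'rV[R]_N -> R) (lambda : R).
Local Notation mu := (@lebesgue_rV R N).

Definition L2_norm g : \bar R := ('N[mu]_2%:E[EFin \o g])%E.

(* [D22 u g]: [u] belongs to D^{2,2}, the completion of C_0^oo for the norm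
   [L2_norm (laplacian u)], and [g] is its Laplacian.  An element of the
   completion is a class of Cauchy sequences [phi] for that norm; it is
   represented by the L^2 limit [g] of the Laplacians, so that its norm is
   [L2_norm g], together with the almost everywhere limit [u] of [phi].  For
   N >= 5 the Sobolev inequality ||phi||_{2N/(N-4)} <= C ||Delta phi||_2 shows
   that such a [u] exists along a subsequence and that [u] and [g] determine
   each other up to null sets. *)
Definition D22 u g :=
  [/\ measurable_fun setT u, measurable_fun setT g &
      exists phi : nat -> 'rV[R]_N -> R,
      [/\ forall k, Cc_infty (phi k),
          L2_norm (laplacian (phi k) \- g) @[k --> \oo] --> 0%E &
          {ae mu, forall x, phi k x @[k --> \oo] --> u x}]].

Definition ae_zero u := {ae mu, forall x, u x = 0}.

Definition integral_sqr g : \bar R := (\int[mu]_x (g x ^+ 2)%:E)%E.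

Definition potential_energy V u : \bar R := (\int[mu]_x (V x * u x ^+ 2)%:E)%E.

(* <(Delta^2 - lambda V) u, u>; it is -oo when lambda V > 0 and the integral
   of V |u|^2 diverges. *)
Definition quad_form lambda V u : \bar R :=
  (integral_sqr (laplacian u) - lambda%:E * potential_energy V u)%E.

Definition nonneg_operator lambda V :=
  forall u, Cc_infty u -> (0 <= quad_form lambda V u)%E.

Definition subcritical lambda V :=
  nonneg_operator lambda V /\
  exists W, [/\ continuous W, forall x, 0 <= W x, exists x, W x != 0 &
    forall u, Cc_infty u -> (potential_energy W u <= quad_form lambda V u)%E].

Definition critical lambda V :=
  nonneg_operator lambda V /\ ~ subcritical lambda V.

(* In [\bar R], [x / +oo = 0]. *)
Definition rayleigh V u g : \bar R := (integral_sqr g / potential_energy V u)%E.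

Definition sharp_constant V : \bar R :=
  ereal_inf [set q | exists u g, [/\ D22 u g, ~ ae_zero u & q = rayleigh V u g]].

Definition sharp_constant_achieved V :=
  exists u g, [/\ D22 u g, ~ ae_zero u & rayleigh V u g = sharp_constant V].

Definition positive_critical lambda V :=
  [/\ critical lambda V, lambda%:E = sharp_constant V &
      sharp_constant_achieved V].

Definition null_critical lambda V :=
  [/\ critical lambda V, lambda%:E = sharp_constant V &
      ~ sharp_constant_achieved V].

End critical_operators.

Section potential.
Context {R : realType} {N n : nat}.
Variable a : 'I_n -> 'rV[R]_N.

Definition nu (k i j : 'I_n) : R :=
  if (k == i) || (k == j) then (N%:R + 2 * n%:R - 4) / N%:R
  else (N%:R - 4) / N%:R.

(* At the poles [a i], a null set, this takes an irrelevant finite value. *)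
Definition V_ (x : 'rV[R]_N) : R :=
  \sum_(i < n) \sum_(j < n | (i < j)%N)
    sqnorm (a i - a j) / (sqnorm (x - a i) * sqnorm (x - a j)) *
    (\sum_(k < n) \sum_(l < n | (k < l)%N)
       nu k i j * nu l i j * sqnorm (a k - a l) /
       (sqnorm (x - a k) * sqnorm (x - a l))).

End potential.

(* Main.v *)
Require Import Defs.
From mathcomp Require Import all_boot all_order all_algebra.
From mathcomp Require Import all_classical all_reals all_analysis.
From mathcomp Require Import measurable_realfun ring lra.

(** With [q_i = |x - a_i|^2] and [P] the product of the [q_i], let
    [Phi = P^(- (N - 4) / (2 n))]. Off the poles, a direct computation gives
    [Delta^2 Phi = lambda V Phi] with the [lambda] of the statement
    ([bilaplacian_ground]), while [Phi > 0] and [Delta Phi <= 0]. For [u = Phi v]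
    with [v] a test function vanishing near the poles, Green's formula gives
    the ground state representation ([ground_state_identity])

      [int |Delta u|^2 = lambda int V u^2 + int |Delta u - v Delta Phi|^2
                         + 2 int (- Delta Phi) Phi |grad v|^2].

    The last two terms form the remainder, which is nonnegative. Test functions
    vanishing near the poles are dense because [4 < N] ([cutoff_dense]); so the
    Hardy inequality with constant [lambda] holds on test functions and, by
    Fatou's lemma, on D^{2,2} ([hardy], [hardy_D22]).

    The inequality is optimal in a strong sense. Truncate [Phi] on a logarithmic
    scale, at [|ln P| ~ K], near the poles and near infinity simultaneously. The
    remainder of the truncation is at most a multiple of
    [Phi^2 (sum 1 / q_i)^2 / (1 + ln^2 P)], which is integrable, and it tends to
    zero ([defect_cvg0]). So a potential [W >= 0] whose energy is bounded by the
    quadratic form satisfies [int W Phi^2 = 0], and is null ([ground_null]). With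
    [W] continuous this is criticality; with [W] a multiple of [V] it shows that
    [lambda] is the sharp constant ([critical_V], [sharp_constant_V]).

    For [n >= 3] the function [Phi (sum 1 / q_i)] is square integrable, so the
    truncations converge in D^{2,2} to [Phi], which is a minimiser
    ([achieved_ground]).

    For [n = 2] the integral of [V Phi^2] diverges logarithmically at the poles
    ([ground_potential_infinite]), while every minimiser is a multiple of [Phi]
    ([minimiser_is_ground]). Indeed, the gradient term of the remainder tends to
    zero along a sequence of test functions converging to a minimiser [u]. As the
    gradients themselves have no limit, they are replaced by finite differences,
    which they control ([difference_estimate]): [u / Phi] is invariant under all
    translations up to null sets, hence constant almost everywhere
    ([translation_invariant_cst]). *)

Set Implicit Arguments.
Unset Strict Implicit.
Unset Printing Implicit Defensive.
Import Order.TTheory GRing.Theory Num.Theory.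
Import numFieldNormedType.Exports.
Local Open Scope classical_set_scope.
Local Open Scope ring_scope.

(** * Differentiation rules and elementary functions *)

Lemma scaleRE {R : realType} (a b : R) : a *: (b : R^o) = a * b.
Proof. by []. Qed.

Section chain_rule.
Context {R : realType} {V : normedModType R}.

Let is_derive_line (f : V -> R) (x v : V) (df : R) :
  is_derive x v f df <-> is_derive (0 : R) (1 : R) (fun h : R => f (h *: v + x)) df.
Proof.
have e : 'D_v f x = 'D_1 (fun h : R => f (h *: v + x)) 0.
  rewrite /derive; set g1 := fun h => h^-1 *: _; set g2 := fun h => h^-1 *: _.
  suff -> : g1 = g2 by [].
  by apply/funext => h; rewrite /g1 /g2 /= addr0 scale0r add0r [_%:A]mulr1.
split=> -[H1 H2]; apply: DeriveDef.
- exact: (derivable1P f x v).1 H1.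
- by rewrite -e.
- exact: (derivable1P f x v).2 H1.
- by rewrite e.
Qed.

Lemma is_derive_comp1 (F : R -> R) (g : V -> R) (x v : V) (dF dg : R) :
  is_derive (g x) 1 F dF -> is_derive x v g dg ->
  is_derive x v (fun y => F (g y)) (dF * dg).
Proof.
move=> dF1 /is_derive_line dg1; apply/is_derive_line.
by apply: is_derive1_comp dg1; rewrite scale0r add0r.
Qed.

Lemma differentiable_comp1 (F : R -> R) (g : V -> R) (x : V) :
  derivable F (g x) 1 -> differentiable g x ->
  differentiable (fun y => F (g y)) x.
Proof.
by move=> dF dg; apply: (differentiable_comp dg); exact/derivable1_diffP.
Qed.

Lemma is_derive_add (f g : V -> R) (x v : V) (df dg : R) :
  is_derive x v f df -> is_derive x v g dg ->
  is_derive x v (fun y => f y + g y) (df + dg).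
Proof. exact: is_deriveD. Qed.

Lemma is_derive_mul (f g : V -> R) (x v : V) (df dg : R) :
  is_derive x v f df -> is_derive x v g dg ->
  is_derive x v (fun y => f y * g y) (f x * dg + g x * df).
Proof. exact: is_deriveM. Qed.

Lemma is_derive_bigsum (I : Type) (r : seq I) (P : pred I) (f : I -> V -> R)
    (x v : V) (df : I -> R) :
  (forall i, P i -> is_derive x v (f i) (df i)) ->
  is_derive x v (fun y => \sum_(i <- r | P i) f i y) (\sum_(i <- r | P i) df i).
Proof.
move=> H; elim: r => [|i r IH].
  under eq_fun do rewrite big_nil; rewrite big_nil; exact: is_derive_cst.
under eq_fun do rewrite big_cons; rewrite big_cons.
by case: ifPn => // Pi; apply: is_derive_add => //; exact: H.
Qed.

Lemma is_derive_pow (f : V -> R) (n : nat) (x v : V) (df : R) :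
  is_derive x v f df ->
  is_derive x v (fun y => f y ^+ n) (n%:R * f x ^+ n.-1 * df).
Proof.
move=> dfx; have := @is_deriveX R V f n x v df dfx.
by have -> : f ^+ n = (fun y => f y ^+ n) by apply/funext => y; rewrite fctE.
Qed.

End chain_rule.

Section flat.
Context {R : realType}.

(** The family is indexed by the power of the factor in front of
    [exp (-1/t)], because this makes it stable under differentiation. *)
Definition flat (m : nat) (t : R) : R :=
  if 0 < t then t^-1 ^+ m * expR (- t^-1) else 0.

Lemma flat_ge0 (m : nat) (t : R) : 0 <= flat m t.
Proof.
rewrite /flat; case: ifPn => // t0.
by rewrite mulr_ge0 ?expR_ge0// exprn_ge0// invr_ge0 ltW.
Qed.

Lemma flat_gt0 (m : nat) (t : R) : 0 < t -> 0 < flat m t.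
Proof.
by move=> t0; rewrite /flat t0 mulr_gt0 ?expR_gt0// exprn_gt0// invr_gt0.
Qed.

Lemma flat_eq0 (m : nat) (t : R) : t <= 0 -> flat m t = 0.
Proof. by move=> t0; rewrite /flat ltNge t0. Qed.

(** The term of degree [m + 2] of the exponential series at [1 / t] already
    gives the bound. *)
Lemma flat_le (m : nat) (t : R) : flat m t <= (m.+2)`!%:R * t ^+ 2.
Proof.
rewrite /flat; case: ifPn => t0; last first.
  by rewrite mulr_ge0 ?ler0n ?sqr_ge0.
have y0 : 0 < t^-1 by rewrite invr_gt0.
have t0' : t != 0 by rewrite gt_eqF.
have f0 : (0 : R) < (m.+2)`!%:R by rewrite ltr0n fact_gt0.
have := @expR_ge1Dxn R t^-1 m.+1 (ltW y0) => H.
rewrite expRN ler_pdivrMr ?expR_gt0//.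
apply: (@le_trans _ _ ((m.+2)`!%:R * t ^+ 2 * (t^-1 ^+ m.+2 / (m.+2)`!%:R))).
  rewrite le_eqVlt; apply/orP; left; apply/eqP.
  rewrite -(addn2 m) exprD addn2; set c := (m.+2)`!%:R in f0 *.
  have cn0 : c != 0 by rewrite gt_eqF.
  by field; rewrite cn0 t0'.
rewrite ler_pM2l; last by rewrite mulr_gt0// exprn_gt0.
by apply: le_trans H; rewrite lerDr.
Qed.

Lemma is_derive_quadratic (F : R -> R) (C : R) :
  (forall t, `|F t| <= C * t ^+ 2) -> is_derive (0 : R) (1 : R) F 0.
Proof.
move=> HF.
have F0 : F 0 = 0.
  by apply/eqP; rewrite -normr_le0 (le_trans (HF 0))// expr0n/= mulr0.
have C0 : 0 <= C.
  by have := HF 1; rewrite expr1n mulr1; exact: le_trans.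
suff H : (fun h => h^-1 *: ((F \o shift 0) (h *: (1 : R)) - F 0)) @ 0^' --> (0 : R).
  by apply: DeriveDef; [apply/cvg_ex; exists 0 | exact/cvg_lim].
apply/cvgr0Pnorm_lt => e e0.
have C1 : 0 < C + 1 by rewrite ltr_wpDl.
have H : \forall h \near (0 : R)^', `|h| < e / (C + 1).
  by apply: dnbhs0_lt; rewrite divr_gt0.
near=> h; rewrite F0 subr0 /= addr0 [_%:A]mulr1 scaleRE normrM normfV.
have hn0 : h != 0 by near: h; exact: nbhs_dnbhs_neq.
have h0 : 0 < `|h| by rewrite normr_gt0.
rewrite mulrC ltr_pdivrMr//; apply: (le_lt_trans (HF h)).
rewrite -real_normK ?num_real// expr2 mulrA ltr_pM2r//.
have he : `|h| < e / (C + 1) by near: h.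
rewrite ltr_pdivlMr// in he.
by apply: le_lt_trans he; rewrite mulrC ler_wpM2l// lerDl.
Unshelve. all: by end_near. Qed.

(** The explicit formula is differentiated off [0]; at [0] the derivative
    comes from the quadratic bound [flat_le]. *)
Lemma is_derive_flat (m : nat) (t : R) :
  is_derive t 1 (flat m) (flat m.+2 t - m%:R * flat m.+1 t).
Proof.
have [t0|t0|->] := ltgtP t 0.
- have n0 : \near t, cst 0 t = flat m t.
    have : \near t, t < 0 by exact: lt_nbhsl.
    by apply: filterS => s s0; rewrite flat_eq0// ltW.
  rewrite !flat_eq0 ?ltW// mulr0 subr0.
  by apply: near_eq_is_derive n0 _; exact: is_derive_cst.
- have n0 : \near t, t^-1 ^+ m * expR (- t^-1) = flat m t.
    have : \near t, 0 < t by exact: lt_nbhsr.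
    by apply: filterS => s s0; rewrite /flat s0.
  apply: near_eq_is_derive n0 _.
  have tn0 : t != 0 by rewrite gt_eqF.
  have dV : is_derive t 1 (fun s : R => s^-1) (- t^-1 ^+ 2).
    have := @is_deriveV R id t 1 1 tn0 (is_derive_id _ _).
    by rewrite scaleRE mulr1 exprVn.
  have dN : is_derive t 1 (fun s : R => - s^-1) (t^-1 ^+ 2).
    by apply: is_derive_eq (is_deriveN dV) _; rewrite opprK.
  have dE := is_derive_comp1 (is_derive_expR _) dN.
  apply: is_derive_eq (is_derive_mul (is_derive_pow m dV) dE) _.
  rewrite /flat t0; case: m => [|m]/=.
    by rewrite !expr0; ring.
  by rewrite !exprS; ring.
- rewrite !flat_eq0// mulr0 subr0.
  apply: (@is_derive_quadratic _ (m.+2)`!%:R) => s.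
  by rewrite ger0_norm ?flat_ge0// flat_le.
Qed.

End flat.

(** Functions built from a class [G] of differentiable functions, stable under
    the derivations ['D_v], [v] in [E].  With [G] the smooth functions and [E]
    the coordinate directions it proves smoothness of every concrete function
    needed below; with [G = {id}] on the line it gives the one-variable
    cutoff and its derivatives. *)
Section elementary.
Context {R : realType} {V : normedModType R}.
Variables (E : set V) (G : set (V -> R)).

Inductive elementary : (V -> R) -> Prop :=
| elem_gen f : G f -> elementary f
| elem_cst c : elementary (fun=> c)
| elem_add f g : elementary f -> elementary g ->
    elementary (fun x => f x + g x)
| elem_mul f g : elementary f -> elementary g ->
    elementary (fun x => f x * g x)
| elem_exp f : elementary f -> elementary (fun x => expR (f x))
| elem_inv f : (forall x, f x != 0) -> elementary f ->
    elementary (fun x => (f x)^-1)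
| elem_ln f : (forall x, 0 < f x) -> elementary f ->
    elementary (fun x => ln (f x))
| elem_flat m f : elementary f -> elementary (fun x => flat m (f x)).

Hypothesis HG : forall f, G f ->
  (forall x, differentiable f x) /\ forall v, E v -> elementary ('D_v f).

Let is_derive_comp (F F' : R -> R) (f : V -> R) (v : V) :
  (forall x, is_derive (f x) 1 F (F' (f x))) -> (forall x, differentiable f x) ->
  (forall x, differentiable (fun y => F (f y)) x) /\
  'D_v (fun y => F (f y)) = (fun x => F' (f x) * 'D_v f x).
Proof.
move=> dF df; split=> [x|].
  by apply: differentiable_comp1 (df x); have [] := dF x.
apply/funext => x.
have dfx := derivableP (diff_derivable (v := v) (df x)).
by have [_ ->] := is_derive_comp1 (dF x) dfx.
Qed.

(** Smoothness involves the derivatives of all orders; being stable under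
    derivation reduces it to an induction on expressions. *)
Lemma elementary_derive f : elementary f ->
  (forall x, differentiable f x) /\ forall v, E v -> elementary ('D_v f).
Proof.
elim=> {f}.
- exact: HG.
- move=> c; split=> [x|v _]; first exact: differentiable_cst.
  have -> : 'D_v (fun=> c : R) = fun=> 0 by apply/funext => x; exact: derive_cst.
  exact: elem_cst.
- move=> f g ef [df edf] eg [dg edg]; split=> [x|v Ev].
    exact: differentiableD.
  have -> : 'D_v (fun x => f x + g x) = (fun x => 'D_v f x + 'D_v g x).
    by apply/funext => x; apply: deriveD; exact: diff_derivable.
  by apply: elem_add; [exact: edf|exact: edg].
- move=> f g ef [df edf] eg [dg edg]; split=> [x|v Ev].
    exact: differentiableM.
  have -> : 'D_v (fun x => f x * g x) = (fun x => f x * 'D_v g x + g x * 'D_v f x).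
    by apply/funext => x; apply: deriveM; exact: diff_derivable.
  apply: elem_add; apply: elem_mul => //; [exact: edg|exact: edf].
- move=> f ef [df edf].
  have H v := is_derive_comp v (fun x => is_derive_expR (f x)) df.
  split=> [|v Ev]; first exact: (H 0).1.
  rewrite (H v).2; apply: elem_mul; [exact: elem_exp|exact: edf].
- move=> f f0 ef [df edf].
  have dV x : is_derive (f x) 1 (fun t : R => t^-1) (- ((f x)^-1 * (f x)^-1)).
    apply: is_derive_eq (is_deriveV (f0 x) (is_derive_id _ _)) _.
    by rewrite scaleRE mulr1 -exprVn.
  have H v := @is_derive_comp (fun t => t^-1) (fun t => - (t^-1 * t^-1)) f v dV df.
  split=> [|v Ev]; first exact: (H 0).1.
  rewrite (H v).2.
  have -> : (fun x => - ((f x)^-1 * (f x)^-1) * 'D_v f x) =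
      (fun x => (-1) * ((f x)^-1 * ((f x)^-1 * 'D_v f x))).
    by apply/funext => x; ring.
  apply: elem_mul; first exact: elem_cst.
  apply: elem_mul; first exact: elem_inv.
  by apply: elem_mul; [exact: elem_inv|exact: edf].
- move=> f f0 ef [df edf].
  have H v := is_derive_comp v (fun x => is_derive1_ln (f0 x)) df.
  split=> [|v Ev]; first exact: (H 0).1.
  rewrite (H v).2; apply: elem_mul; last exact: edf.
  by apply: elem_inv => // x; rewrite gt_eqF.
- move=> m f ef [df edf].
  have H v := @is_derive_comp (flat m)
    (fun t => flat m.+2 t - m%:R * flat m.+1 t) f v
    (fun x => is_derive_flat m (f x)) df.
  split=> [|v Ev]; first exact: (H 0).1.
  rewrite (H v).2; apply: elem_mul; last exact: edf.
  have -> : (fun x => flat m.+2 (f x) - m%:R * flat m.+1 (f x)) =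
      (fun x => flat m.+2 (f x) + (- m%:R) * flat m.+1 (f x)).
    by apply/funext => x; rewrite mulNr.
  apply: elem_add; first exact: elem_flat.
  by apply: elem_mul; [exact: elem_cst|exact: elem_flat].
Qed.

End elementary.

(** * Cutoff functions on the line *)

Section cutoff.
Context {R : realType}.

Definition smooth_step (t : R) : R := flat 0 t / (flat 0 t + flat 0 (1 - t)).

Definition bump (t : R) : R := smooth_step (2 - t) * smooth_step (2 + t).

Lemma smooth_step_den_gt0 (t : R) : 0 < flat 0 t + flat 0 (1 - t).
Proof.
have [t0|t0] := ltP 0 t; first by rewrite ltr_wpDr ?flat_ge0// flat_gt0.
by rewrite ltr_wpDl ?flat_ge0// flat_gt0// subr_gt0 (le_lt_trans t0).
Qed.

Lemma smooth_step_ge0 (t : R) : 0 <= smooth_step t.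
Proof. by rewrite divr_ge0 ?flat_ge0// ltW// smooth_step_den_gt0. Qed.

Lemma smooth_step_le1 (t : R) : smooth_step t <= 1.
Proof.
by rewrite ler_pdivrMr ?smooth_step_den_gt0// mul1r lerDl flat_ge0.
Qed.

Lemma smooth_step1 (t : R) : 1 <= t -> smooth_step t = 1.
Proof.
move=> t1; rewrite /smooth_step [flat 0 (1 - t)]flat_eq0 ?subr_le0// addr0.
by rewrite divff// gt_eqF// flat_gt0// (lt_le_trans _ t1).
Qed.

Lemma smooth_step0 (t : R) : t <= 0 -> smooth_step t = 0.
Proof. by move=> t0; rewrite /smooth_step flat_eq0// mul0r. Qed.

Lemma bump_ge0 (t : R) : 0 <= bump t.
Proof. by rewrite mulr_ge0 ?smooth_step_ge0. Qed.

Lemma bump_le1 (t : R) : bump t <= 1.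
Proof. by rewrite mulr_ile1 ?smooth_step_ge0 ?smooth_step_le1. Qed.

Lemma bump1 (t : R) : `|t| <= 1 -> bump t = 1.
Proof.
rewrite ler_norml => /andP[t1 t2]; rewrite /bump !smooth_step1 ?mulr1//; lra.
Qed.

Lemma bump0 (t : R) : 2 <= `|t| -> bump t = 0.
Proof.
rewrite ler_normr /bump => /orP[t2|t2].
  by rewrite smooth_step0 ?mul0r//; lra.
by rewrite [X in _ * X]smooth_step0 ?mulr0//; lra.
Qed.

End cutoff.

Section elementary_bump.
Context {R : realType} {V : normedModType R}.
Variables (G : set (V -> R)).
Notation elem := (elementary G).

Lemma elem_opp f : elem f -> elem (fun x => - f x).
Proof.
move=> ef; have -> : (fun x => - f x) = (fun x => (-1) * f x).
  by apply/funext => x; rewrite mulN1r.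
by apply: elem_mul => //; exact: elem_cst.
Qed.

Lemma elem_smooth_step f : elem f -> elem (fun x => smooth_step (f x)).
Proof.
move=> ef; apply: elem_mul; first exact: elem_flat.
apply: elem_inv => [x|]; first by rewrite gt_eqF ?smooth_step_den_gt0.
apply: elem_add; first exact: elem_flat.
by apply: elem_flat; apply: elem_add; [exact: elem_cst|exact: elem_opp].
Qed.

Lemma elem_bump f : elem f -> elem (fun x => bump (f x)).
Proof.
move=> ef; apply: elem_mul; apply: elem_smooth_step; apply: elem_add => //;
  by [exact: elem_cst|exact: elem_opp].
Qed.

End elementary_bump.

Section bump_derivatives.
Context {R : realType}.

Let Gid : set (R -> R) := [set id].

Let HG f : Gid f -> (forall x, differentiable f x) /\
  forall v, [set (1 : R)] v -> elementary Gid ('D_v f).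
Proof.
move=> ->; split=> [x //|v ->].
have -> : 'D_(1 : R) (id : R -> R) = fun=> 1.
  by apply/funext => x; exact: derive_id.
exact: elem_cst.
Qed.

Definition bump' : R -> R := 'D_(1 : R) (bump : R -> R).
Definition bump'' : R -> R := 'D_(1 : R) bump'.

Let ebump : elementary Gid (bump : R -> R).
Proof. by apply: elem_bump; apply: elem_gen. Qed.

Let ebump' : elementary Gid bump'.
Proof. by have [_] := elementary_derive HG ebump; apply. Qed.

Let ebump'' : elementary Gid bump''.
Proof. by have [_] := elementary_derive HG ebump'; apply. Qed.

Lemma is_derive_bump (t : R) : is_derive t 1 bump (bump' t).
Proof.
by apply: derivableP; apply: diff_derivable; have [+ _] := elementary_derive HG ebump.
Qed.

Lemma is_derive_bump' (t : R) : is_derive t 1 bump' (bump'' t).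
Proof.
by apply: derivableP; apply: diff_derivable; have [+ _] := elementary_derive HG ebump'.
Qed.

Let derive_locally_cst (f : R -> R) (c t : R) (P : set R) :
  open P -> P t -> {in P, forall s, f s = c} -> 'D_(1 : R) f t = 0.
Proof.
move=> oP Pt fc; rewrite (@near_eq_derive _ _ _ f (cst c)) ?derive_cst//.
have : nbhs t P by exact: open_nbhs_nbhs.
by apply: filterS => s Ps; rewrite fc ?inE.
Qed.

Let inside := [set t : R | `|t| < 1].
Let outside := [set t : R | 2 < `|t|].

Let norm_continuous : continuous (Num.norm : R -> R).
Proof. exact: norm_continuous. Qed.

Let open_inside : open inside.
Proof.
have -> : inside = Num.norm @^-1` [set t : R | t < 1] by [].
by apply: open_comp => [x _|]; [exact: norm_continuous|exact: open_lt].
Qed.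

Let open_outside : open outside.
Proof.
have -> : outside = Num.norm @^-1` [set t : R | 2 < t] by [].
by apply: open_comp => [x _|]; [exact: norm_continuous|exact: open_gt].
Qed.

Lemma bump'_eq0 (t : R) : (`|t| < 1) || (2 < `|t|) -> bump' t = 0.
Proof.
case/orP => t1.
  apply: (derive_locally_cst (c := 1) open_inside) => // s.
  by rewrite inE => s1; rewrite bump1// ltW.
apply: (derive_locally_cst (c := 0) open_outside) => // s.
by rewrite inE => s1; rewrite bump0// ltW.
Qed.

Lemma bump''_eq0 (t : R) : (`|t| < 1) || (2 < `|t|) -> bump'' t = 0.
Proof.
case/orP => t1.
  apply: (derive_locally_cst (c := 0) open_inside) => // s.
  by rewrite inE => s1; rewrite bump'_eq0// (_ : `|s| < 1).
apply: (derive_locally_cst (c := 0) open_outside) => // s.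
by rewrite inE => s1; rewrite bump'_eq0// (_ : 2 < `|s|) ?orbT.
Qed.

Let bounded_of_elementary (f : R -> R) : elementary Gid f ->
  (forall t, 2 < `|t| -> f t = 0) -> exists C, forall t, `|f t| <= C.
Proof.
move=> ef f0; have [df _] := elementary_derive HG ef.
have cf : {within `[-2, 2], continuous (fun t => `|f t|)}.
  apply: continuous_subspaceT => t; apply: continuous_comp.
    exact: differentiable_continuous.
  exact: norm_continuous.
have [|c _ Hc] := EVT_max _ cf; first by lra.
exists `|f c| => t; have [t2|t2] := leP `|t| 2.
  by apply: Hc; rewrite in_itv/= -ler_norml.
by rewrite f0// normr0.
Qed.

Lemma bump_derivatives_bounded : exists2 C : R, 0 < C &
  forall t, `|bump' t| <= C /\ `|bump'' t| <= C.
Proof.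
have [C1 H1] : exists C, forall t, `|bump' t| <= C.
  by apply: bounded_of_elementary => // t t2; rewrite bump'_eq0// t2 orbT.
have [C2 H2] : exists C, forall t, `|bump'' t| <= C.
  by apply: bounded_of_elementary => // t t2; rewrite bump''_eq0// t2 orbT.
have C10 : 0 <= C1 by apply: le_trans (H1 0).
have C20 : 0 <= C2 by apply: le_trans (H2 0).
exists (1 + C1 + C2); first lra.
move=> t; split; [apply: le_trans (H1 t) _|apply: le_trans (H2 t) _]; lra.
Qed.

End bump_derivatives.

(** * Calculus of smooth functions *)

Section smooth.
Context {R : realType} {N : nat}.
Implicit Types (f g : 'rV[R]_N -> R).

Definition axis : set 'rV[R]_N := range (fun i : 'I_N => delta_mx ord0 i).

Lemma smooth_differentiable f : smooth f -> forall x, differentiable f x.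
Proof. by move=> sf x; exact: (sf [::] x). Qed.

Lemma smooth_partial f i : smooth f -> smooth (partial i f).
Proof.
move=> sf s x; have := sf (rcons s i) x.
by rewrite /iter_partial foldr_rcons.
Qed.

(** The derivations are peeled off from the innermost one, so that the
    induction hypothesis applies to the partial derivatives, which stay in the
    class. *)
Lemma smoothP (C : set ('rV[R]_N -> R)) :
  (forall f, C f -> (forall x, differentiable f x) /\ forall i, C (partial i f)) ->
  forall f, C f -> smooth f.
Proof.
move=> HC f Cf s; elim/last_ind: s f Cf => [|s i IH] f Cf x.
  exact: (HC _ Cf).1.
by rewrite /iter_partial foldr_rcons; apply: IH; exact: (HC _ Cf).2.
Qed.

Lemma elementary_smooth f : elementary smooth f -> smooth f.
Proof.
apply: smoothP => {}f ef.
have HG g : smooth g -> (forall x, differentiable g x) /\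
    forall v, axis v -> elementary smooth ('D_v g).
  move=> sg; split; first exact: smooth_differentiable.
  by move=> v [i _ <-]; apply: elem_gen; exact: smooth_partial.
have [df ed] := elementary_derive HG ef; split=> // i.
by apply: ed; exists i.
Qed.

Lemma smooth_cst (c : R) : smooth (fun _ : 'rV[R]_N => c).
Proof. by apply: elementary_smooth; exact: elem_cst. Qed.

Lemma smooth_add f g : smooth f -> smooth g -> smooth (fun x => f x + g x).
Proof.
by move=> sf sg; apply: elementary_smooth; apply: elem_add; exact: elem_gen.
Qed.

Lemma smooth_mul f g : smooth f -> smooth g -> smooth (fun x => f x * g x).
Proof.
by move=> sf sg; apply: elementary_smooth; apply: elem_mul; exact: elem_gen.
Qed.

Lemma smooth_opp f : smooth f -> smooth (fun x => - f x).
Proof. by move=> sf; apply/elementary_smooth/elem_opp/elem_gen. Qed.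

Lemma smooth_sum (I : Type) (r : seq I) (P : pred I) (f : I -> 'rV[R]_N -> R) :
  (forall i, P i -> smooth (f i)) -> smooth (fun x => \sum_(i <- r | P i) f i x).
Proof.
move=> sf; elim: r => [|i r IH].
  rewrite (_ : (fun x => _) = fun=> 0); first exact: smooth_cst.
  by apply/funext => x; rewrite big_nil.
have [Pi|Pi] := boolP (P i); last first.
  rewrite (_ : (fun x => _) = fun x => \sum_(j <- r | P j) f j x)//.
  by apply/funext => x; rewrite big_cons (negbTE Pi).
rewrite (_ : (fun x => _) = fun x => f i x + \sum_(j <- r | P j) f j x).
  by apply: smooth_add => //; exact: sf.
by apply/funext => x; rewrite big_cons Pi.
Qed.

Lemma smooth_prod (I : Type) (r : seq I) (P : pred I) (f : I -> 'rV[R]_N -> R) :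
  (forall i, P i -> smooth (f i)) -> smooth (fun x => \prod_(i <- r | P i) f i x).
Proof.
move=> sf; elim: r => [|i r IH].
  rewrite (_ : (fun x => _) = fun=> 1); first exact: smooth_cst.
  by apply/funext => x; rewrite big_nil.
have [Pi|Pi] := boolP (P i); last first.
  rewrite (_ : (fun x => _) = fun x => \prod_(j <- r | P j) f j x)//.
  by apply/funext => x; rewrite big_cons (negbTE Pi).
rewrite (_ : (fun x => _) = fun x => f i x * \prod_(j <- r | P j) f j x).
  by apply: smooth_mul => //; exact: sf.
by apply/funext => x; rewrite big_cons Pi.
Qed.

Lemma is_derive_coord (j i : 'I_N) (x : 'rV[R]_N) :
  is_derive x (delta_mx ord0 i) (fun y : 'rV[R]_N => y ord0 j) (j == i)%:R.
Proof.
apply: DeriveDef; first exact/diff_derivable/differentiable_coord.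
rewrite /derive; apply: cvg_lim => //.
apply: (@cvg_trans _ (cst ((j == i)%:R : R) @ (0 : R)^')); last exact: cvg_cst.
apply: near_eq_cvg; near=> h.
have h0 : h != 0 by near: h; exact: nbhs_dnbhs_neq.
rewrite /= !mxE eqxx /= addrK scaleRE.
by rewrite mulrA mulVf// mul1r.
Unshelve. all: by end_near. Qed.

Lemma smooth_coord (j : 'I_N) : smooth (fun x : 'rV[R]_N => x ord0 j).
Proof.
move=> s x; case/lastP: s => [|s i]; first exact: differentiable_coord.
rewrite /iter_partial foldr_rcons -/(iter_partial s _).
have -> : partial i (fun x : 'rV[R]_N => x ord0 j) = fun=> (j == i)%:R.
  by apply/funext => y; have [_ e] := is_derive_coord j i y; exact: e.
exact: smooth_cst.
Qed.

Lemma smooth_laplacian f : smooth f -> smooth (laplacian f).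
Proof.
by move=> sf; apply: smooth_sum => i _; apply: smooth_partial; exact: smooth_partial.
Qed.

Lemma is_derive_partial f i x : differentiable f x ->
  is_derive x (delta_mx ord0 i) f (partial i f x).
Proof. by move=> df; apply/derivableP/diff_derivable. Qed.

Lemma partialE f i x df :
  is_derive x (delta_mx ord0 i) f df -> partial i f x = df.
Proof. by case. Qed.

Lemma partial_add f g i : smooth f -> smooth g ->
  partial i (fun x => f x + g x) = (fun x => partial i f x + partial i g x).
Proof.
move=> sf sg; apply/funext => x; apply: partialE; apply: is_derive_add;
  by apply: is_derive_partial; exact: smooth_differentiable.
Qed.

Lemma partial_mul f g i : smooth f -> smooth g ->
  partial i (fun x => f x * g x) = (fun x => f x * partial i g x + g x * partial i f x).
Proof.
move=> sf sg; apply/funext => x; apply: partialE; apply: is_derive_mul;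
  by apply: is_derive_partial; exact: smooth_differentiable.
Qed.

Lemma laplacian_mul f g x : smooth f -> smooth g ->
  laplacian (fun x => f x * g x) x = f x * laplacian g x + g x * laplacian f x +
    2 * \sum_(i < N) partial i f x * partial i g x.
Proof.
move=> sf sg; rewrite /laplacian !mulr_sumr -!big_split/=; apply: eq_bigr => i _.
have sf' := smooth_partial i sf; have sg' := smooth_partial i sg.
rewrite partial_mul// partial_add; [|exact: smooth_mul|exact: smooth_mul].
by rewrite !partial_mul//; ring.
Qed.

Lemma near_eq_partial f g i x : (\near x, f x = g x) ->
  partial i f x = partial i g x.
Proof. exact: near_eq_derive. Qed.

Lemma near_eq_laplacian f g x : (\near x, f x = g x) ->
  laplacian f x = laplacian g x.
Proof.
move=> fg; apply: eq_bigr => i _; apply: near_eq_partial.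
by move/nbhs_interior : fg; apply: filterS => y; exact: near_eq_partial.
Qed.

End smooth.

(** * Lebesgue measure on the Euclidean space *)

Section rV_norm.
Context {R : realType} {N : nat}.
Implicit Types (x : 'rV[R]_N).

Lemma rV_norm_leP x (M : R) : 0 <= M ->
  `|x| <= M <-> forall i, `|x ord0 i| <= M.
Proof.
move=> M0; rewrite [X in X <= _]/Num.norm /= mx_normrE; split.
  by move/bigmax_leP => [_ H] i; exact: (H (ord0, i)).
by move=> H; apply/bigmax_leP; split=> // -[k i] _ /=; rewrite ord1.
Qed.

Lemma rV_coord_le_norm x i : `|x ord0 i| <= `|x|.
Proof. exact: (rV_norm_leP x (normr_ge0 x)).1. Qed.

(** Balls for the sup norm have an explicit measure, so the estimates are made
    on them; this lemma and the next one compare the two norms. *)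
Lemma sqnorm_ge_norm x : `|x| ^+ 2 <= sqnorm x.
Proof.
have s0 : 0 <= sqnorm x by apply: sumr_ge0 => i _; exact: sqr_ge0.
rewrite -(sqr_sqrtr s0) ler_sqr ?nnegrE ?sqrtr_ge0//.
apply/rV_norm_leP; first exact: sqrtr_ge0.
move=> i; rewrite -sqrtr_sqr ler_wsqrtr// /sqnorm (bigD1 i)//= lerDl.
by apply: sumr_ge0 => j _; exact: sqr_ge0.
Qed.

Lemma sqnorm_le_norm x : sqnorm x <= N%:R * `|x| ^+ 2.
Proof.
rewrite mulrC mulr_natr -[X in _ *+ X](card_ord N) -sumr_const; apply: ler_sum => i _.
by rewrite -(real_normK (num_real (x ord0 i))) ler_sqr ?nnegrE// rV_coord_le_norm.
Qed.

End rV_norm.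

Section borel.
Context {R : realType} {N : nat}.

Lemma measurable_rV_box (A : 'I_N -> set (measurableTypeR R)) :
  (forall i, measurable (A i)) ->
  measurable [set x : 'rV[R]_N | forall i, A i (x ord0 i)].
Proof.
move=> mA; rewrite (_ : [set x | _] = \bigcap_(i in [set: 'I_N])
    ((fun x : 'rV[R]_N => x ord0 i : measurableTypeR R) @^-1` A i)).
  apply: fin_bigcap_measurable => [|i _]; first exact: finite_finset.
  by rewrite -[X in measurable X]setTI; exact: measurable_coord.
by apply/seteqP; split => x /= h i *; exact: h.
Qed.

(** Boxes with rational centre and size [1 / (k + 1)] form a countable base. *)
Lemma open_measurable_rV (U : set 'rV[R]_N) : open U -> measurable U.
Proof.
move=> oU.
pose bx (p : 'rV[rat]_N * nat) : set 'rV[R]_N :=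
  [set y | forall i, `](ratr (p.1 ord0 i) - p.2.+1%:R^-1 : R),
                      (ratr (p.1 ord0 i) + p.2.+1%:R^-1)[%classic (y ord0 i)].
have mbx p : measurable (bx p).
  apply: (@measurable_rV_box (fun i => `](ratr (p.1 ord0 i) - p.2.+1%:R^-1 : R),
    (ratr (p.1 ord0 i) + p.2.+1%:R^-1)[%classic)) => i; exact: measurable_itv.
pose F p := if `[< bx p `<=` U >] then bx p else set0.
have -> : U = \bigcup_p F p.
  apply/seteqP; split=> [x Ux|x [p _]]; last first.
    by rewrite /F; case: asboolP => // H; exact: H.
  have /nbhs_ballP[e /= e0 He] : nbhs x U by exact: open_nbhs_nbhs.
  have [k Hk] : exists k : nat, (k.+1%:R^-1 : R) < e / 2.
    have e20 : 0 < e / 2 by rewrite divr_gt0.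
    case: (near_infty_natSinv_lt (PosNum e20)) => k _ H.
    by exists k; exact: (H k (leqnn k)).
  have k0 : (0 : R) < k.+1%:R^-1 by rewrite invr_gt0.
  have [r rE] : exists r : R, k.+1%:R^-1 = r by eexists.
  rewrite rE in Hk k0.
  have /choice[q Hq] : forall i, exists q : rat,
      x ord0 i - r < ratr q < x ord0 i + r.
    move=> i; have /rat_in_itvoo[q] : x ord0 i - r < x ord0 i + r by lra.
    by rewrite in_itv/=; exists q.
  exists (\row_i q i, k) => //; rewrite /F.
  have xb : bx (\row_i q i, k) x.
    move=> i /=; rewrite rE in_itv/= mxE; have /andP[q1 q2] := Hq i.
    by apply/andP; split; lra.
  case: asboolP => // -[] y yb; apply: He; split=> // j i.
  rewrite (ord1 j) /ball /=; have := yb i.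
  have := xb i; rewrite /= rE !in_itv/= !mxE => /andP[x1 x2] /andP[y1 y2].
  by rewrite ltr_distlC; apply/andP; split; lra.
apply: countable_bigcupT_measurable => [|p]; first exact: countableP.
by rewrite /F; case: asboolP.
Qed.

Lemma continuous_measurable_rV (f : 'rV[R]_N -> R) : continuous f ->
  measurable_fun [set: 'rV[R]_N] f.
Proof.
move=> cf; apply: (measurability _ (measurable_realfun.RGenOInfty.measurableE R)) => _ [_ [a ->] <-].
rewrite setTI; apply: open_measurable_rV; apply: open_comp => [x _|]; first exact: cf.
rewrite (_ : `]a, +oo[%classic = [set t | a < t]); first exact: open_gt.
by apply/seteqP; split => t /=; rewrite in_itv/= andbT.
Qed.

End borel.

(** Packages the pushforward as a measure, to which the uniqueness theorems
    for measures apply. *)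
Lemma pushforward_measure d1 d2 (T1 : measurableType d1)
    (T2 : measurableType d2) (R : realType) (mu : {measure set T1 -> \bar R})
    (f : T1 -> T2) : measurable_fun setT f ->
  exists m : {measure set T2 -> \bar R}, forall A, m A = mu (f @^-1` A).
Proof.
move=> mf.
by unshelve refine (ex_intro _ (pushforward mu f : {measure set T2 -> \bar R}) _).
Qed.

Section translation.
Context {R : realType}.
Local Open Scope ereal_scope.

(** The two sides are measures in [A] which agree on the half-open intervals. *)
Lemma lebesgue_measure_shift (c : R) (A : set (measurableTypeR R)) : measurable A ->
  lebesgue_measure ((fun t : R => (t + c)%R) @^-1` A) = lebesgue_measure A.
Proof.
move=> mA.
have mf : measurable_fun [set: measurableTypeR R]
    (fun t : measurableTypeR R => (t + c)%R : measurableTypeR R).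
  exact: (@measurable_funD _ _ _ [set: measurableTypeR R] id (cst c)).
have [m mE] := pushforward_measure lebesgue_measure mf.
rewrite -[LHS]mE; apply/esym.
apply: (@lebesgue_measure_unique R m) => // X.
case=> -[a b] _ <-; rewrite mE /=.
rewrite [X in _ = lebesgue_measure X](_ : _ = `](a - c)%R, (b - c)%R]%classic); last first.
  by apply/seteqP; split=> t /=; rewrite !in_itv/= ltrBlDr lerBrDr.
rewrite !lebesgue_measure_itv/= !lte_fin ltrD2r.
by case: ifPn => // _; rewrite -!EFinB; congr EFin; ring.
Qed.

Let measurable_rV_shift n (h : 'rV[R]_n) :
  measurable_fun [set: 'rV[R]_n] (fun x : 'rV[R]_n => (x + h)%R).
Proof.
apply: measurable_fun_rV => i; under eq_fun do rewrite mxE.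
by apply: measurable_funD => //; exact: measurable_coord.
Qed.

(** Induction on the dimension, by uniqueness of the product measure. *)
Lemma lebesgue_rV_shift n (h : 'rV[R]_n) (A : set 'rV[R]_n) : measurable A ->
  lebesgue_rV n ((fun x => (x + h)%R) @^-1` A) = lebesgue_rV n A.
Proof.
elim: n h A => [|n IH] h A mA.
  rewrite (_ : _ @^-1` A = A)//; apply/seteqP; split=> x /=;
    by rewrite [(x + h)%R]thinmx0 [x]thinmx0.
rewrite /= /lebesgue_rV_step /pushforward.
have mA' : measurable (@cons_rV R n @^-1` A).
  by rewrite -[X in measurable X]setTI; exact: measurable_cons_rV.
pose c : R := h ord0 ord0; pose k : 'rV[R]_n := \row_j h ord0 (lift ord0 j).
pose f := fun p : measurableTypeR R * 'rV[R]_n =>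
  ((p.1 + c)%R : measurableTypeR R, (p.2 + k)%R).
have mf : measurable_fun setT f.
  apply/measurable_fun_pairP; split => /=.
    by apply: (@measurable_funD _ _ _ setT fst (cst c)) => //; exact: measurable_fst.
  apply: (measurableT_comp (measurable_rV_shift k)); exact: measurable_snd.
have fE p : (cons_rV p + h)%R = cons_rV (f p).
  by apply/rowP => j; rewrite !mxE; case: unliftP => [i ->|->]; rewrite ?mxE.
have -> : @cons_rV R n @^-1` ((fun x => (x + h)%R) @^-1` A) = f @^-1` (@cons_rV R n @^-1` A).
  by apply/seteqP; split=> p; rewrite /preimage/mkset fE.
have [m mE] := pushforward_measure (lebesgue_measure \x lebesgue_rV n) mf.
rewrite -[LHS]mE; apply/esym; apply: product_measure_unique => // B C mB mC.
have mB' : measurable ((fun t : R => (t + c)%R) @^-1` B : set (measurableTypeR R)).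
  by rewrite -[X in measurable X]setTI; apply: (@measurable_funD _ _ _ setT id (cst c)).
have mC' : measurable ((fun x => (x + k)%R) @^-1` C).
  by rewrite -[X in measurable X]setTI; exact: measurable_rV_shift.
have := product_measure1E lebesgue_measure (lebesgue_rV n) mB' mC'.
move=> e; rewrite mE; apply: (etrans e); congr (_ * _); last exact: IH.
exact: lebesgue_measure_shift.
Qed.

End translation.

Section integrals.
Context {R : realType} {N : nat}.
Notation mu := (@lebesgue_rV R N).
Local Open Scope ereal_scope.

Lemma measurable_shift (h : 'rV[R]_N) :
  measurable_fun [set: 'rV[R]_N] (fun x : 'rV[R]_N => (x + h)%R).
Proof.
apply: measurable_fun_rV => i; under eq_fun do rewrite mxE.
by apply: measurable_funD => //; exact: measurable_coord.
Qed.

Lemma ge0_integral_shift (f : 'rV[R]_N -> \bar R) (h : 'rV[R]_N) :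
  measurable_fun setT f -> (forall x, 0 <= f x) ->
  \int[mu]_x f (x + h)%R = \int[mu]_x f x.
Proof.
move=> mf f0; have mh := measurable_shift h.
have := @ge0_integral_pushforward _ _ _ _ R _ mh mu setT f
  measurableT mf (fun x _ => f0 x).
rewrite preimage_setT => <-.
apply: eq_measure_integral => A mA _.
by rewrite -[RHS](lebesgue_rV_shift h mA).
Qed.

Lemma integral_shift (f : 'rV[R]_N -> \bar R) (h : 'rV[R]_N) :
  measurable_fun setT f -> \int[mu]_x f (x + h)%R = \int[mu]_x f x.
Proof.
move=> mf; rewrite integralE [RHS]integralE; congr (_ - _).
- have := @ge0_integral_shift (f^\+) h (measurable_funepos mf) (fun=> funepos_ge0 _ _).
  by move=> <-; apply: eq_integral => x _; rewrite unlock.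
- have := @ge0_integral_shift (f^\-) h (measurable_funeneg mf) (fun=> funeneg_ge0 _ _).
  by move=> <-; apply: eq_integral => x _; rewrite unlock.
Qed.

Lemma measurable_ball0 (r : R) : measurable [set x : 'rV[R]_N | (`|x| <= r)%R].
Proof.
rewrite -[X in measurable X]setTI.
have : measurable_fun [set: 'rV[R]_N] (fun x : 'rV[R]_N => `|x|%R).
  by apply: continuous_measurable_rV; exact: norm_continuous.
move=> /(_ measurableT [set` (`]-oo, r] : interval R)] (measurable_itv _)).
by rewrite (_ : _ @^-1` _ = [set x | (`|x| <= r)%R]).
Qed.

Lemma lebesgue_rV_ball0 (r : R) : (0 <= r)%R ->
  mu [set x : 'rV[R]_N | (`|x| <= r)%R] = ((2 * r) ^+ N)%:E.
Proof.
move=> r0.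
pose I : set R := [set` (`[(- r)%R, r] : interval R)].
rewrite (_ : [set x | _] = [set x : 'rV[R]_N | forall i, I (x ord0 i)]).
  rewrite (lebesgue_rV_box (A := fun=> I)); last by move=> i; exact: measurable_itv.
  under eq_bigr do rewrite lebesgue_measure_itv/=.
  rewrite (eq_bigr (fun=> (2 * r)%:E)) => [|i _].
    by rewrite prodEFin prodr_const card_ord.
  case: ifPn => [_|]; first by rewrite -EFinB opprK; congr EFin; ring.
  rewrite lte_fin -leNgt => rr.
  have r1 : r = 0%R by lra.
  by rewrite r1 mulr0.
apply/seteqP; split=> x /=.
  by move/(rV_norm_leP _ r0) => H i; rewrite /I/= in_itv/= -ler_norml.
by move=> H; apply/(rV_norm_leP _ r0) => i; have := H i; rewrite /I/= in_itv/= -ler_norml.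
Qed.

Lemma lebesgue_rV_set1 (a : 'rV[R]_N) : (0 < N)%N -> mu [set a] = 0.
Proof.
move=> N0.
rewrite (_ : [set a] = [set x : 'rV[R]_N | forall i, [set (a ord0 i)] (x ord0 i)]).
  rewrite (lebesgue_rV_box (A := fun i => [set (a ord0 i)])); last first.
    by move=> i; exact: measurable_set1.
  rewrite (bigD1 (Ordinal N0))//= lebesgue_measure_set1 mul0e//.
apply/seteqP; split=> x /=; first by move=> ->.
by move=> H; apply/rowP.
Qed.

Lemma integrable_ball0 (r : R) : (0 <= r)%R ->
  mu.-integrable setT (fun x => (\1_[set x : 'rV[R]_N | (`|x| <= r)%R] x)%:E).
Proof.
move=> r0; have mA := measurable_ball0 r; have muA := lebesgue_rV_ball0 r0.
apply/integrableP; split; first by apply/measurable_EFinP; exact: measurable_indic.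
under eq_integral do rewrite gee0_abs ?lee_fin//.
by rewrite integral_indic// setIT [X in (X < _)%E]muA ltry.
Qed.

(** Compactness of the support, in the form used in the estimates. *)
Definition vanishes_off_ball (f : 'rV[R]_N -> R) :=
  exists M : R, forall x, (M < `|x|)%R -> f x = 0%R.

Lemma vanishes_off_ballW (f : 'rV[R]_N -> R) : vanishes_off_ball f ->
  exists2 M : R, (0 < M)%R & forall x, (M < `|x|)%R -> f x = 0%R.
Proof.
move=> [M HM]; exists (1 + `|M|)%R; first by rewrite ltr_pwDl.
move=> x Mx; apply: HM; apply: le_lt_trans Mx.
by rewrite (le_trans (ler_norm _))// lerDr.
Qed.

Lemma continuous_bounded_on_ball (f : 'rV[R]_N -> R) (M : R) : continuous f ->
  exists2 C : R, (0 <= C)%R & forall x, (`|x| <= M)%R -> (`|f x| <= C)%R.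
Proof.
move=> cf; pose A := [set x : 'rV[R]_N | (`|x| <= M)%R].
have cA : compact A.
  apply: bounded_closed_compact.
    exists M; split; first exact: num_real.
    by move=> r Mr x /= xM; apply: ltW; exact: le_lt_trans Mr.
  have -> : A = Num.norm @^-1` [set r : R | (r <= M)%R] by [].
  apply: closed_comp => [x _|]; first exact: norm_continuous.
  exact: closed_le.
have := continuous_compact (continuous_subspaceT (A := A) cf) cA.
move/compact_bounded => [C [_ HC]].
exists `|C + 1|%R => // x xM.
apply: le_trans (HC (C + 1)%R _ (f x) _) (ler_norm _); first by rewrite ltrDl.
by exists x.
Qed.

Lemma integrable_continuous (f : 'rV[R]_N -> R) : continuous f ->
  vanishes_off_ball f -> mu.-integrable setT (EFin \o f).
Proof.
move=> cf /vanishes_off_ballW[M M0 HM].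
have [C C0 HC] := continuous_bounded_on_ball M cf.
have mf := continuous_measurable_rV cf.
pose A := [set x : 'rV[R]_N | (`|x| <= M)%R].
have mA : measurable A := measurable_ball0 M.
have muA := lebesgue_rV_ball0 (ltW M0).
apply/integrableP; split; first exact/measurable_EFinP.
apply: (@le_lt_trans _ _ (\int[mu]_x (C * \1_A x)%:E)).
  apply: ge0_le_integral => //.
  - by apply/measurable_EFinP; apply: measurableT_comp.
  - by apply/measurable_EFinP; apply: measurable_funM => //; exact: measurable_indic.
  - move=> x _ /=; rewrite lee_fin indicE; have [xM|xM] := leP `|x|%R M.
      by rewrite mem_set//= mulr1 HC.
    by rewrite HM// normr0 mulr_ge0.
under eq_integral do rewrite EFinM.
rewrite ge0_integralZl_EFin//.
- by rewrite integral_indic// setIT [X in _ * X]muA -EFinM ltry.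
- by apply/measurable_EFinP; exact: measurable_indic.
Qed.

End integrals.

(** * Integration by parts *)

Section integral_partial.
Context {R : realType} {N : nat}.
Notation mu := (@lebesgue_rV R N).
Implicit Types (f g : 'rV[R]_N -> R).

Let continuous_sub f g : continuous f -> continuous g ->
  continuous (fun x => f x - g x).
Proof. by move=> cf cg x; exact: (@continuousB _ _ _ f g x (cf x) (cg x)). Qed.

Let continuous_cmulB (c : R) f g : continuous f -> continuous g ->
  continuous (fun x => c * (f x - g x)).
Proof.
move=> cf cg x.
apply: (@continuous_comp _ _ _ (fun x => f x - g x) ( *%R c)).
  exact: continuous_sub.
exact: mulrl_continuous.
Qed.

Lemma smooth_continuous f : smooth f -> continuous f.
Proof. by move=> sf x; apply: differentiable_continuous; exact: smooth_differentiable. Qed.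

Lemma is_derive_along f (x v : 'rV[R]_N) (t : R) :
  differentiable f (t *: v + x) ->
  is_derive t 1 (fun s : R => f (s *: v + x)) ('D_v f (t *: v + x)).
Proof.
move=> df; have dv := diff_derivable (v := v) df.
have e : (fun h : R => h^-1 *: (((fun s : R => f (s *: v + x)) \o shift t) (h *: 1) -
    f (t *: v + x))) = (fun h : R => h^-1 *: ((f \o shift (t *: v + x)) (h *: v) -
    f (t *: v + x))).
  by apply/funext => h /=; rewrite [_%:A]mulr1 scalerDl addrA.
by apply: DeriveDef; [rewrite /derivable e|rewrite /derive e].
Qed.

(** Mean value theorem on the segment from [x] to [x + h v]. *)
Lemma lipschitz_along f (x v : 'rV[R]_N) (C h : R) : 0 <= h ->
  (forall y, differentiable f y) ->
  (forall t, 0 <= t <= h -> `|'D_v f (t *: v + x)| <= C) ->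
  `|f (h *: v + x) - f x| <= C * h.
Proof.
move=> h0 df HC; pose g (s : R) := f (s *: v + x).
have dg (t : R) : is_derive t 1 g ('D_v f (t *: v + x)) by exact: is_derive_along.
have cg : {within `[0, h], continuous g}.
  apply: derivable_within_continuous => t _; by have [] := dg t.
have [c cin Hc] := MVT_segment h0 (fun t _ => dg t) cg.
have := Hc; rewrite /g scale0r add0r subr0 => ->.
by rewrite normrM (ger0_norm h0) ler_wpM2r// HC.
Qed.

Lemma norm_axis (i : 'I_N) : `|delta_mx ord0 i : 'rV[R]_N| <= 1.
Proof.
apply/rV_norm_leP => // j; rewrite mxE eqxx/=.
by case: eqP => _; rewrite ?normr1 ?normr0.
Qed.

Lemma near_off_ball (M : R) (x : 'rV[R]_N) : M < `|x| -> \near x, M < `|x|.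
Proof.
move=> Mx.
have : open [set y : 'rV[R]_N | M < `|y|].
  have -> : [set y : 'rV[R]_N | M < `|y|] = Num.norm @^-1` [set r : R | M < r] by [].
  by apply: open_comp => [y _|]; [exact: norm_continuous|exact: open_gt].
by move=> oA; apply: open_nbhs_nbhs.
Qed.

Lemma partial_vanishes f i : vanishes_off_ball f -> vanishes_off_ball (partial i f).
Proof.
move=> [M HM]; exists M => x Mx; apply: partialE.
have n0 : \near x, cst 0 x = f x.
  by apply: filterS (near_off_ball Mx) => y /HM ->.
exact: near_eq_is_derive n0 (is_derive_cst _ _ _).
Qed.

Lemma laplacian_vanishes f : vanishes_off_ball f -> vanishes_off_ball (laplacian f).
Proof.
move=> [M HM]; exists M => x Mx.
rewrite (near_eq_laplacian (g := cst 0)).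
  rewrite /laplacian big1// => i _.
  have -> : partial i (cst 0 : 'rV[R]_N -> R) = cst 0.
    by apply/funext => y; exact: derive_cst.
  exact: derive_cst.
by apply: filterS (near_off_ball Mx) => y /HM ->.
Qed.

Lemma vanishes_mulr f g : vanishes_off_ball g -> vanishes_off_ball (fun x => f x * g x).
Proof. by move=> [M HM]; exists M => x /HM ->; rewrite mulr0. Qed.

Lemma vanishes_mull f g : vanishes_off_ball f -> vanishes_off_ball (fun x => f x * g x).
Proof. by move=> [M HM]; exists M => x /HM ->; rewrite mul0r. Qed.

Lemma vanishes_add f g : vanishes_off_ball f -> vanishes_off_ball g ->
  vanishes_off_ball (fun x => f x + g x).
Proof.
move=> [M HM] [K HK]; exists (Num.max M K) => x; rewrite gt_max => /andP[xM xK].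
by rewrite HM// HK// addr0.
Qed.

(** The difference quotients have integral zero by translation invariance, and
    converge to the derivative with a uniform bound on a fixed ball. *)
Lemma integral_partial f i : smooth f -> vanishes_off_ball f ->
  (\int[mu]_x (partial i f x)%:E = 0)%E.
Proof.
move=> sf vf; have [M M0 HM] := vanishes_off_ballW vf.
pose e : 'rV[R]_N := delta_mx ord0 i.
have ne : `|e| <= 1 := norm_axis i.
have cf := smooth_continuous sf.
have cp := smooth_continuous (smooth_partial i sf).
have [C C0 HC] := continuous_bounded_on_ball (M + 2) cp.
pose h (k : nat) : R := k.+1%:R^-1.
have h0 k : 0 < h k by rewrite invr_gt0.
have h1 k : h k <= 1 by rewrite invf_le1// ler1n.
pose d (k : nat) (x : 'rV[R]_N) : R := (h k)^-1 * (f (h k *: e + x) - f x).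
have cs k : continuous (fun x : 'rV[R]_N => f (h k *: e + x)).
  move=> x; apply: continuous_comp; last exact: cf.
  by apply: (@continuousD _ _ _ (cst (h k *: e)) id x); [exact: cst_continuous|exact: cvg_id].
have normhe k : `|h k *: e| <= 1.
  by rewrite normrZ (gtr0_norm (h0 k)) mulr_ile1// ltW.
have vs k : vanishes_off_ball (fun x : 'rV[R]_N => f (h k *: e + x)).
  exists (M + 1) => x Mx; apply: HM.
  have : `|x| <= `|h k *: e + x| + `|h k *: e|.
    by rewrite -[X in `|X| <= _](addKr (h k *: e) x) addrC (le_trans (ler_normD _ _))// normrN.
  by have := normhe k; lra.
have cd k : continuous (d k).
  by apply: continuous_cmulB => //; exact: cs.
(* A difference quotient is bounded through the mean value theorem where
   [f] does not vanish, and is zero far from there. *)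
have dle k x : `|d k x| <= C * \1_[set x : 'rV[R]_N | `|x| <= M + 1] x.
  rewrite indicE; have [xM|xM] := leP `|x| (M + 1).
    rewrite mem_set//= mulr1 /d normrM gtr0_norm ?invr_gt0//.
    rewrite mulrC ler_pdivrMr//.
    apply: lipschitz_along; [exact: ltW|exact: smooth_differentiable|].
    move=> t /andP[t0 th]; apply: HC.
    rewrite (le_trans (ler_normD _ _))// normrZ ger0_norm//.
    have : t * `|e| <= 1 by rewrite mulr_ile1// (le_trans th).
    lra.
  rewrite memNset/=; last by apply/negP; rewrite -ltNge.
  have x1 : `|x| <= `|h k *: e + x| + `|h k *: e|.
    by rewrite -[X in `|X| <= _](addKr (h k *: e) x) addrC (le_trans (ler_normD _ _))// normrN.
  have x2 := normhe k.
  by rewrite mulr0 /d (HM (_ + _)) ?(HM x) ?subrr ?mulr0 ?normr0//; lra.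
have d0 k : (\int[mu]_x (d k x)%:E = 0)%E.
  under eq_integral do rewrite EFinM.
  rewrite integralZl//; last first.
    by apply: integrable_continuous => [x|]; [by apply: continuous_sub; [exact: cs|exact: cf]|
      apply: vanishes_add => //; case: vf => K HK; exists K => x /HK ->; rewrite oppr0].
  under eq_integral do rewrite EFinB.
  rewrite integralB//; [|exact: integrable_continuous|exact: integrable_continuous].
  under eq_integral do rewrite addrC.
  have mf : measurable_fun setT (EFin \o f).
    exact: (measurable_EFinP _ _).2 (continuous_measurable_rV cf).
  rewrite (integral_shift (h k *: e) mf).
  rewrite subee ?mule0//.
  by apply: integrable_fin_num => //; exact: integrable_continuous.
have mB := @measurable_ball0 R N (M + 1).
have ff : {ae mu, forall x, setT x ->
    (d k x)%:E @[k --> \oo] --> (partial i f x)%:E}.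
  apply: aeW => x _; apply/fine_cvgP; split; first exact: nearW.
  have dx : derivable f x e by apply: diff_derivable; exact: smooth_differentiable.
  apply: (cvgr_dnbhsP (fun t : R => t^-1 *: (f (t *: e + x) - f x)) 0 _).1 => //.
  by split=> [k|]; [rewrite gt_eqF|exact: cvg_harmonic].
have ig : mu.-integrable setT
    (fun x => (C * \1_[set x : 'rV[R]_N | `|x| <= M + 1] x)%:E).
  under eq_fun do rewrite EFinM.
  have M1 : 0 <= M + 1 by lra.
  exact: (integrableZl measurableT C (integrable_ball0 M1)).
have fg : {ae mu, forall x k, setT x ->
    (`|(d k x)%:E| <= (C * \1_[set x : 'rV[R]_N | `|x| <= M + 1] x)%:E)%E}.
  by apply: aeW => x k _; rewrite lee_fin; exact: dle.
have [_ _] := @dominated_convergence _ _ _ mu setT measurableT (fun k x => (d k x)%:E)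
  (fun x => (partial i f x)%:E) _
  (fun k => (measurable_EFinP _ _).2 (continuous_measurable_rV (cd k)))
  ((measurable_EFinP _ _).2 (continuous_measurable_rV cp)) ff ig fg.
under eq_fun do rewrite d0.
by move=> H; apply/esym; apply: (cvg_unique _ _ H) => //; exact: cvg_cst.
Qed.

(** The integrand is the divergence of [f grad g - g grad f]. *)
Lemma integral_green f g : smooth f -> smooth g -> vanishes_off_ball g ->
  (\int[mu]_x (f x * laplacian g x - g x * laplacian f x)%:E = 0)%E.
Proof.
move=> sf sg vg.
pose F i (x : 'rV[R]_N) := f x * partial i g x + (-1) * (g x * partial i f x).
have sF i : smooth (F i).
  apply: smooth_add; first by apply: smooth_mul => //; exact: smooth_partial.
  apply: smooth_mul; first exact: smooth_cst.
  by apply: smooth_mul => //; exact: smooth_partial.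
have vF i : vanishes_off_ball (F i).
  apply: vanishes_add; first by apply: vanishes_mulr; exact: partial_vanishes.
  by apply: vanishes_mulr; exact: vanishes_mull.
have -> : (fun x => (f x * laplacian g x - g x * laplacian f x)%:E) =
    (fun x => \sum_(i < N) (partial i (F i) x)%:E)%E.
  apply/funext => x; rewrite sumEFin; congr EFin.
  rewrite /laplacian !mulr_sumr -sumrB; apply: eq_bigr => i _.
  have sf' := smooth_partial i sf; have sg' := smooth_partial i sg.
  have sm := smooth_mul sg sf'.
  rewrite /F partial_add; [|exact: smooth_mul|by apply: smooth_mul => //; exact: smooth_cst].
  rewrite partial_mul// partial_mul//; last exact: smooth_cst.
  rewrite partial_mul//.
  have -> : partial i (fun _ : 'rV[R]_N => -1 : R) x = 0 by exact: derive_cst.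
  move: (f x) (g x) (partial i f x) (partial i g x)
    (partial i (partial i f) x) (partial i (partial i g) x) => *; ring.
rewrite integral_sum//.
  by rewrite big1// => i _; exact: integral_partial.
move=> i; apply: integrable_continuous.
  by apply: smooth_continuous; exact: smooth_partial.
exact: partial_vanishes.
Qed.

(** The energy density of [Delta^2 - Delta^2 Phi / Phi] at [Phi v], up to a
    divergence, as a sum of two terms which are nonnegative as soon as [Phi] and
    [- Delta Phi] are. *)
Definition remainder (Phi v : 'rV[R]_N -> R) (x : 'rV[R]_N) : R :=
  (laplacian (fun y => Phi y * v y) x - v x * laplacian Phi x) ^+ 2 +
  2 * (- laplacian Phi x) * Phi x * \sum_(i < N) partial i v x ^+ 2.

(** With [w = Phi v^2], the integrand on the left exceeds the one on the right
    by [Delta Phi * Delta w - w * Delta^2 Phi], which has integral zero by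
    Green's formula. *)
Lemma ground_state_identity (Phi v : 'rV[R]_N -> R) :
  smooth Phi -> smooth v -> vanishes_off_ball v ->
  (\int[mu]_x (laplacian (fun y => Phi y * v y) x ^+ 2)%:E =
   \int[mu]_x (laplacian (laplacian Phi) x * Phi x * v x ^+ 2 + remainder Phi v x)%:E)%E.
Proof.
move=> sP sv vv.
have sw := smooth_laplacian sP.
have su := smooth_mul sP sv.
have svv := smooth_mul sv sv.
have sg := smooth_mul sP svv.
have slu := smooth_laplacian su; have slg := smooth_laplacian sg.
have slw := smooth_laplacian sw.
have vg : vanishes_off_ball (fun x => Phi x * (v x * v x)).
  by apply: vanishes_mulr; exact: vanishes_mulr.
have vu : vanishes_off_ball (fun x => Phi x * v x) by exact: vanishes_mulr.
have E x : laplacian (laplacian Phi) x * Phi x * v x ^+ 2 + remainder Phi v x =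
    laplacian (fun y => Phi y * v y) x ^+ 2 +
    (-1) * (laplacian Phi x * laplacian (fun x => Phi x * (v x * v x)) x -
     Phi x * (v x * v x) * laplacian (laplacian Phi) x).
  rewrite /remainder !laplacian_mul//.
  have -> : \sum_(i < N) partial i v x ^+ 2 = \sum_(i < N) partial i v x * partial i v x.
    by apply: eq_bigr => i _; rewrite expr2.
  have -> : \sum_(i < N) partial i Phi x * partial i (fun x => v x * v x) x =
      2 * v x * \sum_(i < N) partial i Phi x * partial i v x.
    by rewrite mulr_sumr; apply: eq_bigr => i _; rewrite partial_mul//; ring.
  set G := \sum_(i < N) partial i Phi x * partial i v x.
  set D := \sum_(i < N) partial i v x * partial i v x.
  move: (laplacian (laplacian Phi) x) (Phi x) (v x) G D (laplacian Phi x) (laplacian v x).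
  by move=> *; ring.
under [RHS]eq_integral do rewrite E EFinD.
have cl : continuous (fun x => laplacian (fun y => Phi y * v y) x ^+ 2).
  move=> x; apply: (@continuous_comp _ _ _ (laplacian _) (fun t => t ^+ 2)).
    exact: smooth_continuous.
  exact: exprn_continuous.
have vl : vanishes_off_ball (fun x => laplacian (fun y => Phi y * v y) x ^+ 2).
  by have [M HM] := laplacian_vanishes vu; exists M => x /HM ->; rewrite expr0n.
have cG : continuous (fun x => laplacian Phi x * laplacian (fun x => Phi x * (v x * v x)) x -
     Phi x * (v x * v x) * laplacian (laplacian Phi) x).
  by apply: smooth_continuous; apply: smooth_add; [|apply: smooth_opp]; exact: smooth_mul.
have vG : vanishes_off_ball (fun x => laplacian Phi x *
     laplacian (fun x => Phi x * (v x * v x)) x -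
     Phi x * (v x * v x) * laplacian (laplacian Phi) x).
  apply: vanishes_add; first by apply: vanishes_mulr; exact: laplacian_vanishes.
  have [M HM] := vg; exists M => x /HM ->; by rewrite mul0r oppr0.
have iG := integrable_continuous cG vG.
rewrite integralD//; last 2 first.
- exact: integrable_continuous cl vl.
- under eq_fun do rewrite EFinM; exact: integrableZl.
under [X in _ = (_ + X)%E]eq_integral do rewrite EFinM.
by rewrite integralZl// integral_green// mule0 adde0.
Qed.

End integral_partial.

(** * The multipolar ground state *)

Section poles.
Context {R : realType} {N n : nat}.
Variable a : 'I_n -> 'rV[R]_N.
Implicit Types (x : 'rV[R]_N) (c : 'I_n -> R) (m : 'I_N) (i j : 'I_n).
Local Notation e m := (delta_mx ord0 m : 'rV[R]_N).

Definition dist2 i x : R := sqnorm (x - a i).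
Definition dprod x : R := \prod_i dist2 i x.
Definition off_poles x : Prop := 0 < dprod x.

Lemma dist2_ge0 i x : 0 <= dist2 i x.
Proof. by apply: sumr_ge0 => m _; exact: sqr_ge0. Qed.

Lemma dist2_gt0 i x : off_poles x -> 0 < dist2 i x.
Proof.
move=> ox; rewrite lt_neqAle dist2_ge0 andbT eq_sym; apply/eqP => q0.
by move: ox; rewrite /off_poles /dprod (bigD1 i)//= q0 mul0r ltxx.
Qed.

Lemma off_polesP x : off_poles x <-> forall i, x != a i.
Proof.
split=> [ox i|xa].
  apply/eqP => xi; have := dist2_gt0 i ox.
  rewrite /dist2 xi subrr /sqnorm big1 ?ltxx// => m _.
  by rewrite mxE expr0n.
rewrite /off_poles /dprod; apply: prodr_gt0 => i _.
rewrite lt_neqAle dist2_ge0 andbT eq_sym; apply: contra (xa i).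
rewrite /dist2 /sqnorm psumr_eq0 => [/allP H|m _]; last exact: sqr_ge0.
apply/eqP/rowP => m; apply/eqP; rewrite -subr_eq0.
have := H m; rewrite mem_index_enum => /(_ isT).
by rewrite sqrf_eq0 !mxE.
Qed.

Lemma is_derive_dist2 i m x :
  is_derive x (e m) (dist2 i) (2 * (x ord0 m - a i ord0 m)).
Proof.
have -> : dist2 i = fun x => \sum_k (x ord0 k - a i ord0 k) ^+ 2.
  by apply/funext => y; apply: eq_bigr => k _; rewrite !mxE.
have dk k : is_derive x (e m) (fun y : 'rV[R]_N => (y ord0 k - a i ord0 k) ^+ 2)
    (2 * (x ord0 k - a i ord0 k) * (k == m)%:R).
  have := is_derive_add (is_derive_coord k m x) (is_derive_cst (- a i ord0 k) x (e m)).
  by rewrite addr0 => /(is_derive_pow 2); rewrite expr1.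
apply: is_derive_eq (@is_derive_bigsum R _ 'I_N (index_enum _) xpredT _ x (e m) _
  (fun k _ => dk k)) _.
rewrite (bigD1 m)//= eqxx mulr1 big1 ?addr0// => k km.
by rewrite (negbTE km) mulr0.
Qed.

Lemma smooth_dist2 i : smooth (dist2 i).
Proof.
have -> : dist2 i = fun x => \sum_k (x ord0 k + - a i ord0 k) * (x ord0 k + - a i ord0 k).
  by apply/funext => y; apply: eq_bigr => k _; rewrite !mxE expr2.
apply: smooth_sum => k _; apply: smooth_mul; apply: smooth_add;
  by [exact: smooth_coord|exact: smooth_cst].
Qed.

Lemma smooth_dprod : smooth dprod.
Proof. by apply: smooth_prod => i _; exact: smooth_dist2. Qed.

Lemma near_off_poles x : off_poles x -> \near x, off_poles x.
Proof.
move=> ox; have : open [set y | off_poles y].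
  have -> : [set y | off_poles y] = dprod @^-1` [set r : R | 0 < r] by [].
  by apply: open_comp => [y _|]; [exact: smooth_continuous smooth_dprod y|exact: open_gt].
by move=> oA; apply: open_nbhs_nbhs.
Qed.

(** The derivatives are given as explicit functions, so that the Laplacian of a
    composite can be read off; nothing is claimed at the poles. *)
Definition twice_derivable (f : 'rV[R]_N -> R) (f1 f2 : 'I_N -> 'rV[R]_N -> R) :=
  forall x m, off_poles x ->
    is_derive x (e m) f (f1 m x) /\ is_derive x (e m) (f1 m) (f2 m x).

Lemma twice_partial f f1 f2 x m : twice_derivable f f1 f2 -> off_poles x ->
  partial m f x = f1 m x.
Proof. by move=> tf ox; apply: partialE; exact: (tf x m ox).1. Qed.

Lemma twice_laplacian f f1 f2 x : twice_derivable f f1 f2 -> off_poles x ->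
  laplacian f x = \sum_m f2 m x.
Proof.
move=> tf ox; apply: eq_bigr => m _; apply: partialE.
have n0 : \near x, f1 m x = partial m f x.
  by apply: filterS (near_off_poles ox) => y oy; rewrite (twice_partial m tf).
exact: near_eq_is_derive n0 (tf x m ox).2.
Qed.

Lemma twice_add f f1 f2 g g1 g2 : twice_derivable f f1 f2 ->
  twice_derivable g g1 g2 ->
  twice_derivable (fun x => f x + g x) (fun m x => f1 m x + g1 m x)
    (fun m x => f2 m x + g2 m x).
Proof.
move=> tf tg x m ox; have [a1 a2] := tf x m ox; have [b1 b2] := tg x m ox.
by split; exact: is_derive_add.
Qed.

Lemma twice_scale k f f1 f2 : twice_derivable f f1 f2 ->
  twice_derivable (fun x => k * f x) (fun m x => k * f1 m x) (fun m x => k * f2 m x).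
Proof.
move=> tf x m ox; have [a1 a2] := tf x m ox.
have H g dg : is_derive x (e m) g dg -> is_derive x (e m) (fun y => k * g y) (k * dg).
  move=> Hg; apply: is_derive_eq (is_derive_mul (is_derive_cst k x (e m)) Hg) _.
  by rewrite mulr0 addr0.
by split; exact: H.
Qed.

Lemma twice_bigsum (I : Type) (r : seq I) (P : pred I)
    (f : I -> 'rV[R]_N -> R) f1 f2 :
  (forall t, twice_derivable (f t) (f1 t) (f2 t)) ->
  twice_derivable (fun x => \sum_(t <- r | P t) f t x)
    (fun m x => \sum_(t <- r | P t) f1 t m x) (fun m x => \sum_(t <- r | P t) f2 t m x).
Proof.
move=> tf x m ox; split; apply: is_derive_bigsum => t _; have [] := tf t x m ox; by [].
Qed.

Lemma twice_comp (F F1 F2 : R -> R) g g1 g2 :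
  (forall t : R, is_derive t 1 F (F1 t)) -> (forall t : R, is_derive t 1 F1 (F2 t)) ->
  twice_derivable g g1 g2 ->
  twice_derivable (fun x => F (g x)) (fun m x => F1 (g x) * g1 m x)
    (fun m x => F2 (g x) * g1 m x ^+ 2 + F1 (g x) * g2 m x).
Proof.
move=> dF dF1 tg x m ox; have [b1 b2] := tg x m ox; split.
  exact: is_derive_comp1.
apply: is_derive_eq (is_derive_mul (is_derive_comp1 (dF1 _) b1) b2) _.
by rewrite addrC; congr (_ + _); ring.
Qed.

(** The logarithm of the product of the [|x - a_i|^(2 c_i)], followed by its
    first and its pure second partial derivatives. *)
Definition ell c x : R := \sum_i c i * ln (dist2 i x).
Definition grad_ell c m x : R :=
  \sum_i c i * (2 * (x ord0 m - a i ord0 m) / dist2 i x).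
Definition hess_ell c m x : R :=
  \sum_i c i * (2 / dist2 i x - 4 * (x ord0 m - a i ord0 m) ^+ 2 / dist2 i x ^+ 2).

Lemma twice_ell c : twice_derivable (ell c) (grad_ell c) (hess_ell c).
Proof.
apply: twice_bigsum => i; apply: (@twice_scale (c i) _
  (fun m x => 2 * (x ord0 m - a i ord0 m) / dist2 i x)
  (fun m x => 2 / dist2 i x - 4 * (x ord0 m - a i ord0 m) ^+ 2 / dist2 i x ^+ 2)).
move=> x m ox; have q0 := dist2_gt0 i ox; have qn0 : dist2 i x != 0 by rewrite gt_eqF.
have dq := is_derive_dist2 i m x; split.
  apply: is_derive_eq (is_derive_comp1 (is_derive1_ln q0) dq) _.
  by rewrite mulrC.
have dV : is_derive (dist2 i x) 1 (fun t : R => t^-1) (- (dist2 i x ^+ 2)^-1).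
  apply: is_derive_eq (is_deriveV qn0 (is_derive_id _ _)) _.
  by rewrite scaleRE mulr1.
have d1 := is_derive_add (is_derive_coord m m x) (is_derive_cst (- a i ord0 m) x (e m)).
have d2 := is_derive_mul (is_derive_cst (2 : R) x (e m)) d1.
apply: is_derive_eq (is_derive_mul d2 (is_derive_comp1 dV dq)) _.
by rewrite eqxx /cst/= ?mulr1n; field.
Qed.

(** The reciprocal distances enter the Laplacians through a weighted sum and
    through this quadratic form, which absorbs the scalar products. *)
Definition winv c x : R := \sum_i c i / dist2 i x.
Definition dform c x : R :=
  \sum_i \sum_j c i * c j * sqnorm (a i - a j) / (dist2 i x * dist2 j x).

Lemma sum_hess_ell c x : off_poles x ->
  \sum_m hess_ell c m x = (2 * N%:R - 4) * winv c x.
Proof.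
move=> ox; rewrite /hess_ell exchange_big/= /winv mulr_sumr; apply: eq_bigr => i _.
have qn0 : dist2 i x != 0 by rewrite gt_eqF ?dist2_gt0.
rewrite -mulr_sumr sumrB sumr_const card_ord -mulr_suml -mulr_sumr.
have -> : \sum_m (x ord0 m - a i ord0 m) ^+ 2 = dist2 i x.
  by apply: eq_bigr => m _; rewrite !mxE.
by rewrite -[_ *+ N]mulr_natr; field.
Qed.

Lemma scalar_product i j x :
  2 * \sum_m (x ord0 m - a i ord0 m) * (x ord0 m - a j ord0 m) =
  dist2 i x + dist2 j x - sqnorm (a i - a j).
Proof.
rewrite /dist2 /sqnorm -big_split -sumrB mulr_sumr; apply: eq_bigr => m _ /=.
by rewrite !mxE; ring.
Qed.

(** The scalar products of [x - a_i] and [x - a_j] are eliminated by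
    polarisation, which is where the [|a_i - a_j|^2] come from. *)
Lemma sum_grad_ell c d x : off_poles x ->
  \sum_m grad_ell c m x * grad_ell d m x =
  2 * (\sum_i c i * winv d x + \sum_i d i * winv c x) -
  2 * \sum_i \sum_j c i * d j * sqnorm (a i - a j) / (dist2 i x * dist2 j x).
Proof.
move=> ox.
have -> : \sum_m grad_ell c m x * grad_ell d m x = \sum_i \sum_j
    c i * d j * (2 * (2 * \sum_m (x ord0 m - a i ord0 m) * (x ord0 m - a j ord0 m)) /
    (dist2 i x * dist2 j x)).
  transitivity (\sum_m \sum_i \sum_j (c i * (2 * (x ord0 m - a i ord0 m) / dist2 i x)) *
      (d j * (2 * (x ord0 m - a j ord0 m) / dist2 j x))).
    by apply: eq_bigr => m _; rewrite /grad_ell mulr_suml; apply: eq_bigr => i _; rewrite mulr_sumr.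
  rewrite exchange_big; apply: eq_bigr => i _; rewrite exchange_big; apply: eq_bigr => j _ /=.
  have qi : dist2 i x != 0 by rewrite gt_eqF ?dist2_gt0.
  have qj : dist2 j x != 0 by rewrite gt_eqF ?dist2_gt0.
  move: (dist2 i x) (dist2 j x) qi qj => u v u0 v0.
  rewrite !mulr_sumr mulr_suml mulr_sumr; apply: eq_bigr => m _.
  by field; rewrite u0 v0.
have -> : \sum_i c i * winv d x = \sum_i \sum_j c i * d j / dist2 j x.
  apply: eq_bigr => i _; rewrite /winv mulr_sumr; apply: eq_bigr => j _.
  by rewrite mulrA.
have -> : \sum_i d i * winv c x = \sum_i \sum_j c i * d j / dist2 i x.
  rewrite exchange_big/=; apply: eq_bigr => i _; rewrite /winv mulr_sumr; apply: eq_bigr => j _.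
  by rewrite mulrA [d i * _]mulrC.
rewrite -big_split/= !mulr_sumr -sumrB; apply: eq_bigr => i _.
rewrite -big_split/= !mulr_sumr -sumrB; apply: eq_bigr => j _ /=.
rewrite scalar_product.
have qi : dist2 i x != 0 by rewrite gt_eqF ?dist2_gt0.
have qj : dist2 j x != 0 by rewrite gt_eqF ?dist2_gt0.
by field; rewrite qi qj.
Qed.

Lemma sum_grad_ell_sqr c x : off_poles x ->
  \sum_m grad_ell c m x ^+ 2 = 4 * (\sum_i c i) * winv c x - 2 * dform c x.
Proof.
move=> ox; transitivity (\sum_m grad_ell c m x * grad_ell c m x).
  by apply: eq_bigr => m _; rewrite expr2.
by rewrite sum_grad_ell// -mulr_suml /dform; ring.
Qed.

Lemma laplacian_comp_ell (F F1 F2 : R -> R) c x :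
  (forall t : R, is_derive t 1 F (F1 t)) -> (forall t : R, is_derive t 1 F1 (F2 t)) ->
  off_poles x ->
  laplacian (fun x => F (ell c x)) x =
  F2 (ell c x) * (4 * (\sum_i c i) * winv c x - 2 * dform c x) +
  F1 (ell c x) * ((2 * N%:R - 4) * winv c x).
Proof.
move=> dF dF1 ox; rewrite (twice_laplacian (twice_comp dF dF1 (twice_ell c)) ox).
by rewrite big_split/= -!mulr_sumr sum_grad_ell_sqr// sum_hess_ell.
Qed.

Definition power c x : R := expR (ell c x).

Let twice_power c := twice_comp (fun t => is_derive_expR t) (fun t => is_derive_expR t)
  (twice_ell c).

(** The family of the products of powers of the distances is stable under the
    Laplacian, up to division by squared distances. *)
Lemma laplacian_power c x : off_poles x ->
  laplacian (power c) x = power c x *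
    ((4 * (\sum_i c i) + 2 * N%:R - 4) * winv c x - 2 * dform c x).
Proof.
move=> ox; rewrite /power (laplacian_comp_ell c (fun t => is_derive_expR t) (fun t => is_derive_expR t) ox).
by ring.
Qed.

Definition dpole i : 'I_n -> R := fun k => (k == i)%:R.

Lemma powerB c i x : off_poles x ->
  power (fun k => c k - dpole i k) x = power c x / dist2 i x.
Proof.
move=> ox; rewrite /power /ell.
under eq_bigr do rewrite mulrBl.
rewrite sumrB expRB; congr (_ / _).
rewrite (bigD1 i)//= /dpole eqxx mul1r big1 ?addr0 => [|k /negbTE ->]; last by rewrite mul0r.
by rewrite lnK// posrE dist2_gt0.
Qed.

Lemma sum_dpole i : \sum_k dpole i k = 1.
Proof.
rewrite (bigD1 i)//= /dpole eqxx big1 ?addr0// => k /negbTE ->; by [].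
Qed.

Lemma sqnorm0 : sqnorm (0 : 'rV[R]_N) = 0.
Proof. by rewrite /sqnorm big1// => m _; rewrite mxE expr0n. Qed.

Lemma sqnormBC (x y : 'rV[R]_N) : sqnorm (x - y) = sqnorm (y - x).
Proof. by apply: eq_bigr => m _; rewrite !mxE; ring. Qed.

(** The exponent making the biharmonic operator act on the ground state as a
    multiplication. *)
Definition gexp : R := - ((N%:R - 4) / (2 * n%:R)).
Definition ground : 'rV[R]_N -> R := power (fun=> gexp).
Definition rho x : R := winv (fun=> 1) x.
Definition dform1 x : R := dform (fun=> 1) x.

Hypothesis n0 : (0 < n)%N.

Let nR : n%:R != 0 :> R. Proof. by rewrite pnatr_eq0 -lt0n. Qed.

Lemma sum_gexp : \sum_(i < n) gexp = - (N%:R - 4) / 2.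
Proof.
by rewrite sumr_const card_ord -mulr_natr /gexp; field.
Qed.

Lemma winv_cst (k : R) x : winv (fun=> k) x = k * rho x.
Proof. by rewrite /rho /winv mulr_sumr; apply: eq_bigr => i _; rewrite mul1r. Qed.

Lemma dform_cst (k : R) x : dform (fun=> k) x = k ^+ 2 * dform1 x.
Proof.
rewrite /dform1 /dform mulr_sumr; apply: eq_bigr => i _.
by rewrite mulr_sumr; apply: eq_bigr => j _; rewrite !mul1r expr2 !mulrA.
Qed.

Definition lapl_ground x : R := ground x * (4 * gexp * rho x - 2 * gexp ^+ 2 * dform1 x).

Lemma laplacian_ground x : off_poles x -> laplacian ground x = lapl_ground x.
Proof.
move=> ox; rewrite /ground laplacian_power// sum_gexp winv_cst dform_cst /lapl_ground /ground.
by field.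
Qed.

(** [lapl_ground] is a combination of powers whose exponents are lowered at
    one or two poles, so [laplacian_power] applies to each term. The
    coefficient of [winv] there is [0] when one pole is lowered and [-4] when
    two are. The [dform] terms of the first kind can be rewritten as [winv]
    terms, and cancel those of the second kind; only the [dform] terms of the
    second kind are left. *)
Lemma laplacian_lapl_ground x : off_poles x ->
  laplacian lapl_ground x = 4 * gexp ^+ 2 * ground x *
    \sum_i \sum_j sqnorm (a i - a j) / (dist2 i x * dist2 j x) *
      dform (fun k => gexp - dpole i k - dpole j k) x.
Proof.
move=> ox; set g := gexp.
pose G y := \sum_i (4 * g) * power (fun k => g - dpole i k) y +
  \sum_i \sum_j (- 2 * g ^+ 2 * sqnorm (a i - a j)) * power (fun k => g - dpole i k - dpole j k) y.
have GE : \near x, lapl_ground x = G x.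
  apply: filterS (near_off_poles ox) => y oy.
  rewrite /lapl_ground mulrBr; congr (_ + _).
    rewrite /rho /winv !mulr_sumr; apply: eq_bigr => i _.
    by rewrite (powerB (fun=> g))// /ground; ring.
  transitivity (- (ground y * (2 * gexp ^+ 2)) * dform1 y); first by ring.
  rewrite /dform1 /dform [LHS]mulr_sumr; apply: eq_bigr => i _.
  rewrite [LHS]mulr_sumr; apply: eq_bigr => j _.
  rewrite (powerB (fun k => g - dpole i k))// (powerB (fun=> g))// /ground !mul1r invfM.
  by ring.
rewrite (near_eq_laplacian GE).
have tG := twice_add
  (twice_bigsum (index_enum _) xpredT (fun i => twice_scale (4 * g) (twice_power (fun k => g - dpole i k))))
  (twice_bigsum (index_enum _) xpredT (fun i =>
   twice_bigsum (index_enum _) xpredT (fun j =>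
    twice_scale (- 2 * g ^+ 2 * sqnorm (a i - a j)) (twice_power (fun k => g - dpole i k - dpole j k))))).
rewrite (twice_laplacian tG ox) big_split/=.
have lp c : \sum_m (expR (ell c x) * grad_ell c m x ^+ 2 + expR (ell c x) * hess_ell c m x) =
    power c x * ((4 * (\sum_i c i) + 2 * N%:R - 4) * winv c x - 2 * dform c x).
  by rewrite -laplacian_power// (twice_laplacian (twice_power c) ox).
have -> : \sum_m \sum_i 4 * g * (expR (ell (fun k => g - dpole i k) x) *
      grad_ell (fun k => g - dpole i k) m x ^+ 2 +
      expR (ell (fun k => g - dpole i k) x) * hess_ell (fun k => g - dpole i k) m x) =
    \sum_i - (8 * g) * (ground x / dist2 i x) * dform (fun k => g - dpole i k) x.
  rewrite exchange_big; apply: eq_bigr => i _ /=.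
  rewrite -mulr_sumr lp (powerB (fun=> g))// sumrB sum_gexp sum_dpole -/(ground x).
  by field; rewrite gt_eqF ?dist2_gt0.
have -> : \sum_m \sum_i \sum_j - 2 * g ^+ 2 * sqnorm (a i - a j) *
    (expR (ell (fun k => g - dpole i k - dpole j k) x) *
      grad_ell (fun k => g - dpole i k - dpole j k) m x ^+ 2 +
      expR (ell (fun k => g - dpole i k - dpole j k) x) *
      hess_ell (fun k => g - dpole i k - dpole j k) m x) =
    \sum_i \sum_j (- 2 * g ^+ 2 * sqnorm (a i - a j)) *
      (ground x / (dist2 i x * dist2 j x) *
       (- 4 * winv (fun k => g - dpole i k - dpole j k) x -
        2 * dform (fun k => g - dpole i k - dpole j k) x)).
  rewrite exchange_big; apply: eq_bigr => i _ /=.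
  rewrite exchange_big; apply: eq_bigr => j _ /=.
  rewrite -mulr_sumr lp (powerB (fun k => g - dpole i k))// (powerB (fun=> g))//.
  rewrite !sumrB sum_gexp !sum_dpole -/(ground x).
  by field; rewrite !gt_eqF ?dist2_gt0.
have winvE i j : winv (fun k => g - dpole i k - dpole j k) x =
    g * rho x - (dist2 i x)^-1 - (dist2 j x)^-1.
  have H l : \sum_k dpole l k / dist2 k x = (dist2 l x)^-1.
    rewrite (bigD1 l)//= /dpole eqxx mul1r big1 ?addr0// => k /negbTE ->.
    by rewrite mul0r.
  rewrite -(H i) -(H j) -winv_cst /winv -!sumrB; apply: eq_bigr => k _.
  by rewrite !mulrBl.
(* Once the sum over the lowered pole is inside, the product of the two
   indicators contributes nothing, since it forces [a_k = a_l]. *)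
have -> : \sum_i - (8 * g) * (ground x / dist2 i x) * dform (fun k => g - dpole i k) x =
    \sum_k \sum_l - (8 * g ^+ 2) * ground x * (sqnorm (a k - a l) / (dist2 k x * dist2 l x)) *
      winv (fun i => g - dpole k i - dpole l i) x.
  transitivity (\sum_k \sum_l \sum_i - (8 * g) * (ground x / dist2 i x) *
      ((g - dpole i k) * (g - dpole i l) * sqnorm (a k - a l) / (dist2 k x * dist2 l x))).
    transitivity (\sum_i \sum_k \sum_l - (8 * g) * (ground x / dist2 i x) *
      ((g - dpole i k) * (g - dpole i l) * sqnorm (a k - a l) / (dist2 k x * dist2 l x))).
      by apply: eq_bigr => i _; rewrite /dform mulr_sumr; apply: eq_bigr => k _; rewrite mulr_sumr.
    by rewrite exchange_big; apply: eq_bigr => k _; rewrite exchange_big.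
  apply: eq_bigr => k _; apply: eq_bigr => l _.
  rewrite /winv [RHS]mulr_sumr; apply: eq_bigr => i _.
  have -> : dpole i k = dpole k i by rewrite /dpole eq_sym.
  have -> : dpole i l = dpole l i by rewrite /dpole eq_sym.
  have : dpole k i * dpole l i * sqnorm (a k - a l) = 0.
    rewrite /dpole; case: eqP => [<-|_]; last by rewrite !mul0r.
    by case: eqP => [<-|_]; rewrite ?mulr0 ?mul0r// subrr sqnorm0 mulr0.
  move: (dpole k i) (dpole l i) (sqnorm (a k - a l)) (ground x) => u v s p uvs.
  have -> : (g - u) * (g - v) * s = (g * (g - u - v)) * s by rewrite -[RHS]addr0 -uvs; ring.
  by field; rewrite !gt_eqF ?dist2_gt0.
rewrite -big_split/= mulr_sumr; apply: eq_bigr => i _.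
rewrite -big_split/= mulr_sumr; apply: eq_bigr => j _ /=.
move: (winv _ x) (dform _ x) (ground x) (sqnorm _) => w d p s.
by field; rewrite !gt_eqF ?dist2_gt0.
Qed.

Lemma sum_sym_pairs (f : 'I_n -> 'I_n -> R) : (forall i j, f i j = f j i) ->
  (forall i, f i i = 0) ->
  \sum_i \sum_j f i j = 2 * \sum_(i < n) \sum_(j < n | (i < j)%N) f i j.
Proof.
move=> fC f0.
have -> : \sum_i \sum_j f i j = \sum_(i < n) \sum_(j < n | (i < j)%N) f i j +
    \sum_(i < n) \sum_(j < n | (j < i)%N) f i j.
  rewrite -big_split; apply: eq_bigr => i _ /=.
  rewrite (bigID (fun j => (i < j)%N))/=; congr (_ + _).
  rewrite (bigID (fun j => (j < i)%N))/= [X in _ + X]big1 ?addr0.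
    apply: eq_bigl => j; by case: ltngtP.
  move=> j /andP[]; rewrite -!leqNgt => ji ij.
  have -> : j = i by apply/val_inj/eqP; rewrite eqn_leq ji ij.
  exact: f0.
rewrite mulrDl mul1r; congr (_ + _).
rewrite (exchange_big_dep xpredT)//=; apply: eq_bigr => i _; apply: eq_bigr => j _.
exact: fC.
Qed.

Definition lambdaV : R := N%:R ^+ 2 * (N%:R - 4) ^+ 2 / n%:R ^+ 4.

Hypothesis N0 : (0 < N)%N.

Let NR : N%:R != 0 :> R. Proof. by rewrite pnatr_eq0 -lt0n. Qed.

(** Up to the factor [- N / (2 n)], the lowered exponents [g - dpole i k -
    dpole j k] are the coefficients [nu k i j]. *)
Lemma V_E x : lambdaV * V_ a x = 4 * gexp ^+ 2 *
    \sum_i \sum_j sqnorm (a i - a j) / (dist2 i x * dist2 j x) *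
      dform (fun k => gexp - dpole i k - dpole j k) x.
Proof.
have dE i j : (i < j)%N -> dform (fun k => gexp - dpole i k - dpole j k) x =
    N%:R ^+ 2 / (2 * n%:R ^+ 2) *
    \sum_(k < n) \sum_(l < n | (k < l)%N) @nu R N n k i j * @nu R N n l i j * sqnorm (a k - a l) /
       (sqnorm (x - a k) * sqnorm (x - a l)).
  move=> ij.
  have nuE k : gexp - dpole i k - dpole j k = - (N%:R / (2 * n%:R)) * @nu R N n k i j :> R.
    rewrite /nu /dpole; case: (eqVneq k i) => [->|ki] /=.
      by rewrite (_ : (i == j) = false) ?subr0; [rewrite /gexp; field; rewrite NR nR|
        apply/eqP => ije; rewrite ije ltnn in ij].
    by case: (k == j) => /=; rewrite /gexp; field; rewrite NR nR.
  rewrite /dform sum_sym_pairs; first last.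
  - by move=> k; rewrite subrr sqnorm0 mulr0 mul0r.
  - by move=> k l; rewrite sqnormBC [dist2 k x * _]mulrC; congr (_ * _ / _); rewrite mulrC.
  rewrite [LHS]mulr_sumr [RHS]mulr_sumr; apply: eq_bigr => k _.
  rewrite [LHS]mulr_sumr [RHS]mulr_sumr; apply: eq_bigr => l _.
  rewrite !nuE /dist2; move: (sqnorm (a k - a l)) (sqnorm (x - a k) * sqnorm (x - a l))^-1 => z w.
  by move: (nu k i j) (nu l i j) => s t; field.
rewrite sum_sym_pairs; first last.
- by move=> i; rewrite subrr sqnorm0 !mul0r.
- move=> i j; rewrite sqnormBC [dist2 i x * _]mulrC; congr (_ * _).
  by congr dform; apply/funext => k; ring.
rewrite [RHS]mulrA /V_ [LHS]mulr_sumr [RHS]mulr_sumr; apply: eq_bigr => i _.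
rewrite [LHS]mulr_sumr [RHS]mulr_sumr; apply: eq_bigr => j ij.
rewrite dE// /lambdaV /gexp /dist2; move: (\sum_k _) (sqnorm (a i - a j)) (sqnorm (x - a i) * sqnorm (x - a j))^-1 => s d z.
by field.
Qed.

Lemma bilaplacian_ground x : off_poles x ->
  laplacian lapl_ground x = lambdaV * V_ a x * ground x.
Proof. by move=> ox; rewrite laplacian_lapl_ground// V_E; ring. Qed.

End poles.

(** * Cutoffs near the poles and near infinity *)

Section cutoff.
Context {R : realType} {N n : nat}.
Variable a : 'I_n -> 'rV[R]_N.
Hypotheses (N5 : (5 <= N)%N) (n2 : (2 <= n)%N).
Implicit Types (x : 'rV[R]_N) (c : R) (m : 'I_N) (i j : 'I_n) (k : nat).
Notation P := (dprod a).
Notation off := (off_poles a).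
Notation Phi := (ground a).
Notation g := (@gexp R N n).

Let NR5 : (5 : R) <= N%:R. Proof. by rewrite (ler_nat R 5 N). Qed.
Let nR2 : (2 : R) <= n%:R. Proof. by rewrite (ler_nat R 2 n). Qed.
Let n0 : (0 < n)%N. Proof. exact: leq_trans n2. Qed.
Let N0 : (0 < N)%N. Proof. exact: leq_trans N5. Qed.

Lemma gexp_lt0 : g < 0.
Proof.
rewrite /gexp oppr_lt0 divr_gt0//; first by have := NR5; lra.
by rewrite mulr_gt0// ltr0n.
Qed.

Definition log_dprod x : R := ell a (fun=> 1) x.
Notation L := log_dprod.

Lemma ln_dprod x : off x -> ln (P x) = L x.
Proof.
move=> ox; have PE : expR (L x) = P x.
  rewrite /log_dprod /ell expR_sum; apply: eq_bigr => i _.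
  by rewrite mul1r lnK// posrE dist2_gt0.
by rewrite -PE expRK.
Qed.

Lemma expR_log_dprod x : off x -> expR (L x) = P x.
Proof. by move=> ox; rewrite -ln_dprod// lnK// posrE. Qed.

Lemma groundE x : Phi x = expR (g * L x).
Proof.
rewrite /ground /power /log_dprod /ell mulr_sumr; congr expR.
by apply: eq_bigr => i _; rewrite mul1r.
Qed.

Lemma ground_gt0 x : 0 < Phi x.
Proof. exact: expR_gt0. Qed.

(** Interpolates between [P] and the constant [c / 2], so as to have a smooth
    logarithm across the poles. *)
Definition reg c x : R :=
  let s := smooth_step ((P x - c / 2) / (c / 2)) in P x * s + (1 - s) * (c / 2).

Lemma reg_eq c x : 0 < c -> c <= P x -> reg c x = P x.
Proof.
move=> c0 cP; rewrite /reg smooth_step1; first by rewrite subrr mul0r mulr1 addr0.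
by rewrite ler_pdivlMr; lra.
Qed.

Lemma reg_gt0 c x : 0 < c -> 0 < reg c x.
Proof.
move=> c0; rewrite /reg; set s := smooth_step _.
have s0 : 0 <= s := smooth_step_ge0 _; have s1 : s <= 1 := smooth_step_le1 _.
have [Pc|Pc] := leP (P x) (c / 2).
  rewrite /s smooth_step0 ?mulr0 ?add0r ?subr0 ?mul1r; first lra.
  by rewrite pmulr_lle0 ?invr_gt0; lra.
have [->|s1'] := eqVneq s 1; first by rewrite subrr mul0r addr0 mulr1; lra.
rewrite ltr_wpDl//; first by rewrite mulr_ge0//; lra.
by rewrite mulr_gt0//; [rewrite subr_gt0 lt_neqAle s1'|lra].
Qed.

Lemma reg_le c x : 0 < c -> P x <= c -> reg c x <= c.
Proof.
move=> c0 Pc; rewrite /reg; set s := smooth_step _.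
have s0 : 0 <= s := smooth_step_ge0 _; have s1 : s <= 1 := smooth_step_le1 _.
have : P x * s <= c * s by rewrite ler_wpM2r.
have : (1 - s) * (c / 2) <= (1 - s) * c by rewrite ler_wpM2l//; lra.
lra.
Qed.

Definition lreg c x : R := ln (reg c x).

Let elem_reg c : 0 < c -> elementary smooth (reg c).
Proof.
move=> c0; have eP : elementary smooth P by apply: elem_gen; exact: smooth_dprod.
have es : elementary smooth (fun x => smooth_step ((P x - c / 2) / (c / 2))).
  apply: elem_smooth_step; apply: elem_mul; last exact: elem_cst.
  by apply: elem_add => //; exact: elem_cst.
apply: elem_add; first exact: elem_mul.
apply: elem_mul; last exact: elem_cst.
by apply: elem_add; [exact: elem_cst|exact: elem_opp].
Qed.

Let elem_lreg c : 0 < c -> elementary smooth (lreg c).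
Proof. by move=> c0; apply: elem_ln => [x|]; [exact: reg_gt0|exact: elem_reg]. Qed.

Lemma lregE c x : 0 < c -> c <= P x -> lreg c x = L x.
Proof. by move=> c0 cP; rewrite /lreg reg_eq// ln_dprod// /off_poles (lt_le_trans c0). Qed.

Lemma near_dprod_gt c x : c < P x -> \near x, c < P x.
Proof.
move=> cx; have : open [set y | c < P y].
  have -> : [set y | c < P y] = P @^-1` [set r : R | c < r] by [].
  apply: open_comp => [y _|]; last exact: open_gt.
  exact: (smooth_continuous (smooth_dprod a)).
by move=> oA; apply: open_nbhs_nbhs.
Qed.

Lemma near_dprod_lt c x : P x < c -> \near x, P x < c.
Proof.
move=> cx; have : open [set y | P y < c].
  have -> : [set y | P y < c] = P @^-1` [set r : R | r < c] by [].
  apply: open_comp => [y _|]; last exact: open_lt.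
  exact: (smooth_continuous (smooth_dprod a)).
by move=> oA; apply: open_nbhs_nbhs.
Qed.

Notation K k := (k.+1%:R : R).

(** With [K = k + 1], descends from [1] to [0] while [|L|] goes from [K] to [2
    K], that is, both near the poles and near infinity; on this logarithmic
    scale each derivative gains a factor [1 / K]. At the level [exp (- 2 K)]
    of the regularisation the bump already vanishes. *)
Definition cutoff k x : R := bump (lreg (expR (- 2 * K k)) x / K k).

Lemma smooth_cutoff k : smooth (cutoff k).
Proof.
apply: elementary_smooth; apply: elem_bump; apply: elem_mul; last exact: elem_cst.
by apply: elem_lreg; exact: expR_gt0.
Qed.

Lemma cutoff_ge0 k x : 0 <= cutoff k x. Proof. exact: bump_ge0. Qed.
Lemma cutoff_le1 k x : cutoff k x <= 1. Proof. exact: bump_le1. Qed.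

Let K1 k : 1 <= K k. Proof. by rewrite ler1n. Qed.
Let K0 k : 0 < K k. Proof. by rewrite ltr0n. Qed.

Lemma cutoff_eq0 k x : P x <= expR (- 2 * K k) -> cutoff k x = 0.
Proof.
move=> Px; have e0 := expR_gt0 (- 2 * K k).
have : lreg (expR (- 2 * K k)) x <= - 2 * K k.
  rewrite -[leRHS]expRK /lreg ler_ln ?posrE ?expR_gt0 ?reg_gt0//.
  exact: reg_le.
move=> H; apply: bump0; have Kk0 := K0 k.
have : lreg (expR (- 2 * K k)) x / K k <= - 2 by rewrite ler_pdivrMr.
by move=> H'; rewrite ler_normr; apply/orP; right; rewrite lerNr.
Qed.

Lemma cutoffE k x : off x -> cutoff k x = bump (L x / K k).
Proof.
move=> ox; have [Px|Px] := leP (P x) (expR (- 2 * K k)); last first.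
  by rewrite /cutoff lregE ?expR_gt0// ltW.
rewrite cutoff_eq0// bump0//; have Kk0 := K0 k.
have : L x <= - 2 * K k by rewrite -ln_dprod// -[leRHS]expRK ler_ln ?posrE ?expR_gt0.
move=> H; have : L x / K k <= - 2 by rewrite ler_pdivrMr.
by move=> H'; rewrite ler_normr; apply/orP; right; rewrite lerNr.
Qed.

Lemma cutoff_cvg x : off x -> exists k0, forall k, (k0 <= k)%N -> `|L x| < K k.
Proof.
move=> ox; exists (Num.bound `|L x|) => k kx.
by apply: lt_le_trans (archi_boundP (normr_ge0 _)) _; rewrite ler_nat leqW.
Qed.

Lemma dist2_large i (M : R) x : `|a i| + M <= `|x| -> 0 <= M -> M ^+ 2 <= dist2 a i x.
Proof.
move=> H M0; apply: le_trans (sqnorm_ge_norm _).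
rewrite ler_sqr ?nnegrE//.
have : `|x| <= `|x - a i| + `|a i|.
  by rewrite -[X in `|X| <= _](subrK (a i)) ler_normD.
lra.
Qed.

(** Far from all the poles every factor is larger than [1], and one of them is
    larger than [M]. *)
Lemma dprod_bounded (M : R) : exists2 B : R, 0 < B & forall x, P x <= M -> `|x| <= B.
Proof.
pose A := \sum_i `|a i|; pose B := A + (1 + `|M|).
have A0 : 0 <= A by apply: sumr_ge0.
have aA i : `|a i| <= A.
  by rewrite /A (bigD1 i)//= lerDl; apply: sumr_ge0.
exists B => [|x]; first by rewrite /B; have := normr_ge0 M; lra.
apply: contraLR; rewrite -!ltNge => Bx.
have qi i : (1 + `|M|) ^+ 2 <= dist2 a i x.
  apply: dist2_large; last by have := normr_ge0 M; lra.
  by have := aA i; rewrite /B in Bx; lra.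
have i0 : 'I_n by exact: (Ordinal n0).
have sq1 : 1 + `|M| <= (1 + `|M|) ^+ 2 by rewrite expr2 ler_pMr; have := normr_ge0 M; lra.
have M1 : 1 + `|M| <= P x.
  rewrite /dprod (bigD1 i0)//=.
  have p1 : 1 <= \prod_(i | i != i0) dist2 a i x.
    elim/big_ind: _ => // [y z y1 z1|i _]; first by rewrite mulr_ege1.
    by apply: le_trans (qi i); have := normr_ge0 M; lra.
  apply: (le_trans sq1); apply: (le_trans (qi i0)).
  by rewrite ler_peMr// dist2_ge0.
by have := ler_norm M; lra.
Qed.

Lemma cutoff_vanishes k : vanishes_off_ball (cutoff k).
Proof.
have [B B0 HB] := dprod_bounded (expR (2 * K k)).
exists B => x Bx; have Kk0 := K0 k.
have Px : expR (2 * K k) < P x by rewrite ltNge; apply/negP => /HB; rewrite leNgt Bx.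
have ox : off x by rewrite /off_poles (lt_trans _ Px)// expR_gt0.
rewrite cutoffE// bump0//.
have : 2 * K k <= L x by rewrite -ln_dprod// -[leLHS]expRK ler_ln ?posrE ?expR_gt0 ?ltW.
by move=> H; rewrite ler_normr; apply/orP; left; rewrite ler_pdivlMr.
Qed.

(** The squared gradient of [L]. *)
Definition gradL2 x : R := 4 * n%:R * rho a x - 2 * dform1 a x.

Lemma sum_one : \sum_(i < n) (1 : R) = n%:R.
Proof. by rewrite sumr_const card_ord. Qed.

Lemma gradL2E x : off x -> \sum_m grad_ell a (fun=> 1) m x ^+ 2 = gradL2 x.
Proof. by move=> ox; rewrite sum_grad_ell_sqr// sum_one. Qed.

Lemma gradL2_ge0 x : off x -> 0 <= gradL2 x.
Proof. by move=> ox; rewrite -gradL2E//; apply: sumr_ge0 => m _; exact: sqr_ge0. Qed.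

Lemma dform1_ge0 x : 0 <= dform1 a x.
Proof.
apply: sumr_ge0 => i _; apply: sumr_ge0 => j _; rewrite !mul1r.
by rewrite divr_ge0// ?mulr_ge0 ?dist2_ge0//; apply: sumr_ge0 => m _; exact: sqr_ge0.
Qed.

Lemma rho_ge0 x : 0 <= rho a x.
Proof. by apply: sumr_ge0 => i _; rewrite mul1r invr_ge0 dist2_ge0. Qed.

Lemma gradL2_le x : gradL2 x <= 4 * n%:R * rho a x.
Proof. by rewrite /gradL2; have := dform1_ge0 x; lra. Qed.

Lemma dform1_le x : off x -> dform1 a x <= 2 * n%:R * rho a x.
Proof. by move=> /gradL2_ge0; rewrite /gradL2; lra. Qed.

Let Fk k (t : R) := bump (t / K k).
Let Fk1 k (t : R) := bump' (t / K k) / K k.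
Let Fk2 k (t : R) := bump'' (t / K k) / K k ^+ 2.

Let dFk (F F1 : R -> R) k (t : R) : (forall t : R, is_derive t 1 F (F1 t)) ->
  is_derive t 1 (fun t => F (t / K k)) (F1 (t / K k) / K k).
Proof.
move=> dF; have d1 : is_derive t 1 (fun t : R => t / K k) (K k)^-1.
  apply: is_derive_eq (is_derive_mul (is_derive_id t 1) (is_derive_cst ((K k)^-1) t 1)) _.
  by rewrite mulr0 add0r mulr1.
exact: is_derive_comp1 (dF _) d1.
Qed.

Let dFk0 k (t : R) : is_derive t 1 (Fk k) (Fk1 k t).
Proof. exact: (dFk k t is_derive_bump). Qed.

Let dFk1 k (t : R) : is_derive t 1 (Fk1 k) (Fk2 k t).
Proof.
have d := dFk k t is_derive_bump'.
apply: is_derive_eq (is_derive_mul d (is_derive_cst ((K k)^-1) t 1)) _.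
by rewrite mulr0 add0r /Fk2 expr2 invfM /cst; ring.
Qed.

Let near_cutoff k x : off x -> \near x, Fk k (ell a (fun=> 1) x) = cutoff k x.
Proof. by move=> ox; apply: filterS (near_off_poles ox) => y oy; rewrite cutoffE. Qed.

Lemma partial_cutoff k x m : off x ->
  partial m (cutoff k) x = bump' (L x / K k) / K k * grad_ell a (fun=> 1) m x.
Proof.
move=> ox; rewrite -(near_eq_partial m (near_cutoff k ox)).
by rewrite (twice_partial m (twice_comp (dFk0 k) (dFk1 k) (@twice_ell R N n a (fun=> 1))) ox).
Qed.

Lemma laplacian_cutoff k x : off x ->
  laplacian (cutoff k) x = bump'' (L x / K k) / K k ^+ 2 * gradL2 x +
    bump' (L x / K k) / K k * ((2 * N%:R - 4) * rho a x).
Proof.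
move=> ox; rewrite -(near_eq_laplacian (near_cutoff k ox)).
by rewrite (laplacian_comp_ell _ (dFk0 k) (dFk1 k) ox) sum_one.
Qed.

Lemma sum_partial_cutoff k x : off x ->
  \sum_m partial m (cutoff k) x ^+ 2 = (bump' (L x / K k) / K k) ^+ 2 * gradL2 x.
Proof.
move=> ox; rewrite -gradL2E// mulr_sumr; apply: eq_bigr => m _.
by rewrite partial_cutoff// exprMn.
Qed.

(** A globally smooth positive function equal to the ground state where
    [c <= P]. *)
Definition gground c x : R := expR (g * lreg c x).

Let elem_gground c : 0 < c -> elementary smooth (gground c).
Proof.
by move=> c0; apply: elem_exp; apply: elem_mul; [exact: elem_cst|exact: elem_lreg].
Qed.

Lemma smooth_gground c : 0 < c -> smooth (gground c).
Proof. by move=> /elem_gground /elementary_smooth. Qed.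

Lemma smooth_ggroundV c : 0 < c -> smooth (fun x => (gground c x)^-1).
Proof.
move=> /elem_gground ec; apply: elementary_smooth; apply: elem_inv => // x.
by rewrite gt_eqF// expR_gt0.
Qed.

Lemma ggroundE c x : 0 < c -> c <= P x -> gground c x = Phi x.
Proof. by move=> c0 cP; rewrite /gground lregE// groundE. Qed.

Lemma near_gground c x : 0 < c -> c < P x -> \near x, gground c x = Phi x.
Proof.
by move=> c0 cP; apply: filterS (near_dprod_gt cP) => y yP; rewrite ggroundE// ltW.
Qed.

Let off_gt c x : 0 < c -> c < P x -> off x.
Proof. by move=> c0; apply: lt_trans. Qed.

Lemma laplacian_gground c x : 0 < c -> c < P x ->
  laplacian (gground c) x = lapl_ground a x.
Proof.
move=> c0 cP; rewrite (near_eq_laplacian (near_gground c0 cP)) laplacian_ground//.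
exact: off_gt cP.
Qed.

Lemma bilaplacian_gground c x : 0 < c -> c < P x ->
  laplacian (laplacian (gground c)) x = @lambdaV R N n * V_ a x * Phi x.
Proof.
move=> c0 cP; transitivity (laplacian (lapl_ground a) x); last first.
  by apply: bilaplacian_ground => //; exact: off_gt cP.
apply: near_eq_laplacian; apply: filterS (near_dprod_gt cP) => y yP.
exact: laplacian_gground.
Qed.

Lemma partial_gground c x m : 0 < c -> c < P x ->
  partial m (gground c) x = Phi x * (g * grad_ell a (fun=> 1) m x).
Proof.
move=> c0 cP; rewrite (near_eq_partial m (near_gground c0 cP)).
rewrite (twice_partial m (twice_comp (fun t => is_derive_expR t)
  (fun t => is_derive_expR t) (@twice_ell R N n a (fun=> g))) (off_gt c0 cP)).
congr (_ * _); rewrite /grad_ell mulr_sumr; apply: eq_bigr => i _.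
by rewrite mul1r.
Qed.

(** The coefficient of the gradient term of [remainder] for the ground state. *)
Definition weight x : R := 2 * (- lapl_ground a x) * Phi x.

Lemma lapl_ground_le0 x : lapl_ground a x <= 0.
Proof.
rewrite /lapl_ground pmulr_rle0 ?ground_gt0//.
have := rho_ge0 x; have := dform1_ge0 x; have := gexp_lt0 => g0 d0 r0.
have : g * rho a x <= 0 by rewrite mulr_le0_ge0// ltW.
have : 0 <= g ^+ 2 * dform1 a x by rewrite mulr_ge0// sqr_ge0.
lra.
Qed.

Lemma weight_ge0 x : 0 <= weight x.
Proof.
rewrite /weight; apply: mulr_ge0; last exact/ltW/ground_gt0.
by apply: mulr_ge0 => //; rewrite oppr_ge0 lapl_ground_le0.
Qed.

(** The terms in [v Delta f] cancel, so that the remainder only involves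
    derivatives of [v]. *)
Lemma remainderE (f v : 'rV[R]_N -> R) x : smooth f -> smooth v ->
  remainder f v x = (f x * laplacian v x + 2 * \sum_m partial m f x * partial m v x) ^+ 2 +
  2 * (- laplacian f x) * f x * \sum_m partial m v x ^+ 2.
Proof.
move=> sf sv; rewrite /remainder laplacian_mul//.
move: (laplacian v x) (laplacian f x) (\sum_m partial m f x * partial m v x) => lv lf s.
by move: (\sum_m _) (f x) (v x) => *; ring.
Qed.

Definition vanishes_where_lt c (v : 'rV[R]_N -> R) := forall x, P x < c -> v x = 0.

Lemma partial_vanishes_where c v x m : vanishes_where_lt c v -> P x < c ->
  partial m v x = 0.
Proof.
move=> vv Px; rewrite (near_eq_partial (g := cst 0)); first exact: derive_cst.
by apply: filterS (near_dprod_lt Px) => y /vv ->.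
Qed.

(** The regularised ground state differs from the ground state only where [v]
    vanishes identically. *)
Lemma remainder_ge c d v x : 0 < c < d -> smooth v -> vanishes_where_lt d v ->
  off x -> weight x * \sum_m partial m v x ^+ 2 <= remainder (gground c) v x.
Proof.
move=> /andP[c0 cd] sv vv ox; rewrite /remainder.
have [cP|Pc] := ltP c (P x).
  rewrite laplacian_gground// ggroundE ?(ltW cP)// lerDr; exact: sqr_ge0.
have Pd : P x < d by exact: le_lt_trans Pc cd.
rewrite big1 => [|m _]; rewrite ?(partial_vanishes_where _ vv Pd) ?expr0n//.
by rewrite !mulr0 addr0 sqr_ge0.
Qed.

Lemma remainder_ge0 c d v x : 0 < c < d -> smooth v -> vanishes_where_lt d v ->
  0 <= remainder (gground c) v x.
Proof.
move=> /andP[c0 cd] sv vv; rewrite /remainder.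
have [cP|Pc] := ltP c (P x).
  rewrite laplacian_gground// ggroundE ?(ltW cP)// addr_ge0 ?sqr_ge0//.
  by rewrite mulr_ge0 ?weight_ge0//; apply: sumr_ge0 => m _; exact: sqr_ge0.
have Pd : P x < d by exact: le_lt_trans Pc cd.
rewrite [X in _ + _ * X]big1 => [|m _]; rewrite ?(partial_vanishes_where _ vv Pd) ?expr0n//.
by rewrite mulr0 addr0 sqr_ge0.
Qed.

Lemma potential_term c d v x : 0 < c < d -> vanishes_where_lt d v ->
  laplacian (laplacian (gground c)) x * gground c x * v x ^+ 2 =
  @lambdaV R N n * (V_ a x * (gground c x * v x) ^+ 2).
Proof.
move=> /andP[c0 cd] vv; have [cP|Pc] := ltP c (P x).
  by rewrite bilaplacian_gground// ggroundE ?(ltW cP)//; ring.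
by rewrite vv ?(le_lt_trans Pc)//; ring.
Qed.

Lemma V_ge0 x : 0 <= V_ a x.
Proof.
have nu0 (l i j : 'I_n) : 0 <= @nu R N n l i j.
  rewrite /nu; case: ifPn => _; apply: divr_ge0 => //; have := NR5; have := nR2; lra.
have s0 (y : 'rV[R]_N) : 0 <= sqnorm y by apply: sumr_ge0 => m _; exact: sqr_ge0.
apply: sumr_ge0 => i _; apply: sumr_ge0 => j _; rewrite mulr_ge0//.
  by rewrite divr_ge0// mulr_ge0.
by apply: sumr_ge0 => r _; apply: sumr_ge0 => l _; rewrite divr_ge0 ?mulr_ge0.
Qed.

Lemma lambdaV_gt0 : 0 < @lambdaV R N n.
Proof.
have h : 0 < N%:R - 4 :> R by have := NR5; lra.
rewrite /lambdaV; apply: divr_gt0; last by rewrite exprn_gt0// ltr0n.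
by apply: mulr_gt0; apply: exprn_gt0 => //; rewrite ltr0n.
Qed.

(** The Laplacian of [L] and the square of its gradient are both of the order
    of [rho]. *)
Lemma cutoff_laplacian_bounds : exists2 C : R, 0 < C & forall k x, off x ->
  [/\ `|laplacian (cutoff k) x| <= C * rho a x,
      \sum_m partial m (cutoff k) x ^+ 2 <= C * rho a x &
      `|L x| < K k -> laplacian (cutoff k) x = 0 /\ forall m, partial m (cutoff k) x = 0].
Proof.
have [B B0 HB] := @bump_derivatives_bounded R.
have nR := nR2; have NR := NR5.
exists (B * (4 * n%:R) + B * (2 * N%:R - 4) + B ^+ 2 * (4 * n%:R)).
  rewrite ltr_pwDr//; first by rewrite mulr_gt0// ?exprn_gt0//; lra.
  by rewrite addr_ge0// mulr_ge0//; lra.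
move=> k x ox; have Kk1 := K1 k.
have [b1B b2B] := HB (L x / K k); set b1 := bump' _ in b1B *; set b2 := bump'' _ in b2B *.
have r0 := rho_ge0 x; have G0 := gradL2_ge0 ox; have G1 := gradL2_le x.
have t1 : (K k)^-1 <= 1 by rewrite invf_le1 ?K0.
have t0 : 0 <= (K k)^-1 by rewrite invr_ge0 ltW ?K0.
have T1 : 0 <= B * (4 * n%:R) * rho a x by rewrite !mulr_ge0//; lra.
have T2 : 0 <= B * (2 * N%:R - 4) * rho a x by rewrite !mulr_ge0//; lra.
have T3 : 0 <= B ^+ 2 * (4 * n%:R) * rho a x by rewrite !mulr_ge0//; lra.
have b1K : `|b1 / K k| <= B.
  by rewrite normrM (ger0_norm t0) -[leRHS]mulr1 ler_pM.
have b2K : `|b2 / K k ^+ 2| <= B.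
  have p0 : 0 <= (K k)^-1 ^+ 2 by exact: exprn_ge0.
  have p1 : (K k)^-1 ^+ 2 <= 1 by exact: exprn_ile1.
  by rewrite -exprVn normrM (ger0_norm p0) -[leRHS]mulr1 ler_pM.
split.
- rewrite laplacian_cutoff// -/b1 -/b2 (le_trans (ler_normD _ _))//.
  have : `|b2 / K k ^+ 2 * gradL2 x| <= B * (4 * n%:R * rho a x).
    by rewrite normrM (ger0_norm G0) ler_pM.
  have : `|b1 / K k * ((2 * N%:R - 4) * rho a x)| <= B * ((2 * N%:R - 4) * rho a x).
    rewrite normrM ler_pM// ger0_norm// mulr_ge0//; lra.
  by rewrite !mulrDl -!mulrA in T1 T2 T3 *; lra.
- rewrite sum_partial_cutoff// -/b1.
  have : (b1 / K k) ^+ 2 * gradL2 x <= B ^+ 2 * (4 * n%:R * rho a x).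
    by rewrite ler_pM ?sqr_ge0// -(real_normK (num_real _)) ler_sqr ?nnegrE ?(ltW B0).
  move=> h; apply: (le_trans h).
  by rewrite [leRHS]mulrDl -[B ^+ 2 * _ * _]mulrA lerDr mulrDl addr_ge0.
- move=> LK.
  have H : `|L x / K k| < 1 by rewrite normrM (ger0_norm t0) ltr_pdivrMr ?K0// mul1r.
  have b10 : bump' (L x / K k) = 0 by rewrite bump'_eq0// H.
  have b20 : bump'' (L x / K k) = 0 by rewrite bump''_eq0// H.
  split=> [|m]; first by rewrite laplacian_cutoff// b10 b20 !mul0r addr0.
  by rewrite partial_cutoff// b10 !mul0r.
Qed.

Let remainder_cutoff0 k x : off x -> (`|L x / K k| < 1) || (2 < `|L x / K k|) ->
  remainder (gground (expR (- 3 * K k))) (cutoff k) x = 0.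
Proof.
move=> ox H.
have b10 : bump' (L x / K k) = 0 by rewrite bump'_eq0.
have b20 : bump'' (L x / K k) = 0 by rewrite bump''_eq0.
rewrite remainderE; [|by apply: smooth_gground; exact: expR_gt0|exact: smooth_cutoff].
rewrite sum_partial_cutoff// laplacian_cutoff// b10 b20 big1 => [|m _].
  by rewrite !mul0r expr0n/= !(mul0r, mulr0, addr0) expr0n.
by rewrite partial_cutoff// b10 !mul0r mulr0.
Qed.

(** Where the cutoff is not locally constant, [|L|] lies between [K] and [2
    K]. The factor [1 / K^2] due to the logarithmic scale is therefore at most
    [5 / (1 + L^2)]; this gain makes the bound integrable even for two poles. *)
Lemma remainder_cutoff : exists2 C : R, 0 < C & forall k x, off x ->
  remainder (gground (expR (- 3 * K k))) (cutoff k) x <=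
    C * (Phi x ^+ 2 * rho a x ^+ 2 / (1 + L x ^+ 2)) /\
  (`|L x| < K k -> remainder (gground (expR (- 3 * K k))) (cutoff k) x = 0).
Proof.
have [B B0 HB] := @bump_derivatives_bounded R.
have nR := nR2; have NR := NR5; have g0 := gexp_lt0.
pose C1 : R := B * (4 * n%:R + (2 * N%:R - 4) + 8 * n%:R * (- g)).
pose C2 : R := 2 * (4 * (- g) + 4 * g ^+ 2 * n%:R) * (B ^+ 2 * (4 * n%:R)).
have C10 : 0 < C1.
  rewrite /C1 mulr_gt0// ltr_pwDr//; last lra.
  by rewrite !mulr_gt0//; lra.
have C20 : 0 <= C2.
  have gn : 0 <= g ^+ 2 * n%:R by rewrite mulr_ge0 ?sqr_ge0.
  rewrite /C2 mulr_ge0// ?mulr_ge0 ?sqr_ge0//; lra.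
exists (5 * (C1 ^+ 2 + C2)).
  by rewrite mulr_gt0// ltr_pwDl// exprn_gt0.
move=> k x ox; have Kk1 := K1 k; have Kk0 := K0 k.
have r0 := rho_ge0 x; have G0 := gradL2_ge0 ox; have G1 := gradL2_le x.
have d0 := dform1_ge0 x; have d1 := dform1_le ox.
have P0 := ground_gt0 x.
split; last first.
  move=> LK; apply: remainder_cutoff0 => //.
  by rewrite normrM (ger0_norm (x := (K k)^-1)) ?invr_ge0 ?(ltW Kk0)// ltr_pdivrMr// mul1r LK.
have [H|] := boolP ((`|L x / K k| < 1) || (2 < `|L x / K k|)).
  rewrite remainder_cutoff0//; apply: mulr_ge0.
    by rewrite mulr_ge0// addr_ge0// sqr_ge0.
  apply: divr_ge0; first by rewrite mulr_ge0// sqr_ge0.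
  by rewrite addr_ge0// sqr_ge0.
rewrite negb_or -!leNgt => /andP[_ L2].
have {}L2 : `|L x| <= 2 * K k.
  by move: L2; rewrite normrM (ger0_norm (x := (K k)^-1)) ?invr_ge0 ?(ltW Kk0)// ler_pdivrMr.
have cP : expR (- 3 * K k) < P x.
  rewrite -expR_log_dprod// ltr_expR; move: L2; rewrite ler_norml => /andP[L2 _].
  by apply: lt_le_trans L2; lra.
have c0 := expR_gt0 (- 3 * K k).
rewrite remainderE; [|exact: smooth_gground|exact: smooth_cutoff].
rewrite laplacian_gground// ggroundE ?(ltW cP)// sum_partial_cutoff// laplacian_cutoff//.
have -> : \sum_m partial m (gground (expR (- 3 * K k))) x * partial m (cutoff k) x =
    Phi x * g * (bump' (L x / K k) / K k) * gradL2 x.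
  rewrite -gradL2E// mulr_sumr; apply: eq_bigr => m _.
  by rewrite partial_gground// partial_cutoff//; ring.
have [b1B b2B] := HB (L x / K k); set b1 := bump' _ in b1B *; set b2 := bump'' _ in b2B *.
have t0 : 0 < (K k)^-1 by rewrite invr_gt0.
have t1 : (K k)^-1 <= 1 by rewrite invf_le1.
(* Here [K >= 1] and [|L| <= 2 K], whence the constant [5]. *)
have t5 : (K k)^-1 ^+ 2 <= 5 / (1 + L x ^+ 2).
  have L20 : 0 < 1 + L x ^+ 2 by rewrite ltr_pwDl// sqr_ge0.
  rewrite ler_pdivlMr// exprVn mulrC ler_pdivrMr ?exprn_gt0//.
  have : L x ^+ 2 <= (2 * K k) ^+ 2.
    by rewrite -(real_normK (num_real (L x))) ler_sqr// nnegrE mulr_ge0// ltW.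
  have : 1 <= K k ^+ 2 by rewrite exprn_ege1.
  by rewrite exprMn; lra.
rewrite -!exprVn.
move: (K k)^-1 t0 t1 t5 => t t0 t1 t5.
set r := rho a x in r0 G1 d1 *; set G := gradL2 x in G0 G1 *; set p := Phi x in P0 *.
have -> : p * (b2 * t ^+ 2 * G + b1 * t * ((2 * N%:R - 4) * r)) + 2 * (p * g * (b1 * t) * G) =
  p * (t * (b2 * t * G + b1 * ((2 * N%:R - 4) * r) + 2 * g * b1 * G)) by ring.
set T := b2 * t * G + _ + _.
have TB : `|T| <= C1 * r.
  have e1 : `|b2 * t * G| <= B * (4 * n%:R * r).
    rewrite !normrM (ger0_norm G0) (gtr0_norm t0) ler_pM ?mulr_ge0 ?(ltW t0)//.
    by rewrite -[leRHS]mulr1 ler_pM// ltW.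
  have e2 : `|b1 * ((2 * N%:R - 4) * r)| <= B * ((2 * N%:R - 4) * r).
    rewrite normrM ler_pM// ger0_norm// mulr_ge0//; lra.
  have e3 : `|2 * g * b1 * G| <= 2 * (- g) * B * (4 * n%:R * r).
    rewrite !normrM (ger0_norm G0) (ltr0_norm g0) ger0_norm// ler_pM//.
      by rewrite !mulr_ge0//; lra.
    by rewrite ler_wpM2l//; lra.
  have -> : C1 * r = B * (4 * n%:R * r) + B * ((2 * N%:R - 4) * r) +
      2 * (- g) * B * (4 * n%:R * r) by rewrite /C1; ring.
  by rewrite (le_trans (ler_normD _ _))// lerD// (le_trans (ler_normD _ _))// lerD.
have T2 : T ^+ 2 <= C1 ^+ 2 * r ^+ 2.
  rewrite -exprMn -(real_normK (num_real T)) ler_sqr ?nnegrE//.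
  by rewrite mulr_ge0// ltW.
have S2 : 2 * - (4 * g * r - 2 * g ^+ 2 * dform1 a x) * (b1 ^+ 2 * G) <= C2 * r ^+ 2.
  have -> : C2 * r ^+ 2 = 2 * (4 * (- g) * r + 2 * g ^+ 2 * (2 * n%:R * r)) *
      (B ^+ 2 * (4 * n%:R * r)) by rewrite /C2; ring.
  have gd : 0 <= g ^+ 2 * dform1 a x by rewrite mulr_ge0 ?sqr_ge0.
  have gr : 0 <= - g * r by rewrite mulr_ge0//; lra.
  apply: ler_pM.
  - lra.
  - by rewrite mulr_ge0 ?sqr_ge0.
  - have : g ^+ 2 * dform1 a x <= g ^+ 2 * (2 * n%:R * r) by rewrite ler_wpM2l ?sqr_ge0.
    lra.
  - by rewrite ler_pM ?sqr_ge0// -(real_normK (num_real b1)) ler_sqr ?nnegrE ?(ltW B0).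
rewrite /lapl_ground -/p -/r.
have -> : (p * (t * T)) ^+ 2 + 2 * - (p * (4 * g * r - 2 * g ^+ 2 * dform1 a x)) * p *
    ((b1 * t) ^+ 2 * G) =
  p ^+ 2 * t ^+ 2 * (T ^+ 2 + 2 * - (4 * g * r - 2 * g ^+ 2 * dform1 a x) * (b1 ^+ 2 * G)).
  by ring.
have -> : 5 * (C1 ^+ 2 + C2) * (p ^+ 2 * r ^+ 2 / (1 + L x ^+ 2)) =
  p ^+ 2 * (5 / (1 + L x ^+ 2)) * (C1 ^+ 2 * r ^+ 2 + C2 * r ^+ 2) by ring.
have gd : 0 <= g ^+ 2 * dform1 a x by rewrite mulr_ge0 ?sqr_ge0.
have gr : 0 <= - g * r by rewrite mulr_ge0//; lra.
apply: ler_pM; first by rewrite mulr_ge0 ?sqr_ge0.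
- rewrite addr_ge0 ?sqr_ge0// mulr_ge0//; first lra.
  by rewrite mulr_ge0 ?sqr_ge0.
- by rewrite ler_wpM2l ?sqr_ge0.
- exact: lerD.
Qed.

End cutoff.

(** * Integrability near the poles and near infinity *)

(** The identity [x^-1 = x * (x^2)^-1] also holds at [0], and the power on the
    right is taken at a nonnegative real. *)
Lemma measurable_invr d (T : measurableType d) (R : realType) (f : T -> R) :
  measurable_fun setT f -> measurable_fun setT (fun x => (f x)^-1).
Proof.
move=> mf; have -> : (fun x => (f x)^-1) = (fun x => f x * (f x ^+ 2) `^ (-1)).
  apply/funext => x; rewrite powR_inv1 ?sqr_ge0//.
  have [->|f0] := eqVneq (f x) 0; first by rewrite invr0 mul0r.
  by field.
apply: measurable_funM => //.
by apply: (measurableT_comp (measurable_powR _)); exact: measurable_funX.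
Qed.

Section radial.
Context {R : realType} {N : nat}.
Notation mu := (@lebesgue_rV R N).

(** The borderline rate at [0] and at infinity, made integrable by the
    squared logarithm. *)
Definition radial (y : 'rV[R]_N) : R :=
  expR (- (N%:R / 2 * ln (sqnorm y))) / (1 + ln (sqnorm y) ^+ 2).

Lemma radial_ge0 y : 0 <= radial y.
Proof. by rewrite divr_ge0 ?expR_ge0// addr_ge0// sqr_ge0. Qed.

Lemma measurable_sqnorm : measurable_fun [set: 'rV[R]_N] (@sqnorm R N).
Proof.
apply: continuous_measurable_rV; apply: smooth_continuous.
rewrite /sqnorm; apply: smooth_sum => i _.
under eq_fun do rewrite expr2.
by apply: smooth_mul; exact: smooth_coord.
Qed.

Lemma measurable_radial : measurable_fun [set: 'rV[R]_N] radial.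
Proof.
have ml : measurable_fun [set: 'rV[R]_N] (fun y : 'rV[R]_N => ln (sqnorm y)).
  by apply: measurableT_comp; [exact: measurable_ln|exact: measurable_sqnorm].
apply: measurable_funM.
  apply: measurableT_comp; first exact: measurable_expR.
  by apply: measurable_funN; apply: measurable_funM => //.
apply: measurable_invr.
by apply: measurable_funD => //; apply: measurable_funX.
Qed.

(** The shell where the logarithm lies between [j] and [j + 1], on either side
    of [0], is contained in a ball whose volume compensates the size of
    [radial] on it. *)
Let shell (j : nat) (y : 'rV[R]_N) : R := 4 / (j.+1%:R * j.+2%:R) *
  (expR (- (N%:R / 2 * j%:R)) * \1_[set y : 'rV[R]_N | `|y| <= expR (j.+1%:R / 2)] y +
   expR (N%:R / 2 * j.+1%:R) * \1_[set y : 'rV[R]_N | `|y| <= expR (- j%:R / 2)] y).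

Let shell_ge0 j y : 0 <= shell j y.
Proof. by rewrite /shell mulr_ge0 ?divr_ge0 ?addr_ge0 ?mulr_ge0 ?expR_ge0. Qed.

Let measurable_shell j : measurable_fun [set: 'rV[R]_N] (shell j).
Proof.
apply: measurable_funM => //; apply: measurable_funD; apply: measurable_funM => //;
  apply: measurable_indic; exact: measurable_ball0.
Qed.

Let norm_le_of_ln (y : 'rV[R]_N) (t : R) : ln (sqnorm y) <= 2 * t -> `|y| <= expR t \/ y = 0.
Proof.
move=> H; have [y0|y0] := eqVneq y 0; [by right|left].
have q0 : 0 < sqnorm y.
  by apply: lt_le_trans (sqnorm_ge_norm _); rewrite exprn_gt0// normr_gt0.
rewrite -ler_sqr ?nnegrE ?expR_ge0//.
apply: le_trans (sqnorm_ge_norm _) _.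
have : sqnorm y <= expR (2 * t) by rewrite -[leLHS]lnK ?posrE// ler_expR.
by rewrite expRM_natl.
Qed.

Let inv_1Dsqr_le (j : nat) (t : R) : j%:R <= `|t| -> (1 + t ^+ 2)^-1 <= 4 / (j.+1%:R * j.+2%:R).
Proof.
move=> jt.
have j0 : (0 : R) <= j%:R by [].
have t2 : j%:R ^+ 2 <= t ^+ 2.
  by rewrite -(real_normK (num_real t)) ler_sqr// nnegrE.
have p1 : 0 < 1 + t ^+ 2 by rewrite ltr_pwDl// sqr_ge0.
have p2 : (0 : R) < j.+1%:R * j.+2%:R by rewrite mulr_gt0.
rewrite -[leLHS]div1r ler_pdivrMr// mulrAC ler_pdivlMr// mul1r.
have : (j.+1%:R * j.+2%:R : R) <= 4 * (1 + j%:R ^+ 2).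
  by rewrite -!natr1; move: (j%:R : R) j0 => r r0; nra.
by move=> H; apply: (le_trans H); rewrite ler_pM2l// lerD2l.
Qed.

Let radial_le_shell y : exists j, radial y <= shell j y.
Proof.
set s := ln (sqnorm y).
have [j /andP[j1 j2]] : exists j : nat, j%:R <= `|s| < j.+1%:R.
  exists (Num.trunc `|s|); have /andP[-> ->] // := truncn_itv (normr_ge0 s).
exists j; rewrite /radial -/s /shell [leLHS]mulrC.
apply: ler_pM; rewrite ?expR_ge0 ?invr_ge0 ?addr_ge0 ?sqr_ge0//; first exact: inv_1Dsqr_le.
have N20 : 0 <= N%:R / 2 :> R by rewrite divr_ge0.
have [s0|s0] := leP 0 s.
  rewrite (ger0_norm s0) in j1 j2.
  have yb : `|y| <= expR (j.+1%:R / 2).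
    have [//|->] : `|y| <= expR (j.+1%:R / 2) \/ y = 0.
      by apply: norm_le_of_ln; rewrite -/s mulrCA divff// mulr1 ltW.
    by rewrite normr0 expR_ge0.
  rewrite [X in _ * X + _]indicE mem_set// mulr1 (@le_trans _ _ (expR (- (N%:R / 2 * j%:R))))//.
    by rewrite ler_expR lerN2 ler_wpM2l.
  by rewrite lerDl mulr_ge0 ?expR_ge0.
rewrite (ltr0_norm s0) in j1 j2.
have yb : `|y| <= expR (- j%:R / 2).
  have [//|y0] : `|y| <= expR (- j%:R / 2) \/ y = 0.
    by apply: norm_le_of_ln; rewrite -/s mulrCA divff// mulr1 lerNr.
  by rewrite y0 normr0 expR_ge0.
rewrite [X in _ + _ * X]indicE mem_set// mulr1 (@le_trans _ _ (expR (N%:R / 2 * j.+1%:R)))//.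
  by rewrite ler_expR -mulrN ler_wpM2l// ltW.
by rewrite lerDr mulr_ge0 ?expR_ge0.
Qed.

Let C : R := 4 * (2 * (2 ^+ N * expR (N%:R / 2))).

Let integral_shell j : (\int[mu]_y (shell j y)%:E = (C / (j.+1%:R * j.+2%:R))%:E)%E.
Proof.
have mi (r : R) : measurable_fun [set: 'rV[R]_N] (fun y => (\1_[set y : 'rV[R]_N | `|y| <= r] y)%:E).
  by apply/measurable_EFinP; apply: measurable_indic; exact: measurable_ball0.
have vol (r : R) : (\int[mu]_y (\1_[set y : 'rV[R]_N | `|y| <= expR r] y)%:E =
    ((2 * expR r) ^+ N)%:E)%E.
  rewrite integral_indic//; last exact: measurable_ball0.
  by rewrite setIT; exact: (lebesgue_rV_ball0 (expR_ge0 r)).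
under eq_integral do rewrite EFinM EFinD !EFinM.
have m1 (r c : R) : measurable_fun [set: 'rV[R]_N]
    (fun y => c%:E * (\1_[set y : 'rV[R]_N | `|y| <= r] y)%:E)%E.
  exact: emeasurable_funM.
have p1 (r c : R) (y : 'rV[R]_N) : 0 <= c ->
    (0 <= c%:E * (\1_[set y : 'rV[R]_N | `|y| <= r] y)%:E)%E.
  by move=> c0; rewrite -EFinM lee_fin mulr_ge0.
rewrite ge0_integralZl_EFin//.
- rewrite ge0_integralD//; try exact: m1.
  have vol2 (r c : R) : 0 <= c ->
      (\int[mu]_y (c%:E * (\1_[set y : 'rV[R]_N | `|y| <= expR r] y)%:E) =
       (c * (2 * expR r) ^+ N)%:E)%E.
    by move=> c0; rewrite ge0_integralZl_EFin// vol EFinM.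
  rewrite !vol2 ?expR_ge0// -EFinD -EFinM; congr EFin.
  have -> : expR (- (N%:R / 2 * j%:R) : R) * (2 * expR (j.+1%:R / 2)) ^+ N =
      2 ^+ N * expR (N%:R / 2).
    rewrite exprMn -expRM_natl mulrCA; congr (_ * _); rewrite -expRD; congr expR.
    by rewrite -natr1; field.
  have -> : expR (N%:R / 2 * j.+1%:R : R) * (2 * expR (- j%:R / 2)) ^+ N =
      2 ^+ N * expR (N%:R / 2).
    rewrite exprMn -expRM_natl mulrCA; congr (_ * _); rewrite -expRD; congr expR.
    by rewrite -natr1; field.
  have j0 : (0 : R) <= j%:R by [].
  by rewrite /C; field; apply/andP; split; apply: lt0r_neq0; lra.
- by move=> y _; rewrite -!EFinM -EFinD lee_fin addr_ge0// mulr_ge0 ?expR_ge0.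
- by apply: emeasurable_funD; exact: m1.
Qed.

(** The integrals over the shells are [C / ((j + 1) (j + 2))], whose sum
    telescopes. *)
Lemma integrable_radial : mu.-integrable setT (EFin \o radial).
Proof.
apply/integrableP; split.
  exact: (measurable_EFinP _ _).2 measurable_radial.
have mS j : measurable_fun [set: 'rV[R]_N] (EFin \o shell j).
  exact: (measurable_EFinP _ _).2 (measurable_shell j).
apply: (@le_lt_trans _ _ (\int[mu]_y \sum_(0 <= j <oo) (shell j y)%:E)%E).
  apply: ge0_le_integral => //.
  - by apply: measurableT_comp => //; exact: (measurable_EFinP _ _).2 measurable_radial.
  - by apply: ge0_emeasurable_sum => [j y _ _|j _]; [rewrite lee_fin|exact: mS].
  - move=> y _; rewrite /= ger0_norm ?radial_ge0//.
    have [j Hj] := radial_le_shell y.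
    apply: (@le_trans _ _ (shell j y)%:E); first by rewrite lee_fin.
    have := @nneseries_lim_ge R (fun j => (shell j y)%:E) xpredT 0 j.+1
      (fun k _ _ => shell_ge0 k y).
    apply: le_trans; rewrite big_nat_recr//= leeDr// sume_ge0// => k _.
    by rewrite lee_fin.
rewrite integral_nneseries//; last by move=> j y _; rewrite lee_fin.
under eq_eseriesr do rewrite integral_shell.
apply: (@le_lt_trans _ _ C%:E); last exact: ltry.
have C0 : 0 <= C by rewrite /C !mulr_ge0// ?exprn_ge0 ?expR_ge0.
apply: lime_le.
  by apply: is_cvg_nneseries => j _ _; rewrite lee_fin divr_ge0.
apply: nearW => M; rewrite sumEFin lee_fin.
have -> : \sum_(0 <= j < M) C / (j.+1%:R * j.+2%:R) = C * (1 - M.+1%:R^-1).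
  elim: M => [|M IH]; first by rewrite big_geq// invr1 subrr mulr0.
  have M0 : (0 : R) <= M%:R by [].
  by rewrite big_nat_recr//= IH; field; apply/andP; split; apply: lt0r_neq0; lra.
by rewrite ler_piMr// lerBlDr lerDl invr_ge0.
Qed.

End radial.

Section domination.
Context {R : realType} {N n : nat}.
Variable a : 'I_n -> 'rV[R]_N.
Hypotheses (N5 : (5 <= N)%N) (n2 : (2 <= n)%N) (a_inj : injective a).
Implicit Types (x : 'rV[R]_N) (i j : 'I_n).
Notation mu := (@lebesgue_rV R N).
Notation P := (dprod a).
Notation off := (off_poles a).
Notation Phi := (ground a).
Notation L := (log_dprod a).
Notation g := (@gexp R N n).
Notation q := (dist2 a).

Let NR5 : (5 : R) <= N%:R. Proof. by rewrite (ler_nat R 5 N). Qed.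
Let nR2 : (2 : R) <= n%:R. Proof. by rewrite (ler_nat R 2 n). Qed.
Let n0 : (0 < n)%N. Proof. exact: leq_trans n2. Qed.

Definition radials x : R := \sum_i radial (x - a i).

Lemma radials_ge0 x : 0 <= radials x.
Proof. by apply: sumr_ge0 => i _; exact: radial_ge0. Qed.

Lemma integrable_radials : mu.-integrable setT (EFin \o radials).
Proof.
rewrite /radials; have -> : EFin \o (fun x => \sum_i radial (x - a i)) =
    (fun x => \sum_i (radial (x - a i))%:E)%E.
  by apply/funext => x; rewrite sumEFin.
apply: integrable_sum => // i _.
have mr := @measurable_radial R N.
have ms := measurable_shift (- a i).
apply/integrableP; split.
  apply/measurable_EFinP; exact: (measurableT_comp mr ms).
have /integrableP[_] := @integrable_radial R N.
apply: le_lt_trans.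
rewrite -(@ge0_integral_shift _ _ (fun y => `|(EFin \o @radial R N) y|%E) (- a i))//.
by apply: measurableT_comp => //; exact: (measurable_EFinP _ _).2 mr.
Qed.

Let nearest x : exists i, forall j, q i x <= q j x.
Proof.
exists [arg min_(i < Ordinal n0) q i x]%O.
by case: arg_minP => // i _ H j; exact: H.
Qed.

Lemma sqnormD_le (u v : 'rV[R]_N) : sqnorm (u + v) <= 2 * sqnorm u + 2 * sqnorm v.
Proof.
rewrite /sqnorm !mulr_sumr -big_split/=; apply: ler_sum => m _.
by rewrite mxE; have := sqr_ge0 (u ord0 m - v ord0 m); nra.
Qed.

Let separation : exists2 d : R, 0 < d & forall i j, i != j -> d <= sqnorm (a i - a j).
Proof.
pose d := \prod_i \prod_j (if i == j then 1 else Num.min 1 (sqnorm (a i - a j))) : R.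
have s0 i j : i != j -> 0 < sqnorm (a i - a j).
  move=> ij; apply: lt_le_trans (sqnorm_ge_norm _).
  by rewrite exprn_gt0// normr_gt0 subr_eq0; apply: contra ij => /eqP /a_inj ->.
have t0 i j : 0 < (if i == j then 1 else Num.min 1 (sqnorm (a i - a j))) :> R.
  by case: eqVneq => // ij; rewrite lt_min ltr01 s0.
have t1 i j : (if i == j then 1 else Num.min 1 (sqnorm (a i - a j))) <= 1 :> R.
  by case: eqVneq => // ij; rewrite ge_min lexx.
have p1 i (r : pred 'I_n) : 0 <= \prod_(j | r j) (if i == j then 1 else Num.min 1 (sqnorm (a i - a j))) <= (1 : R).
  elim/big_ind: _ => [|y z /andP[y0 y1] /andP[z0 z1]|j _]; rewrite ?ler01 ?lexx//.
    by rewrite mulr_ge0//= mulr_ile1.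
  by rewrite (ltW (t0 _ _)) t1.
exists d => [|i j ij].
  by apply: prodr_gt0 => i _; apply: prodr_gt0 => j _.
rewrite /d (bigD1 i)//= (bigD1 j)//= (negbTE ij).
have m1 : Num.min 1 (sqnorm (a i - a j)) <= sqnorm (a i - a j) by rewrite ge_min lexx orbT.
have m0 : 0 <= Num.min 1 (sqnorm (a i - a j)) by rewrite le_min ler01 ltW ?s0.
have /andP[A0 A1] := p1 i (fun k => k != j).
have /andP[B0 B1] : 0 <= \prod_(k | k != i) \prod_l
    (if k == l then 1 else Num.min 1 (sqnorm (a k - a l))) <= (1 : R).
  elim/big_ind: _ => [|y z /andP[y0 y1] /andP[z0 z1]|k _]; rewrite ?ler01 ?lexx//.
    by rewrite mulr_ge0//= mulr_ile1.
apply: le_trans m1; rewrite -[leRHS]mulr1 ler_pM ?mulr_ge0//.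
by rewrite -[leRHS]mulr1 ler_pM.
Qed.

Let exp_decay (k : R) : 0 < k ->
  exists2 C : R, 0 < C & forall s, s <= 0 -> expR (k * s) <= C / (1 + s ^+ 2).
Proof.
move=> k0; have k2 : 0 < k ^+ 2 by rewrite exprn_gt0.
exists (1 + 2 / k ^+ 2) => [|s s0]; first by rewrite ltr_pwDl// divr_ge0// ltW.
have s2 : 0 < 1 + s ^+ 2 by rewrite ltr_pwDl// sqr_ge0.
rewrite ler_pdivlMr// -[k * s]opprK expRN mulrC ler_pdivrMr ?expR_gt0//.
have ks : 0 <= - (k * s) by rewrite -mulrN mulr_ge0 ?oppr_ge0// ltW.
have H : 1 + (- (k * s)) ^+ 2 / 2 <= expR (- (k * s)) := expR_ge1Dxn 1 ks.
have : (1 + 2 / k ^+ 2) * (1 + (- (k * s)) ^+ 2 / 2) <= (1 + 2 / k ^+ 2) * expR (- (k * s)).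
  by rewrite ler_pM2l// ltr_pwDl// divr_ge0// ltW.
apply: le_trans.
have -> : (1 + 2 / k ^+ 2) * (1 + (- (k * s)) ^+ 2 / 2) =
    1 + s ^+ 2 + (2 / k ^+ 2 + (k * s) ^+ 2 / 2) by field; rewrite gt_eqF.
by rewrite lerDl addr_ge0// divr_ge0// ?sqr_ge0// ltW.
Qed.

(** In the estimates from here on, [i] is the pole nearest to [x] and
    [s = ln (q i x)], so that [radial (x - a i)] is [exp (- N s / 2) / (1 + s^2)]. *)
Let rho_le x i : off x -> (forall j, q i x <= q j x) ->
  rho a x ^+ 2 <= n%:R ^+ 2 * expR (- 2 * ln (q i x)).
Proof.
move=> ox Hi; have qi0 := dist2_gt0 i ox.
have -> : expR (- 2 * ln (q i x)) = (q i x)^-1 ^+ 2.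
  by rewrite mulNr expRN expRM_natl lnK ?posrE// exprVn.
rewrite -exprMn ler_sqr ?nnegrE ?rho_ge0 ?mulr_ge0 ?invr_ge0 ?dist2_ge0//.
rewrite /rho /winv mulrC mulr_natr -[X in _ *+ X]card_ord -sumr_const.
by apply: ler_sum => j _; rewrite mul1r lef_pV2 ?posrE ?dist2_gt0.
Qed.

Let radialE x i : radial (x - a i) =
  expR (- (N%:R / 2 * ln (q i x))) / (1 + ln (q i x) ^+ 2).
Proof. by []. Qed.

Let radial_le x i : radial (x - a i) <= radials x.
Proof.
by rewrite /radials (bigD1 i)//= lerDl; apply: sumr_ge0 => j _; exact: radial_ge0.
Qed.

(** Near a pole [rho^2] is of the order of [|x - a_i|^-4], which is integrable
    because [4 < N]. *)
Lemma rho_le_radials (M : R) : exists2 C : R, 0 < C &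
  forall x, off x -> `|x| <= M -> rho a x ^+ 2 <= C * radials x.
Proof.
have k0 : 0 < (N%:R - 4) / 2 :> R by have := NR5; lra.
have [C C0 HC] := exp_decay k0.
pose A := \sum_i `|a i|.
have aA i : `|a i| <= A by rewrite /A (bigD1 i)//= lerDl; apply: sumr_ge0.
pose S := `|ln (N%:R * (`|M| + A) ^+ 2)|.
pose D := expR ((N%:R - 4) / 2 * S) * (1 + S ^+ 2).
have D0 : 0 < D by rewrite mulr_gt0 ?expR_gt0// ltr_pwDl// sqr_ge0.
have nn : 0 < n%:R ^+ 2 :> R by rewrite exprn_gt0// ltr0n.
exists (n%:R ^+ 2 * (C + D)) => [|x ox xM]; first by rewrite mulr_gt0// addr_gt0.
have [i Hi] := nearest x; have qi0 := dist2_gt0 i ox.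
apply: (le_trans (rho_le ox Hi)); rewrite -mulrA ler_pM2l//.
apply: (@le_trans _ _ ((C + D) * radial (x - a i))); last first.
  by rewrite ler_pM2l ?addr_gt0.
rewrite radialE; set s := ln (q i x).
have s2 : 0 < 1 + s ^+ 2 by rewrite ltr_pwDl// sqr_ge0.
have -> : expR (- 2 * s) = expR (- (N%:R / 2 * s)) * expR ((N%:R - 4) / 2 * s).
  by rewrite -expRD; congr expR; field.
rewrite mulrCA ler_pM2l ?expR_gt0//.
have [s0|s0] := leP s 0.
  apply: (le_trans (HC _ s0)); rewrite ler_pM2r ?invr_gt0//.
  by rewrite lerDl ltW.
have sS : s <= S.
  have q1 : q i x <= N%:R * (`|M| + A) ^+ 2.
    apply: (le_trans (sqnorm_le_norm _)); rewrite ler_wpM2l//.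
    rewrite ler_sqr ?nnegrE ?addr_ge0//; last by apply: sumr_ge0.
    rewrite (le_trans (ler_normB _ _))// lerD//; exact: le_trans xM (ler_norm _).
  apply: (le_trans _ (ler_norm _)); rewrite ler_ln ?posrE//.
  exact: lt_le_trans qi0 q1.
rewrite ler_pdivlMr// (@le_trans _ _ D)//; last by rewrite lerDr ltW.
rewrite /D ler_pM ?expR_ge0 ?(ltW s2)//.
  by rewrite ler_expR ler_pM2l.
by rewrite lerD2l ler_sqr ?nnegrE ?(ltW s0)//; exact: le_trans (ltW s0) sS.
Qed.

(** Poles other than the nearest one stay at a distance bounded below by the
    separation of the poles, and also bounded above when [x] is close to the
    nearest one. *)
Let log_other : exists2 D : R, 0 <= D & forall x i, off x ->
  (forall j, q i x <= q j x) -> forall j, j != i ->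
  - D <= ln (q j x) /\ (ln (q i x) <= 0 -> `|ln (q j x)| <= D).
Proof.
have [d d0 Hd] := separation.
pose A := \sum_i \sum_j sqnorm (a i - a j).
have s0 (y : 'rV[R]_N) : 0 <= sqnorm y by apply: sumr_ge0 => m _; exact: sqr_ge0.
have A0 : 0 <= A by apply: sumr_ge0 => i _; apply: sumr_ge0.
have aA i j : sqnorm (a i - a j) <= A.
  rewrite /A (bigD1 i)//= (bigD1 j)//= -addrA lerDl addr_ge0//.
    by apply: sumr_ge0.
  by apply: sumr_ge0 => k _; apply: sumr_ge0.
exists (`|ln (d / 4)| + `|ln (2 + 2 * A)|) => [|x i ox Hi j ji]; first by rewrite addr_ge0.
have qi0 := dist2_gt0 i ox; have qj0 := dist2_gt0 j ox.
have low : ln (d / 4) <= ln (q j x).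
  rewrite ler_ln ?posrE ?divr_gt0// ler_pdivrMr//.
  apply: (le_trans (Hd i j _)); first by rewrite eq_sym.
  have -> : a i - a j = (x - a j) + - (x - a i).
    by apply/rowP => m; rewrite !mxE; ring.
  apply: (le_trans (sqnormD_le _ _)).
  have -> : sqnorm (- (x - a i)) = q i x.
    by apply: eq_bigr => m _; rewrite !mxE sqrrN.
  by have := Hi j; rewrite /dist2; lra.
have low' : - `|ln (d / 4)| <= ln (q j x).
  by have := ler_norm (- ln (d / 4)); rewrite normrN; lra.
split; first by have := normr_ge0 (ln (2 + 2 * A)); lra.
move=> si; rewrite ler_norml; apply/andP; split.
  by have := normr_ge0 (ln (2 + 2 * A)); lra.
have qi1 : q i x <= 1 by rewrite -[leLHS]lnK ?posrE// -[leRHS]expR0 ler_expR.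
have : ln (q j x) <= ln (2 + 2 * A).
  rewrite ler_ln ?posrE//; last by rewrite ltr_pwDl// mulr_ge0.
  have -> : q j x = sqnorm ((x - a i) + (a i - a j)) by rewrite addrA subrK.
  apply: (le_trans (sqnormD_le _ _)).
  by have := aA i j; rewrite /dist2 in qi1 *; lra.
by have := ler_norm (ln (2 + 2 * A)); have := normr_ge0 (ln (d / 4)); lra.
Qed.

Let L_split x i : L x = ln (q i x) + \sum_(j | j != i) ln (q j x).
Proof.
by rewrite /log_dprod /ell (bigD1 i)//= mul1r; congr (_ + _); apply: eq_bigr => j _; rewrite mul1r.
Qed.

Let card_others i : \sum_(j | j != i) (1 : R) = n%:R - 1.
Proof.
have := sum_one (R := R) (n := n); rewrite (bigD1 i)//= => <-.
by rewrite addrAC subrr add0r.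
Qed.

Let ground2 x : Phi x ^+ 2 = expR (- ((N%:R - 4) / n%:R * L x)).
Proof.
rewrite groundE -expRM_natl; congr expR; rewrite /gexp.
by field; rewrite pnatr_eq0 -lt0n.
Qed.

(** At infinity the left hand side is of the order of [|x|^(4 - 2 N)]. *)
Let ground_rho_large : exists2 C : R, 0 < C & forall x i, off x ->
  (forall j, q i x <= q j x) -> 0 <= ln (q i x) ->
  Phi x ^+ 2 * rho a x ^+ 2 <= C * radials x.
Proof.
have k0 : 0 < (N%:R - 4) / 2 :> R by have := NR5; lra.
have [C C0 HC] := exp_decay k0.
have nn : 0 < n%:R ^+ 2 :> R by rewrite exprn_gt0// ltr0n.
exists (n%:R ^+ 2 * C) => [|x i ox Hi s0]; first by rewrite mulr_gt0.
apply: (@le_trans _ _ (n%:R ^+ 2 * C * radial (x - a i))); last first.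
  by rewrite ler_pM2l; [exact: radial_le|exact: mulr_gt0].
set s := ln (q i x) in s0 *.
have Ls : n%:R * s <= L x.
  rewrite (L_split x i) -/s.
  have : \sum_(j | j != i) s <= \sum_(j | j != i) ln (q j x).
    by apply: ler_sum => j _; rewrite ler_ln ?posrE ?dist2_gt0.
  have -> : \sum_(j | j != i) s = s * (n%:R - 1).
    by rewrite -(card_others i) mulr_sumr; apply: eq_bigr => j _; rewrite mulr1.
  lra.
have nR : 0 < n%:R :> R by rewrite ltr0n.
apply: (@le_trans _ _ (expR (- ((N%:R - 4) * s)) * (n%:R ^+ 2 * expR (- 2 * s)))).
  apply: ler_pM; rewrite ?sqr_ge0 ?rho_le// ground2 ler_expR lerN2.
  have -> : (N%:R - 4) * s = (N%:R - 4) / n%:R * (n%:R * s) by field; rewrite gt_eqF.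
  by rewrite ler_wpM2l// divr_ge0//; have := NR5; lra.
rewrite radialE -/s mulrCA -expRD.
have -> : - ((N%:R - 4) * s) + - 2 * s = - (N%:R / 2 * s) + (N%:R - 4) / 2 * - s by field.
rewrite expRD -[leRHS]mulrA ler_pM2l// mulrCA ler_pM2l ?expR_gt0//.
by have := HC (- s); rewrite sqrrN oppr_le0; apply.
Qed.

(** Near a pole the left hand side is of the order of [|x - a_i|^(- N + (N -
    4) (1 - 2 / n))]: exactly the borderline rate for [n = 2], and better for
    [n >= 3]. *)
Let ground_rho_small : exists2 C : R, 0 < C & forall x i, off x ->
  (forall j, q i x <= q j x) -> ln (q i x) <= 0 ->
  Phi x ^+ 2 * rho a x ^+ 2 <= C * (expR (- (N%:R / 2 * ln (q i x))) *
    expR ((N%:R - 4) * (2^-1 - n%:R^-1) * ln (q i x))).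
Proof.
have [D D0 HD] := log_other.
have nn : 0 < n%:R ^+ 2 :> R by rewrite exprn_gt0// ltr0n.
have nR : 0 < n%:R :> R by rewrite ltr0n.
exists (n%:R ^+ 2 * expR ((N%:R - 4) / n%:R * (n%:R - 1) * D)) => [|x i ox Hi s0].
  by rewrite mulr_gt0 ?expR_gt0.
set s := ln (q i x) in s0 *.
have Ls : s - (n%:R - 1) * D <= L x.
  rewrite (L_split x i) -/s.
  have : \sum_(j | j != i) - D <= \sum_(j | j != i) ln (q j x).
    by apply: ler_sum => j ji; exact: (HD x i ox Hi j ji).1.
  have -> : \sum_(j | j != i) - D = - D * (n%:R - 1).
    by rewrite -(card_others i) mulr_sumr; apply: eq_bigr => j _; rewrite mulr1.
  lra.
apply: (@le_trans _ _ (expR (- ((N%:R - 4) / n%:R * (s - (n%:R - 1) * D))) *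
    (n%:R ^+ 2 * expR (- 2 * s)))).
  apply: ler_pM; rewrite ?sqr_ge0 ?rho_le// ground2 ler_expR lerN2.
  by rewrite ler_wpM2l// divr_ge0//; have := NR5; lra.
rewrite le_eqVlt; apply/orP; left; apply/eqP.
rewrite mulrCA -[RHS]mulrA; congr (_ * _); rewrite -!expRD; congr expR.
by field; rewrite gt_eqF.
Qed.

(** The borderline rate is compensated by the logarithm, as [L] and [s] differ
    by a bounded amount near a pole. *)
Lemma ground_rho_le_radials_log : exists2 C : R, 0 < C & forall x, off x ->
  Phi x ^+ 2 * rho a x ^+ 2 / (1 + L x ^+ 2) <= C * radials x.
Proof.
have [C1 C10 H1] := ground_rho_large; have [C2 C20 H2] := ground_rho_small.
have [D D0 HD] := log_other.
pose E := 2 + 2 * ((n%:R - 1) * D) ^+ 2 : R.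
have E0 : 0 < E by rewrite ltr_pwDl// mulr_ge0// sqr_ge0.
exists (C1 + C2 * E) => [|x ox]; first by rewrite addr_gt0// mulr_gt0.
have r0 := radials_ge0 x.
have L20 : 0 < 1 + L x ^+ 2 by rewrite ltr_pwDl// sqr_ge0.
have L1 : (1 + L x ^+ 2)^-1 <= 1 by rewrite invf_le1// lerDl sqr_ge0.
have [i Hi] := nearest x; have [s0|s0] := leP (ln (q i x)) 0; last first.
  apply: (@le_trans _ _ (Phi x ^+ 2 * rho a x ^+ 2)).
    by rewrite ler_piMr// mulr_ge0// sqr_ge0.
  apply: (le_trans (H1 x i ox Hi (ltW s0))).
  by rewrite ler_wpM2r// lerDl mulr_ge0// ltW.
set s := ln (q i x) in s0 *.
apply: (@le_trans _ _ (C2 * E * radials x)); last first.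
  by rewrite ler_wpM2r// lerDr ltW.
apply: (@le_trans _ _ (C2 * E * radial (x - a i))); last first.
  by rewrite ler_pM2l; [exact: radial_le|exact: mulr_gt0].
rewrite radialE -/s.
have Ls : `|L x - s| <= (n%:R - 1) * D.
  rewrite (L_split x i) -/s addrAC subrr add0r.
  apply: (le_trans (ler_norm_sum _ _ _)).
  rewrite -(card_others i) mulr_suml; apply: ler_sum => j ji; rewrite mul1r.
  exact: (HD x i ox Hi j ji).2.
have s2 : 1 + s ^+ 2 <= E * (1 + L x ^+ 2).
  have : (L x - s) ^+ 2 <= ((n%:R - 1) * D) ^+ 2.
    rewrite -(real_normK (num_real (L x - s))) ler_sqr ?nnegrE//.
    by rewrite mulr_ge0//; have := nR2; lra.
  rewrite /E; set F := ((n%:R - 1) * D) ^+ 2.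
  have F0 : 0 <= F by exact: sqr_ge0.
  have : 0 <= F * L x ^+ 2 by rewrite mulr_ge0// sqr_ge0.
  have := sqr_ge0 (2 * L x - s); have := sqr_ge0 (L x); nra.
have s20 : 0 < 1 + s ^+ 2 by rewrite ltr_pwDl// sqr_ge0.
apply: (@le_trans _ _ (C2 * expR (- (N%:R / 2 * s)) * (E / (1 + s ^+ 2)))); last first.
  by rewrite le_eqVlt; apply/orP; left; apply/eqP; ring.
apply: ler_pM.
- by rewrite mulr_ge0// sqr_ge0.
- by rewrite invr_ge0 ltW.
- apply: (le_trans (H2 x i ox Hi s0)); rewrite -/s ler_pM2l// ler_piMr ?expR_ge0//.
  rewrite -[leRHS]expR0 ler_expR mulr_ge0_le0// mulr_ge0//; first by have := NR5; lra.
  by rewrite subr_ge0 lef_pV2 ?posrE ?ltr0n.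
- by rewrite ler_pdivlMr// mulrC ler_pdivrMr.
Qed.

(** The positive power of [|x - a_i|] gained for [n >= 3] absorbs the
    logarithm of [radial]. *)
Lemma ground_rho_le_radials : (3 <= n)%N -> exists2 C : R, 0 < C & forall x, off x ->
  Phi x ^+ 2 * rho a x ^+ 2 <= C * radials x.
Proof.
move=> n3.
have [C1 C10 H1] := ground_rho_large; have [C2 C20 H2] := ground_rho_small.
have k0 : 0 < (N%:R - 4) * (2^-1 - n%:R^-1) :> R.
  rewrite mulr_gt0//; first by have := NR5; lra.
  by rewrite subr_gt0 ltf_pV2 ?posrE ?ltr0n// ltr_nat.
have [C3 C30 H3] := exp_decay k0.
exists (C1 + C2 * C3) => [|x ox]; first by rewrite addr_gt0// mulr_gt0.
have r0 := radials_ge0 x.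
have [i Hi] := nearest x; have [s0|s0] := leP (ln (q i x)) 0; last first.
  apply: (le_trans (H1 x i ox Hi (ltW s0))).
  by rewrite ler_wpM2r// lerDl mulr_ge0// ltW.
apply: (le_trans (H2 x i ox Hi s0)).
apply: (@le_trans _ _ (C2 * C3 * radials x)); last first.
  by rewrite ler_wpM2r// lerDr ltW.
apply: (@le_trans _ _ (C2 * C3 * radial (x - a i))); last first.
  by rewrite ler_pM2l; [exact: radial_le|exact: mulr_gt0].
rewrite radialE -[leRHS]mulrA ler_pM2l// mulrCA ler_pM2l ?expR_gt0//.
exact: H3.
Qed.

End domination.

(** * Convergence of energies *)

Section energy.
Context {R : realType} {N : nat}.
Notation mu := (@lebesgue_rV R N).
Implicit Types (f g : 'rV[R]_N -> R).
Local Open Scope ereal_scope.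

Lemma ge0_cvg0P (u : nat -> \bar R) : (forall k, 0 <= u k) ->
  u @ \oo --> 0 <-> forall e : R, (0 < e)%R -> \forall k \near \oo, u k <= e%:E.
Proof.
move=> u0; split.
  move/fine_cvgP => [fu /cvgrPdist_le H] e e0.
  near=> k; have fk : u k \is a fin_num by near: k.
  rewrite -(fineK fk) lee_fin.
  have : (`|0 - (fine \o u) k| <= e)%R by near: k; exact: H.
  by rewrite sub0r normrN; apply: le_trans; exact: ler_norm.
move=> H; apply/fine_cvgP; split.
  apply: filterS (H 1%R ltr01) => k uk.
  by rewrite ge0_fin_numE// (le_lt_trans uk)// ltry.
apply/cvgrPdist_le => e e0; apply: filterS (H e e0) => k uk.
rewrite sub0r normrN /= ger0_norm ?fine_ge0//.
have fk : u k \is a fin_num by rewrite ge0_fin_numE// (le_lt_trans uk)// ltry.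
by rewrite -lee_fin fineK.
Unshelve. all: by end_near. Qed.

Lemma ge0_integral_mono f g : measurable_fun setT f -> measurable_fun setT g ->
  (forall x, (0 <= f x)%R) -> (forall x, (f x <= g x)%R) ->
  \int[mu]_x (f x)%:E <= \int[mu]_x (g x)%:E.
Proof.
move=> mf mg f0 fg; apply: ge0_le_integral => //.
- by move=> x _; rewrite lee_fin.
- exact: (measurable_EFinP _ _).2 mf.
- exact: (measurable_EFinP _ _).2 mg.
- by move=> x _; rewrite lee_fin.
Qed.

Lemma ge0_integral_add f g : measurable_fun setT f -> measurable_fun setT g ->
  (forall x, (0 <= f x)%R) -> (forall x, (0 <= g x)%R) ->
  \int[mu]_x (f x + g x)%:E = \int[mu]_x (f x)%:E + \int[mu]_x (g x)%:E.
Proof.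
move=> /measurable_EFinP mf /measurable_EFinP mg f0 g0.
under eq_integral do rewrite EFinD.
by rewrite ge0_integralD// => x _; rewrite lee_fin.
Qed.

Lemma ge0_integral_scale (c : R) f : (0 <= c)%R -> measurable_fun setT f ->
  (forall x, (0 <= f x)%R) ->
  \int[mu]_x (c * f x)%:E = c%:E * \int[mu]_x (f x)%:E.
Proof.
move=> c0 /measurable_EFinP mf f0.
under eq_integral do rewrite EFinM.
by rewrite ge0_integralZl_EFin// => x _; rewrite lee_fin.
Qed.

Lemma integral_sqr_ge0 f : 0 <= integral_sqr f.
Proof. by apply: integral_ge0 => x _; rewrite lee_fin sqr_ge0. Qed.

Lemma integral_sqr_L2 f : integral_sqr f = (L2_norm f) `^ 2.
Proof.
rewrite /L2_norm poweR_Lnorm//; apply: eq_integral => x _ /=.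
by rewrite powR_mulrn// real_normK// num_real.
Qed.

Lemma L2_integral_sqr f : L2_norm f = (integral_sqr f) `^ (2^-1).
Proof.
by rewrite integral_sqr_L2 -poweRrM divff// poweRe1// /L2_norm Lnorm_ge0.
Qed.

Lemma L2_cvg0P (f : nat -> 'rV[R]_N -> R) :
  (fun k => L2_norm (f k)) @ \oo --> 0 <-> (fun k => integral_sqr (f k)) @ \oo --> 0.
Proof.
have n0 k : 0 <= L2_norm (f k) by exact: Lnorm_ge0.
split=> /ge0_cvg0P H; apply/ge0_cvg0P => [k|e e0]; rewrite ?integral_sqr_ge0//.
  have e1 : (0 < Num.sqrt e)%R by rewrite sqrtr_gt0.
  apply: filterS (H n0 _ e1) => k; rewrite integral_sqr_L2 => Hk.
  have -> : e%:E = (Num.sqrt e)%:E `^ 2.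
    by rewrite poweR_EFin powR_mulrn ?sqrtr_ge0// sqr_sqrtr// ltW.
  apply: gt0_ler_poweR => //.
    by rewrite in_itv/= leey andbT.
  by rewrite in_itv/= leey andbT lee_fin sqrtr_ge0.
have e1 : (0 < e ^+ 2)%R by rewrite exprn_gt0.
have i0 k : 0 <= integral_sqr (f k) by exact: integral_sqr_ge0.
apply: filterS (H i0 _ e1) => k; rewrite L2_integral_sqr => Hk.
have -> : e%:E = (e ^+ 2)%:E `^ (2^-1).
  by rewrite poweR_EFin -powR_mulrn ?(ltW e0)// -powRrM divff// powRr1// ltW.
apply: gt0_ler_poweR => //; rewrite in_itv/= leey andbT//.
by rewrite lee_fin sqr_ge0.
Qed.

(** The bound is only required eventually, because the energies along an
    approximating sequence are controlled in the limit. *)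
Lemma fatou_bound (f_ : nat -> 'rV[R]_N -> R) f (M : \bar R) :
  (forall k, measurable_fun setT (f_ k)) -> measurable_fun setT f ->
  (forall k x, (0 <= f_ k x)%R) ->
  {ae mu, forall x, f_ k x @[k --> \oo] --> f x} ->
  (\forall k \near \oo, \int[mu]_x (f_ k x)%:E <= M) ->
  \int[mu]_x (f x)%:E <= M.
Proof.
move=> mf_ mf f0 ff HM.
have mE k : measurable_fun setT (EFin \o f_ k) by exact: (measurable_EFinP _ _).2 (mf_ k).
have H := @fatou _ _ _ mu setT measurableT (fun k x => (f_ k x)%:E) mE
  (fun k x _ => f0 k x).
apply: (@le_trans _ _ (\int[mu]_x limn_einf (fun k => (f_ k x)%:E))).
  rewrite le_eqVlt; apply/orP; left; apply/eqP; apply: ae_eq_integral => //.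
  - exact: (measurable_EFinP _ _).2 mf.
  - apply: measurableT_comp => //; apply: measurable_fun_limn_esup => k.
    rewrite (_ : (fun x => _) = EFin \o (fun x => - f_ k x)%R)//.
    exact: (measurable_EFinP _ _).2 (measurable_funN (mf_ k)).
  - apply: filterS ff => x fx _.
    have cx : (f_ k x)%:E @[k --> \oo] --> (f x)%:E.
      by apply/fine_cvgP; split; [exact: nearW|exact: fx].
    rewrite is_cvg_limn_einfE; last by apply/cvg_ex; exists (f x)%:E.
    by apply/esym/cvg_lim.
apply: (le_trans H); rewrite limn_einf_lim; apply: lime_le; first exact: is_cvg_einfs.
apply: filterS HM => k; apply: le_trans.
by apply: ereal_inf_lbound; exists k => //=.
Qed.

(** The right hand side exceeds the left one by the integral of [d^-1 (f - (1
    + d) g)^2]. *)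
Lemma sqr_triangle (d : R) f g : (0 < d)%R ->
  measurable_fun setT f -> measurable_fun setT g ->
  integral_sqr f <= (1 + d)%:E * integral_sqr g + (1 + d^-1)%:E * integral_sqr (f \- g)%R.
Proof.
move=> d0 mf mg; have dV : (0 < d^-1)%R by rewrite invr_gt0.
have mfg : measurable_fun setT (f \- g)%R by exact: measurable_funB.
have s0 (k : 'rV[R]_N -> R) x : (0 <= k x ^+ 2)%R by exact: sqr_ge0.
have d1 : (0 <= 1 + d)%R by rewrite addr_ge0// ltW.
have d2 : (0 <= 1 + d^-1)%R by rewrite addr_ge0// ltW.
have m1 := measurable_funX 2 mg; have m2 := measurable_funX 2 mfg.
rewrite /integral_sqr -!ge0_integral_scale// -ge0_integral_add//; first last.
- by move=> x; rewrite mulr_ge0.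
- by move=> x; rewrite mulr_ge0.
- exact: measurable_funM.
- exact: measurable_funM.
apply: ge0_integral_mono => //.
- exact: measurable_funX.
- by apply: measurable_funD; apply: measurable_funM.
move=> x /=.
have -> : ((1 + d) * g x ^+ 2 + (1 + d^-1) * (f x - g x) ^+ 2 =
    f x ^+ 2 + d^-1 * (f x - g x - d * g x) ^+ 2)%R by field; rewrite gt_eqF.
by rewrite lerDl mulr_ge0 ?sqr_ge0// ltW.
Qed.

Lemma integral_sqr_sym f g : integral_sqr (f \- g)%R = integral_sqr (g \- f)%R.
Proof. by apply: eq_integral => x _; congr EFin; rewrite /=; ring. Qed.

Lemma integral_sqr_lim (f : nat -> 'rV[R]_N -> R) g :
  (forall k, measurable_fun setT (f k)) -> measurable_fun setT g ->
  (forall k, integral_sqr (f k) < +oo) ->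
  (fun k => integral_sqr (f k \- g)%R) @ \oo --> 0 ->
  integral_sqr g < +oo /\ forall e : R, (0 < e)%R -> \forall k \near \oo,
    integral_sqr (f k) <= integral_sqr g + e%:E /\
    integral_sqr g <= integral_sqr (f k) + e%:E.
Proof.
move=> mf mg ff /ge0_cvg0P H.
have {}H := H (fun k => integral_sqr_ge0 _).
have fing : integral_sqr g < +oo.
  have [k _ Hk] := H 1%R ltr01; have {}Hk := Hk k (leqnn k).
  apply: (le_lt_trans (sqr_triangle ltr01 mg (mf k))).
  rewrite integral_sqr_sym; apply: lte_add_pinfty; apply: lte_mul_pinfty => //.
  by apply: (le_lt_trans Hk); exact: ltry.
split=> // e e0.
have gf : integral_sqr g \is a fin_num by rewrite ge0_fin_numE ?integral_sqr_ge0.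
set G := fine (integral_sqr g).
have G0 : (0 <= G)%R by rewrite fine_ge0 ?integral_sqr_ge0.
have gE : integral_sqr g = G%:E by rewrite fineK.
pose A : R := (G + e + 1)%R.
have A0 : (0 < A)%R by rewrite /A; lra.
pose d : R := (e / 2 / A)%R.
have d0 : (0 < d)%R by rewrite !divr_gt0.
pose eta : R := (e / 2 / (1 + d^-1))%R.
have dV : (0 < 1 + d^-1)%R by rewrite ltr_pwDl// ltW// invr_gt0.
have eta0 : (0 < eta)%R by rewrite !divr_gt0.
apply: filterS (H eta eta0) => k Hk.
have dA : (d * A = e / 2)%R by rewrite /d divfK// gt_eqF.
have etaE : ((1 + d^-1) * eta = e / 2)%R by rewrite /eta mulrC divfK// gt_eqF.
have fk : integral_sqr (f k) \is a fin_num by rewrite ge0_fin_numE ?integral_sqr_ge0.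
have dk : integral_sqr (f k \- g)%R \is a fin_num.
  by rewrite ge0_fin_numE ?integral_sqr_ge0// (le_lt_trans Hk)// ltry.
have T1 := sqr_triangle d0 (mf k) mg.
have T2 := sqr_triangle d0 mg (mf k).
rewrite integral_sqr_sym in T2.
rewrite -(fineK fk) -(fineK dk) gE -!EFinM -EFinD lee_fin in T1.
rewrite -(fineK fk) -(fineK dk) gE -!EFinM -EFinD lee_fin in T2.
rewrite -(fineK dk) lee_fin in Hk.
rewrite -(fineK fk) gE -!EFinD !lee_fin.
set F := fine (integral_sqr (f k)) in T1 T2 *; set D := fine _ in Hk T1 T2.
have D1 : ((1 + d^-1) * D <= e / 2)%R by rewrite -etaE ler_pM2l.
have dG : (d * G <= e / 2)%R by rewrite -dA ler_pM2l// /A; lra.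
have FG : (F <= G + e)%R by move: T1; rewrite mulrDl mul1r; lra.
split=> //.
have dF : (d * F <= e / 2)%R by rewrite -dA ler_pM2l// /A; lra.
by move: T2; rewrite [((1 + d) * F)%R]mulrDl mul1r; lra.
Qed.

Lemma dominated_cvg_to0 (f_ : nat -> 'rV[R]_N -> R) (h : 'rV[R]_N -> R) :
  (forall k, measurable_fun setT (f_ k)) ->
  mu.-integrable setT (EFin \o h) ->
  {ae mu, forall x, forall k, (0 <= f_ k x <= h x)%R} ->
  {ae mu, forall x, f_ k x @[k --> \oo] --> (0 : R)%R} ->
  (fun k => \int[mu]_x (f_ k x)%:E) @ \oo --> 0.
Proof.
move=> mf_ ih fh f0.
have ff : {ae mu, forall x, setT x -> (f_ k x)%:E @[k --> \oo] --> 0}.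
  apply: filterS f0 => x fx _.
  by apply/fine_cvgP; split; [exact: nearW|exact: fx].
have fg : {ae mu, forall x k, setT x -> `|(f_ k x)%:E| <= (EFin \o h) x}.
  apply: filterS fh => x fx k _; have /andP[f1 f2] := fx k.
  by rewrite /= lee_fin ger0_norm.
have [_ _] := @dominated_convergence _ _ _ mu setT measurableT (fun k x => (f_ k x)%:E)
  (fun=> 0) _ (fun k => (measurable_EFinP _ _).2 (mf_ k)) (measurable_cst _) ff ih fg.
by rewrite integral0.
Qed.

Lemma ae_all_eq0 (f : 'rV[R]_N -> R) : measurable_fun setT f ->
  (forall x, (0 <= f x)%R) -> \int[mu]_x (f x)%:E = 0 -> {ae mu, forall x, f x = 0%R}.
Proof.
move=> mf f0 If.
have mE : measurable_fun setT (EFin \o f) by exact: (measurable_EFinP _ _).2 mf.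
have : \int[mu]_x `|(EFin \o f) x| = 0.
  by rewrite -[RHS]If; apply: eq_integral => x _; rewrite /= ger0_norm.
move/(ae_eq_integral_abs mu measurableT mE) => H.
by apply: filterS H => x Hx; have := Hx I; rewrite /= => -[].
Qed.

End energy.

(** * Test functions and measurability *)

Section test_function.
Context {R : realType} {N : nat}.
Implicit Types (u : 'rV[R]_N -> R).

Lemma Cc_inftyP u : Cc_infty u <-> smooth u /\ vanishes_off_ball u.
Proof.
split=> [[su cu]|[su [M uM]]]; split=> //.
  have [M0 [_ HM]] := compact_bounded cu.
  exists (M0 + 1) => x Mx; apply: contraPeq Mx => ux; apply/negP; rewrite -leNgt.
  by apply: (HM (M0 + 1)) => /=; [rewrite ltrDl|exact: subset_closure].
have cl : closed [set x : 'rV[R]_N | `|x| <= M].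
  apply: (@closed_comp _ _ (fun x : 'rV[R]_N => `|x|) [set r | r <= M]).
    by move=> x _; exact: norm_continuous.
  exact: closed_le.
have sub : closure [set x | u x != 0] `<=` [set x : 'rV[R]_N | `|x| <= M].
  move/closure_id: cl => ->; apply: closure_subset => x /= ux.
  by rewrite leNgt; apply/negP => /uM/eqP; rewrite (negbTE ux).
apply: bounded_closed_compact; last exact: closed_closure.
exists M; split; first exact: num_real.
by move=> r Mr x /sub /= xM; rewrite (le_trans xM)// ltW.
Qed.

Lemma measurable_smooth u : smooth u -> measurable_fun setT u.
Proof. by move=> su; apply: continuous_measurable_rV; exact: smooth_continuous. Qed.

Lemma measurable_bigsum (I : Type) (r : seq I) (p : pred I) (f : I -> 'rV[R]_N -> R) :
  (forall i, measurable_fun setT (f i)) ->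
  measurable_fun setT (fun x => \sum_(i <- r | p i) f i x).
Proof.
move=> mf; under eq_fun do rewrite big_mkcond; apply: measurable_sum => i.
by case: (p i) => //; exact: measurable_cst.
Qed.

Lemma continuous_integral_sqr_fin u : continuous u -> vanishes_off_ball u ->
  (integral_sqr u < +oo)%E.
Proof.
move=> cu vu.
have c2 : continuous (fun x => u x * u x).
  by move=> x; apply: (@continuousM _ _ u u x (cu x) (cu x)).
have [_] := integrableP _ _ _ (integrable_continuous c2 (vanishes_mulr u vu)).
apply: le_lt_trans; rewrite le_eqVlt; apply/orP; left; apply/eqP.
by apply: eq_integral => x _ /=; rewrite -expr2 ger0_norm// sqr_ge0.
Qed.

End test_function.

Section measurability.
Context {R : realType} {N n : nat}.
Variable a : 'I_n -> 'rV[R]_N.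
Notation mu := (@lebesgue_rV R N).

Lemma measurable_dist2 i : measurable_fun setT (dist2 a i).
Proof. exact: measurable_smooth (smooth_dist2 a i). Qed.

Lemma measurable_ell c : measurable_fun setT (ell a c).
Proof.
apply: measurable_bigsum => i; apply: measurable_funM; first exact: measurable_cst.
by apply: measurableT_comp; [exact: measurable_ln|exact: measurable_dist2].
Qed.

Lemma measurable_ground : measurable_fun setT (ground a).
Proof. by apply: measurableT_comp; [exact: measurable_expR|exact: measurable_ell]. Qed.

Lemma measurable_rho : measurable_fun setT (rho a).
Proof.
apply: measurable_bigsum => i; apply: measurable_funM; first exact: measurable_cst.
by apply: measurable_invr; exact: measurable_dist2.
Qed.

Lemma measurable_lapl_ground : measurable_fun setT (lapl_ground a).
Proof.
apply: measurable_funM; first exact: measurable_ground.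
apply: measurable_funB; apply: measurable_funM; try exact: measurable_cst.
  exact: measurable_rho.
apply: measurable_bigsum => i; apply: measurable_bigsum => j.
apply: measurable_funM; first exact: measurable_cst.
by apply: measurable_invr; apply: measurable_funM; exact: measurable_dist2.
Qed.

Lemma measurable_V : measurable_fun setT (V_ a).
Proof.
apply: measurable_bigsum => i; apply: measurable_bigsum => j.
apply: measurable_funM.
  apply: measurable_funM; first exact: measurable_cst.
  by apply: measurable_invr; apply: measurable_funM; exact: measurable_dist2.
apply: measurable_bigsum => k; apply: measurable_bigsum => l.
apply: measurable_funM; first exact: measurable_cst.
by apply: measurable_invr; apply: measurable_funM; exact: measurable_dist2.
Qed.

Lemma ae_off_poles : (0 < N)%N -> {ae mu, forall x, off_poles a x}.
Proof.
move=> N0; have : {ae mu, forall x, forall i, x != a i}.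
  apply: filter_forall => i; exists [set a i]; split.
  - rewrite (_ : [set a i] = [set x | forall m, [set a i ord0 m] (x ord0 m)]).
      exact: (measurable_rV_box (A := fun m => [set a i ord0 m]) (fun m => measurable_set1 _)).
    apply/seteqP; split=> x /=; first by move=> ->.
    by move=> H; apply/rowP.
  - exact: lebesgue_rV_set1.
  - by move=> x /= /negP; rewrite negbK => /eqP.
by apply: filterS => x; exact: (off_polesP a x).2.
Qed.

End measurability.

(** * Density of functions vanishing near the poles, and the Hardy inequality *)

Section hardy.
Context {R : realType} {N n : nat}.
Variable a : 'I_n -> 'rV[R]_N.
Hypotheses (N5 : (5 <= N)%N) (n2 : (2 <= n)%N) (a_inj : injective a).
Implicit Types (x : 'rV[R]_N) (k : nat) (u g : 'rV[R]_N -> R).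
Notation mu := (@lebesgue_rV R N).
Notation P := (dprod a).
Notation off := (off_poles a).
Notation Phi := (ground a).
Notation L := (log_dprod a).
Notation lambda := (@lambdaV R N n).
Notation V := (V_ a).
Notation K k := (k.+1%:R : R).

Let N0 : (0 < N)%N. Proof. exact: leq_trans N5. Qed.

Lemma norm_mul2_le (p q : R) : `|2 * (p * q)| <= p ^+ 2 + q ^+ 2.
Proof.
have := sqr_ge0 (p - q); have := sqr_ge0 (p + q); rewrite sqrrB sqrrD => s1 s2.
by rewrite ler_norml; apply/andP; split; lra.
Qed.

(** The shape of [Delta (theta u) - Delta u], with [t], [d] and [s] standing
    for the cutoff, its Laplacian and the gradient term. *)
Lemma sqr_sum3_le (t l p d s B c : R) : 0 <= t -> t <= 1 -> 0 <= B -> 0 <= c ->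
  `|l| <= B -> `|p| <= B -> `|d| <= c -> `|s| <= c + B ->
  ((t - 1) * l + p * d + s) ^+ 2 <= 8 * B ^+ 2 + 2 * ((B + 1) * c) ^+ 2.
Proof.
move=> t0 t1 B0 c0 lB pB dc sB.
have b1 : `|(t - 1) * l| <= B.
  by rewrite normrM -[B]mul1r ler_pM// ler_norml; apply/andP; split; lra.
have b2 : `|p * d| <= B * c by rewrite normrM ler_pM.
have H : `|(t - 1) * l + p * d + s| <= 2 * B + (B + 1) * c.
  apply: le_trans (ler_normD _ _) _; apply: le_trans (lerD (ler_normD _ _) (lexx _)) _.
  by apply: le_trans (lerD (lerD b1 b2) sB) _; rewrite mulrDl mul1r; lra.
have E0 : 0 <= (B + 1) * c by rewrite mulr_ge0// addr_ge0.
rewrite -real_normK ?num_real//.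
apply: (@le_trans _ _ ((2 * B + (B + 1) * c) ^+ 2)).
  by rewrite lerXn2r// nnegrE addr_ge0// mulr_ge0.
move: ((B + 1) * c) {H b1 b2 lB pB dc sB E0} => y.
by have := sqr_ge0 (2 * B - y); rewrite sqrrB sqrrD exprMn; lra.
Qed.

Lemma cutoff_eq1 k x : off x -> `|L x| < K k -> cutoff a k x = 1.
Proof.
move=> ox Lk; rewrite cutoffE// bump1// normrM normfV [`|K k|]ger0_norm//.
by rewrite ler_pdivrMr ?ltr0n// mul1r ltW.
Qed.

Lemma near_cutoff_eq1 x : off x -> \forall k \near \oo, cutoff a k x = 1.
Proof.
move=> /[dup] ox /cutoff_cvg [k0 Hk0]; exists k0 => // k /= /Hk0.
exact: cutoff_eq1.
Qed.

Lemma cvg_eventually (f : nat -> R) (l : R) : (\forall k \near \oo, f k = l) ->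
  f k @[k --> \oo] --> l.
Proof. exact: cvg_near_cst. Qed.

Lemma Cc_cutoff_mul k u : smooth u -> Cc_infty (fun x => cutoff a k x * u x).
Proof.
move=> su; apply/Cc_inftyP; split.
  by apply: smooth_mul => //; exact: smooth_cutoff.
by apply: vanishes_mull; exact: cutoff_vanishes.
Qed.

Lemma integrable_ball0_radials (A B M : R) : 0 <= M ->
  mu.-integrable setT (EFin \o
    (fun x => A * \1_[set x : 'rV[R]_N | `|x| <= M] x + B * radials a x)).
Proof.
move=> M0.
have i1 := integrableZl measurableT A (integrable_ball0 (N := N) M0).
have i2 := integrableZl measurableT B (integrable_radials a).
exact: (integrableD measurableT i1 i2).
Qed.

Lemma bounded_jet u : smooth u -> vanishes_off_ball u ->
  exists M B : R, [/\ 0 < M, 0 <= B,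
    forall x, M < `|x| -> [/\ u x = 0, laplacian u x = 0 & forall m, partial m u x = 0] &
    forall x, `|x| <= M ->
      [/\ `|u x| <= B, `|laplacian u x| <= B & \sum_m partial m u x ^+ 2 <= B]].
Proof.
move=> su vu; have [M M0 HM] := vanishes_off_ballW vu.
have zu x : M < `|x| -> \near x, u x = 0.
  by move=> Mx; apply: filterS (near_off_ball Mx) => y; exact: HM.
have z0 x m : M < `|x| -> partial m u x = 0.
  move=> Mx; rewrite (near_eq_partial _ (zu x Mx)).
  by apply: partialE; exact: is_derive_cst.
have sp : smooth (fun x => \sum_m partial m u x * partial m u x).
  by apply: smooth_sum => m _; apply: smooth_mul; exact: smooth_partial.
have [B1 B10 H1] := continuous_bounded_on_ball M (smooth_continuous su).
have [B2 B20 H2] := continuous_bounded_on_ball M (smooth_continuous (smooth_laplacian su)).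
have [B3 B30 H3] := continuous_bounded_on_ball M (smooth_continuous sp).
exists M, (B1 + B2 + B3); split=> //; first by rewrite !addr_ge0.
  move=> x Mx; split; [exact: HM| |by move=> m; exact: z0].
  rewrite /laplacian big1// => m _.
  have /near_eq_partial -> : \near x, partial m u x = 0.
    by apply: filterS (near_off_ball Mx) => y; exact: z0.
  by apply: partialE; exact: is_derive_cst.
move=> x xM; split.
- by apply: le_trans (H1 x xM) _; rewrite -addrA lerDl addr_ge0.
- by apply: le_trans (H2 x xM) _; rewrite addrAC lerDr addr_ge0.
- under eq_bigr do rewrite expr2.
  by apply: le_trans (ler_norm _) _; apply: le_trans (H3 x xM) _; rewrite lerDr addr_ge0.
Qed.

(** The error is [(theta - 1) Delta u + u Delta theta + 2 grad theta . grad
    u]; on a fixed ball it is bounded by a multiple of [1 + rho], whose square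
    is integrable near the poles by [rho_le_radials]. *)
Lemma cutoff_dense u : smooth u -> vanishes_off_ball u ->
  (fun k => integral_sqr (laplacian (fun x => cutoff a k x * u x) \- laplacian u)) @ \oo
    --> 0%E.
Proof.
move=> su vu; have [M [B [M0 B0 Hout Hin]]] := bounded_jet su vu.
have [C C0 HC] := cutoff_laplacian_bounds a N5 n2.
have [D D0 HD] := rho_le_radials a N5 n2 M.
have lE k x : laplacian (fun x => cutoff a k x * u x) x - laplacian u x =
    (cutoff a k x - 1) * laplacian u x + u x * laplacian (cutoff a k) x +
    2 * \sum_m partial m (cutoff a k) x * partial m u x.
  rewrite laplacian_mul//; last exact: smooth_cutoff.
  by move: (laplacian (cutoff a k) x) (laplacian u x) (\sum_m _ * _) => *; ring.
pose E := C * (B + 1).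
apply: (@dominated_cvg_to0 _ _ _
  (fun x => 8 * B ^+ 2 * \1_[set x : 'rV[R]_N | `|x| <= M] x + 2 * E ^+ 2 * D * radials a x)).
- move=> k; apply: measurable_funX; apply: measurable_funB.
    by apply: measurable_smooth; apply: smooth_laplacian; apply: smooth_mul => //; exact: smooth_cutoff.
  by apply: measurable_smooth; exact: smooth_laplacian.
- exact: integrable_ball0_radials (ltW M0).
- apply: filterS (ae_off_poles a N0) => x ox k; rewrite sqr_ge0/= lE.
  have r0 := radials_ge0 a x.
  have [Mx|xM] := ltP M `|x|.
    have [-> -> z] := Hout x Mx.
    rewrite big1 => [|m _]; last by rewrite z mulr0.
    rewrite mul0r !mulr0 !addr0 expr0n/=; apply: addr_ge0; apply: mulr_ge0 => //.
    - by rewrite mulr_ge0 ?sqr_ge0.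
    - by apply: mulr_ge0; [rewrite mulr_ge0 ?sqr_ge0|exact: ltW].
  rewrite indicE mem_set//= mulr1.
  have [u1 u2 u3] := Hin x xM; have [t1 t2 _] := HC k x ox.
  have t0 := cutoff_ge0 a k x; have tt := cutoff_le1 a k x.
  have rr := rho_ge0 a x; have Dr := HD x ox xM.
  have cs : `|2 * \sum_m partial m (cutoff a k) x * partial m u x| <=
      C * rho a x + B.
    apply: le_trans (lerD t2 u3); rewrite -big_split/= mulr_sumr.
    apply: le_trans (ler_norm_sum _ _ _) _; apply: ler_sum => m _.
    exact: norm_mul2_le.
  have Cr0 : 0 <= C * rho a x by rewrite mulr_ge0// ltW.
  apply: le_trans (sqr_sum3_le t0 tt B0 Cr0 u2 u1 t1 cs) _.
  have -> : (B + 1) * (C * rho a x) = E * rho a x by rewrite mulrA [_ * C]mulrC.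
  rewrite lerD2l [(E * _) ^+ 2]exprMn mulrA -[leRHS]mulrA.
  by apply: ler_wpM2l => //; rewrite mulr_ge0 ?sqr_ge0.
- apply: filterS (ae_off_poles a N0) => x ox; apply: cvg_eventually.
  have [k0 Hk0] := cutoff_cvg ox; exists k0 => // k /= /Hk0 Lk; rewrite lE.
  have [_ _ /(_ Lk) [-> z]] := HC k x ox.
  rewrite cutoff_eq1// big1 => [|m _]; last by rewrite z mul0r.
  by rewrite subrr mul0r !mulr0 !addr0 expr0n.
Qed.

Lemma measurable_remainder (f v : 'rV[R]_N -> R) : smooth f -> smooth v ->
  measurable_fun setT (remainder f v).
Proof.
move=> sf sv; apply: measurable_funD.
  apply: measurable_funX; apply: measurable_funB.
    by apply: measurable_smooth; apply: smooth_laplacian; exact: smooth_mul.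
  by apply: measurable_smooth; apply: smooth_mul => //; exact: smooth_laplacian.
apply: measurable_funM.
  apply: measurable_funM; last exact: measurable_smooth.
  apply: measurable_funM; first exact: measurable_cst.
  by apply: measurable_funN; apply: measurable_smooth; exact: smooth_laplacian.
apply: measurable_sum => m; apply: measurable_funX.
by apply: measurable_smooth; exact: smooth_partial.
Qed.

(** On functions vanishing near the poles the regularised ground state acts as
    the ground state, which turns the first term of [ground_state_identity]
    into the potential energy. *)
Lemma ground_state_energy c d v : 0 < c < d -> smooth v -> vanishes_off_ball v ->
  vanishes_where_lt a d v ->
  integral_sqr (laplacian (fun x => gground a c x * v x)) =
  (lambda%:E * potential_energy V (fun x => gground a c x * v x)%R +
   \int[mu]_x (remainder (gground a c) v x)%:E)%E.
Proof.
move=> cd sv vv zv; have /andP[c0 _] := cd; have sg := smooth_gground a c0.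
have mu2 : measurable_fun setT (fun x => V x * (gground a c x * v x) ^+ 2).
  apply: measurable_funM; first exact: measurable_V.
  by apply: measurable_funX; apply: measurable_smooth; exact: smooth_mul.
have V0 x : 0 <= V x * (gground a c x * v x) ^+ 2.
  by rewrite mulr_ge0 ?sqr_ge0//; exact: V_ge0.
have mr : measurable_fun setT (remainder (gground a c) v) by exact: measurable_remainder.
rewrite /integral_sqr ground_state_identity// /potential_energy.
have l0 : 0 <= lambda by rewrite ltW// lambdaV_gt0.
rewrite -ge0_integral_scale// -ge0_integral_add//.
- by apply: eq_integral => x _; rewrite (@potential_term _ _ _ a N5 n2 c d v x cd zv).
- by apply: measurable_funM => //; exact: measurable_cst.
- by move=> x; rewrite mulr_ge0.
- by move=> x; exact: remainder_ge0 cd sv zv.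
Qed.

Lemma cvg_sqr (f : nat -> R) (l : R) : f k @[k --> \oo] --> l ->
  f k ^+ 2 @[k --> \oo] --> l ^+ 2.
Proof. by move=> fl; rewrite expr2; under eq_fun do rewrite expr2; exact: cvgM. Qed.

Definition quotient c u x : R := u x * (gground a c x)^-1.

Lemma gground_gt0 c x : 0 < gground a c x. Proof. exact: expR_gt0. Qed.

Lemma ground_quotient c u : (fun x => gground a c x * quotient c u x) = u.
Proof.
by apply/funext => x; rewrite /quotient mulrCA divff ?mulr1// gt_eqF// gground_gt0.
Qed.

Let cK k : (0 : R) < expR (- 3 * K k) < expR (- 2 * K k).
Proof.
have : (0 : R) < K k by rewrite ltr0n.
by move=> K0; rewrite expR_gt0 ltr_expR; lra.
Qed.

Lemma quotient_smooth c u : 0 < c -> smooth u -> smooth (quotient c u).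
Proof. by move=> c0 su; apply: smooth_mul => //; exact: smooth_ggroundV. Qed.

Lemma quotient_vanishes_where k u :
  vanishes_where_lt a (expR (- 2 * K k)) (quotient (expR (- 3 * K k)) (fun x => cutoff a k x * u x)).
Proof. by move=> x Px; rewrite /quotient cutoff_eq0 ?mul0r// ltW. Qed.

Lemma cutoff_energy k u : smooth u ->
  integral_sqr (laplacian (fun x => cutoff a k x * u x)) =
  (lambda%:E * potential_energy V (fun x => cutoff a k x * u x)%R +
   \int[mu]_x (remainder (gground a (expR (- 3 * K k)))
      (quotient (expR (- 3 * K k)) (fun x => cutoff a k x * u x)%R) x)%:E)%E.
Proof.
move=> su; set v := quotient _ _.
have sv : smooth v.
  apply: quotient_smooth; first exact: expR_gt0.
  by apply: smooth_mul => //; exact: smooth_cutoff.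
have vv : vanishes_off_ball v.
  by apply: vanishes_mull; apply: vanishes_mull; exact: cutoff_vanishes.
have := ground_state_energy (cK k) sv vv (@quotient_vanishes_where k u).
by rewrite ground_quotient.
Qed.

Lemma cutoff_hardy k u : smooth u ->
  (lambda%:E * potential_energy V (fun x => cutoff a k x * u x)%R <=
   integral_sqr (laplacian (fun x => cutoff a k x * u x)%R))%E.
Proof.
move=> su; rewrite cutoff_energy// leeDl// integral_ge0// => x _; rewrite lee_fin.
apply: (@remainder_ge0 _ _ _ a N5 n2 _ _ _ _ (cK k)).
  apply: quotient_smooth; first exact: expR_gt0.
  by apply: smooth_mul => //; exact: smooth_cutoff.
exact: quotient_vanishes_where.
Qed.

Lemma measurable_potential u : measurable_fun setT u ->
  measurable_fun setT (fun x => lambda * (V x * u x ^+ 2)).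
Proof.
move=> mu'; apply: measurable_funM; first exact: measurable_cst.
by apply: measurable_funM; [exact: measurable_V|exact: measurable_funX].
Qed.

Lemma potential_ge0 u x : 0 <= lambda * (V x * u x ^+ 2).
Proof.
by rewrite mulr_ge0 ?(ltW (lambdaV_gt0 _ _))// mulr_ge0 ?sqr_ge0//; exact: V_ge0.
Qed.

Lemma potential_energyE u : measurable_fun setT u ->
  (lambda%:E * potential_energy V u = \int[mu]_x (lambda * (V x * u x ^+ 2))%:E)%E.
Proof.
move=> mu'; rewrite -ge0_integral_scale//.
- exact: ltW (lambdaV_gt0 _ _).
- by apply: measurable_funM; [exact: measurable_V|exact: measurable_funX].
- by move=> x; rewrite mulr_ge0 ?sqr_ge0//; exact: V_ge0.
Qed.

(** The Laplacians converge in L^2, and the potential energies are lower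
    semicontinuous by Fatou's lemma. *)
Lemma hardy_limit (phi : nat -> 'rV[R]_N -> R) u g :
  measurable_fun setT u -> measurable_fun setT g ->
  (forall k, smooth (phi k) /\ vanishes_off_ball (phi k)) ->
  (forall k, (lambda%:E * potential_energy V (phi k) <= integral_sqr (laplacian (phi k)))%E) ->
  (fun k => integral_sqr (laplacian (phi k) \- g)) @ \oo --> 0%E ->
  {ae mu, forall x, phi k x @[k --> \oo] --> u x} ->
  (integral_sqr g < +oo)%E /\ (lambda%:E * potential_energy V u <= integral_sqr g)%E.
Proof.
move=> mu' mg sphi hphi cphi aephi.
have mp k : measurable_fun setT (phi k) by apply: measurable_smooth; exact: (sphi k).1.
have mlp k : measurable_fun setT (laplacian (phi k)).
  by apply: measurable_smooth; apply: smooth_laplacian; exact: (sphi k).1.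
have fl k : (integral_sqr (laplacian (phi k)) < +oo)%E.
  have [sp vp] := sphi k; apply: continuous_integral_sqr_fin.
    by apply: smooth_continuous; exact: smooth_laplacian.
  exact: laplacian_vanishes.
have [fg H] := integral_sqr_lim mlp mg fl cphi.
split=> //; rewrite potential_energyE//; apply/lee_addgt0Pr => e e0.
apply: (fatou_bound (f_ := fun k x => lambda * (V x * phi k x ^+ 2))).
- by move=> k; exact: measurable_potential.
- exact: measurable_potential.
- by move=> k x; exact: potential_ge0.
- apply: filterS aephi => x px; apply: cvgM; first exact: cvg_cst.
  by apply: cvgM; [exact: cvg_cst|exact: cvg_sqr].
- apply: filterS (H e e0) => k [Hk _].
  by rewrite -potential_energyE//; apply: le_trans (hphi k) _.
Qed.

(** For functions vanishing near the poles the remainder is nonnegative; the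
    general case follows by density. *)
Lemma hardy u : smooth u -> vanishes_off_ball u ->
  (lambda%:E * potential_energy V u <= integral_sqr (laplacian u))%E.
Proof.
move=> su vu.
have [| |k|k| | |] := @hardy_limit (fun k x => cutoff a k x * u x) u (laplacian u).
- exact: measurable_smooth.
- by apply: measurable_smooth; exact: smooth_laplacian.
- by apply/Cc_inftyP; exact: Cc_cutoff_mul.
- exact: cutoff_hardy.
- exact: cutoff_dense.
- apply: filterS (ae_off_poles a N0) => x /near_cutoff_eq1 ox.
  by apply: cvg_eventually; apply: filterS ox => k ->; rewrite mul1r.
- by case.
Qed.

Lemma hardy_D22 u g : D22 u g ->
  (integral_sqr g < +oo)%E /\ (lambda%:E * potential_energy V u <= integral_sqr g)%E.
Proof.
case=> mu' mg [phi [Cphi /L2_cvg0P cphi aephi]].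
apply: (hardy_limit mu' mg _ _ cphi aephi) => k.
  by apply/Cc_inftyP.
by have /Cc_inftyP[sp vp] := Cphi k; exact: hardy.
Qed.

Lemma nonneg_hardy : nonneg_operator lambda V.
Proof.
move=> u /Cc_inftyP [su vu]; have H := hardy su vu.
rewrite /quad_form sube_ge0//; apply/orP; left.
have l0 : (0 <= lambda%:E * potential_energy V u)%E.
  rewrite potential_energyE; last exact: measurable_smooth.
  by apply: integral_ge0 => x _; rewrite lee_fin; exact: potential_ge0.
rewrite ge0_fin_numE//; apply: le_lt_trans H _; apply: continuous_integral_sqr_fin.
  by apply: smooth_continuous; exact: smooth_laplacian.
exact: laplacian_vanishes.
Qed.

End hardy.

(** * Criticality and the sharp constant *)

Section critical.
Context {R : realType} {N n : nat}.
Variable a : 'I_n -> 'rV[R]_N.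
Hypotheses (N5 : (5 <= N)%N) (n2 : (2 <= n)%N) (a_inj : injective a).
Implicit Types (x : 'rV[R]_N) (k : nat) (u g W : 'rV[R]_N -> R).
Notation mu := (@lebesgue_rV R N).
Notation P := (dprod a).
Notation off := (off_poles a).
Notation Phi := (ground a).
Notation L := (log_dprod a).
Notation lambda := (@lambdaV R N n).
Notation V := (V_ a).
Notation K k := (k.+1%:R : R).

Let N0 : (0 < N)%N. Proof. exact: leq_trans N5. Qed.

Lemma ae_dense (p : 'rV[R]_N -> Prop) (y : 'rV[R]_N) (r : R) : {ae mu, forall x, p x} ->
  0 < r -> exists2 x, `|x - y| <= r & p x.
Proof.
move=> ap r0; apply: contrapT => np.
pose B := [set x : 'rV[R]_N | `|x - y| <= r].
have BE : B = (fun x => x - y) @^-1` [set x : 'rV[R]_N | `|x| <= r] by [].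
have mB : measurable B.
  rewrite BE -[X in measurable X]setTI; apply: measurable_shift => //.
  exact: measurable_ball0.
have : mu B = 0%E.
  apply: measure_negligible => //; apply: negligibleS ap => x Bx px.
  by apply: np; exists x.
have -> : mu B = ((2 * r) ^+ N)%:E.
  rewrite BE lebesgue_rV_shift; last exact: measurable_ball0.
  by rewrite lebesgue_rV_ball0// ltW.
by move=> [] /eqP; rewrite expf_eq0 mulf_eq0 pnatr_eq0 (gt_eqF r0) andbF.
Qed.

(** All the terms are nonnegative; this is the one where the two pairs of
    indices coincide. *)
Lemma V_ge (i j : 'I_n) x : (i < j)%N ->
  ((N%:R + 2 * n%:R - 4) / N%:R) ^+ 2 *
    (sqnorm (a i - a j) / (dist2 a i x * dist2 a j x)) ^+ 2 <= V x.
Proof.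
move=> ij.
have n5 : (5 : R) <= N%:R by rewrite (ler_nat R 5 N).
have nu0 (k i' j' : 'I_n) : 0 <= nu (R := R) (N := N) k i' j'.
  have : (0 : R) <= n%:R by [].
  by move=> ?; rewrite /nu; case: ifP => _; apply: divr_ge0; lra.
have s0 (y : 'rV[R]_N) : 0 <= sqnorm y by apply: sumr_ge0 => m _; exact: sqr_ge0.
have ge_term (I : finType) (p : pred I) (F : I -> R) (i0 : I) : p i0 ->
    (forall i, p i -> 0 <= F i) -> F i0 <= \sum_(i | p i) F i.
  move=> pi0 F0; rewrite (bigD1 i0)//= lerDl; apply: sumr_ge0 => k /andP[pk _].
  exact: F0.
have t0 (i' j' k l : 'I_n) : 0 <= nu (R := R) (N := N) k i' j' * nu (R := R) (N := N) l i' j' * sqnorm (a k - a l) /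
       (sqnorm (x - a k) * sqnorm (x - a l)).
  by rewrite divr_ge0 ?mulr_ge0.
have t1 (i' j' : 'I_n) : 0 <= \sum_(k < n) \sum_(l < n | (k < l)%N)
       nu (R := R) (N := N) k i' j' * nu (R := R) (N := N) l i' j' * sqnorm (a k - a l) /
       (sqnorm (x - a k) * sqnorm (x - a l)).
  by apply: sumr_ge0 => k _; apply: sumr_ge0.
have t2 (i' j' : 'I_n) : 0 <= sqnorm (a i' - a j') / (sqnorm (x - a i') * sqnorm (x - a j')).
  by rewrite divr_ge0// mulr_ge0.
have t3 (i' j' : 'I_n) := mulr_ge0 (t2 i' j') (t1 i' j').
rewrite /V_.
apply: le_trans (ge_term _ xpredT _ i isT _); last first.
  by move=> i' _; apply: sumr_ge0.
apply: le_trans (ge_term _ (fun j' : 'I_n => (i < j')%N) _ j ij _); last by [].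
rewrite [X in _ * X <= _]expr2 mulrCA; apply: ler_wpM2l => //.
apply: le_trans (ge_term _ xpredT _ i isT _); last first.
  by move=> i' _; apply: sumr_ge0.
apply: le_trans (ge_term _ (fun j' : 'I_n => (i < j')%N) _ j ij _); last by [].
by rewrite /nu !eqxx orbT/= -expr2 mulrA.
Qed.

Lemma V_gt0 x : off x -> 0 < V x.
Proof.
move=> ox; have n1 := ltnW n2; pose i := Ordinal n1; pose j := Ordinal n2.
have ij : (i < j)%N by [].
apply: lt_le_trans (V_ge x ij).
have n5 : (5 : R) <= N%:R by rewrite (ler_nat R 5 N).
have nn : (0 : R) <= n%:R by [].
rewrite mulr_gt0// exprn_gt0// divr_gt0//; try lra.
  apply: lt_le_trans (sqnorm_ge_norm _); rewrite exprn_gt0// normr_gt0 subr_eq0.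
  by apply/eqP => /a_inj.
by rewrite mulr_gt0// dist2_gt0.
Qed.

(** Truncated ground states: test functions along which the quadratic form
    tends to zero. *)
Definition approx k x : R := gground a (expR (- 3 * K k)) x * cutoff a k x.

Let cK k : (0 : R) < expR (- 3 * K k) < expR (- 2 * K k).
Proof.
have : (0 : R) < K k by rewrite ltr0n.
by move=> K0; rewrite expR_gt0 ltr_expR; lra.
Qed.

Lemma approxE k x : approx k x = cutoff a k x * Phi x.
Proof.
rewrite /approx mulrC; have /andP[c0 cd] := cK k.
have [Px|Px] := leP (P x) (expR (- 2 * K k)); first by rewrite cutoff_eq0// !mul0r.
by rewrite ggroundE// ltW// (lt_trans cd).
Qed.

Lemma smooth_approx k : smooth (approx k).
Proof.
by apply: smooth_mul; [apply: smooth_gground; exact: expR_gt0|exact: smooth_cutoff].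
Qed.

Lemma approx_vanishes k : vanishes_off_ball (approx k).
Proof. by apply: vanishes_mulr; exact: cutoff_vanishes. Qed.

Lemma near_approx x : off x -> \forall k \near \oo, approx k x = Phi x.
Proof.
move=> ox; apply: filterS (near_cutoff_eq1 ox) => k H.
by rewrite approxE H mul1r.
Qed.

Let cutoff_where k : vanishes_where_lt a (expR (- 2 * K k)) (cutoff a k).
Proof. by move=> x Px; rewrite cutoff_eq0// ltW. Qed.

(** By [approx_energy], the value of the quadratic form at [approx k]. *)
Definition defect k : \bar R :=
  (\int[mu]_x (remainder (gground a (expR (- 3 * K k))) (cutoff a k) x)%:E)%E.

Lemma approx_energy k : integral_sqr (laplacian (approx k)) =
  (lambda%:E * potential_energy V (approx k) + defect k)%E.
Proof.
apply: (ground_state_energy N5 n2 (cK k)) => //.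
- exact: smooth_cutoff.
- exact: cutoff_vanishes.
Qed.

Lemma defect_ge0 k : (0 <= defect k)%E.
Proof.
apply: integral_ge0 => x _; rewrite lee_fin.
apply: (@remainder_ge0 _ _ _ a N5 n2 _ _ _ _ (cK k)) => //; exact: smooth_cutoff.
Qed.

Lemma defect_cvg0 : defect k @[k --> \oo] --> 0%E.
Proof.
have [C C0 HC] := remainder_cutoff a N5 n2.
have [D D0 HD] := ground_rho_le_radials_log N5 n2 a_inj.
apply: (@dominated_cvg_to0 _ _ _ (fun x => 0 * \1_[set x : 'rV[R]_N | `|x| <= 1] x + C * D * radials a x)).
- move=> k; apply: measurable_remainder; last exact: smooth_cutoff.
  by apply: smooth_gground; exact: expR_gt0.
- exact: integrable_ball0_radials.
- apply: filterS (ae_off_poles a N0) => x ox k; apply/andP; split.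
    apply: (@remainder_ge0 _ _ _ a N5 n2 _ _ _ _ (cK k)) => //; exact: smooth_cutoff.
  rewrite mul0r add0r; apply: le_trans (HC k x ox).1 _.
  by rewrite -[leRHS]mulrA; apply: ler_wpM2l; [exact: ltW|exact: HD].
- apply: filterS (ae_off_poles a N0) => x ox; apply: cvg_eventually.
  have [k0 Hk0] := cutoff_cvg ox; exists k0 => // k /= /Hk0.
  exact: (HC k x ox).2.
Qed.

(** Along the truncated ground states the integrals of [W u^2] are bounded by
    [defect k], which tends to zero; so [W Phi^2] has integral zero by Fatou's
    lemma, and [Phi] is positive. *)
Lemma ground_null W : measurable_fun setT W -> (forall x, 0 <= W x) ->
  (forall u, Cc_infty u -> (potential_energy W u <= quad_form lambda V u)%E) ->
  {ae mu, forall x, W x = 0}.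
Proof.
move=> mW W0 HW.
have mWu u : measurable_fun setT u -> measurable_fun setT (fun x => W x * u x ^+ 2).
  by move=> mu'; apply: measurable_funM => //; exact: measurable_funX.
have mPhi := measurable_ground a.
have ge0 u x : 0 <= W x * u x ^+ 2 by rewrite mulr_ge0 ?sqr_ge0.
have quadE k : quad_form lambda V (approx k) = defect k.
  rewrite /quad_form approx_energy addeAC subee ?add0e//.
  have H := hardy a N5 n2 (smooth_approx k) (approx_vanishes k).
  rewrite ge0_fin_numE.
    apply: le_lt_trans H _; apply: continuous_integral_sqr_fin.
      by apply: smooth_continuous; apply: smooth_laplacian; exact: smooth_approx.
    by apply: laplacian_vanishes; exact: approx_vanishes.
  rewrite potential_energyE//; last by apply: measurable_smooth; exact: smooth_approx.
  by apply: integral_ge0 => x _; rewrite lee_fin; exact: potential_ge0.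
have I0 : (\int[mu]_x (W x * Phi x ^+ 2)%:E = 0)%E.
  apply/eqP; rewrite eq_le; apply/andP; split; last first.
    by apply: integral_ge0 => x _; rewrite lee_fin.
  apply/lee_addgt0Pr => e e0; rewrite add0e.
  apply: (fatou_bound (f_ := fun k x => W x * approx k x ^+ 2)) => //.
  - by move=> k; apply: mWu; apply: measurable_smooth; exact: smooth_approx.
  - exact: mWu.
  - apply: filterS (ae_off_poles a N0) => x /near_approx ox.
    by apply: cvg_eventually; apply: filterS ox => k ->.
  - have /(ge0_cvg0P defect_ge0) /(_ e e0) := defect_cvg0; apply: filterS => k; apply: le_trans.
    rewrite -quadE; apply: HW.
    by apply/Cc_inftyP; split; [exact: smooth_approx|exact: approx_vanishes].
have := ae_all_eq0 (mWu _ mPhi) (ge0 _) I0; apply: filterS => x /eqP.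
by rewrite mulf_eq0 expf_eq0/= (gt_eqF (ground_gt0 a x)) orbF => /eqP.
Qed.

(** A continuous [W] which is null almost everywhere is null everywhere. *)
Lemma critical_V : critical lambda V.
Proof.
split; first exact: nonneg_hardy.
move=> [_ [W [cW W0 [y Wy] HW]]].
have aeW := ground_null (continuous_measurable_rV cW) W0 HW.
have Wy0 : 0 < W y by rewrite lt_def Wy W0.
have : nbhs y [set x | 0 < W x].
  apply: open_nbhs_nbhs; split=> //=.
  rewrite (_ : mkset _ = W @^-1` [set r : R | 0 < r])//.
  by apply: open_comp => [x _|]; [exact: cW|exact: open_gt].
move=> /nbhs_normP [r /= r0 Hr].
have r2 : 0 < r / 2 by rewrite divr_gt0.
have [x xy] := ae_dense y aeW r2.
move=> Wx; have : 0 < W x.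
  apply: Hr => /=; rewrite distrC (le_lt_trans xy)//.
  by rewrite ltr_pdivrMr// ltr_pMr// ltr1n.
by rewrite Wx ltxx.
Qed.

Lemma Cc_D22 u : Cc_infty u -> D22 u (laplacian u).
Proof.
move=> /[dup] Cu /Cc_inftyP [su vu]; split.
- exact: measurable_smooth.
- by apply: measurable_smooth; exact: smooth_laplacian.
- exists (fun=> u); split=> //.
  + apply/L2_cvg0P; rewrite (_ : (fun k => _) = (fun=> 0%E)); first exact: cvg_cst.
    apply/funext => k; rewrite /integral_sqr; under eq_integral do rewrite /= subrr expr0n/=.
    exact: integral0.
  + by apply: aeW => x; exact: cvg_cst.
Qed.

Lemma potential_energy_gt0 u : measurable_fun setT u -> ~ ae_zero u ->
  (0 < potential_energy V u)%E.
Proof.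
move=> mu' nz.
have V0 x : 0 <= V x * u x ^+ 2 by rewrite mulr_ge0 ?sqr_ge0//; exact: V_ge0.
have p0 : (0 <= potential_energy V u)%E by apply: integral_ge0 => x _; rewrite lee_fin.
rewrite lt_def p0 andbT; apply/eqP => pE; apply: nz.
have mVu : measurable_fun setT (fun x => V x * u x ^+ 2).
  by apply: measurable_funM; [exact: measurable_V|exact: measurable_funX].
have H1 := ae_all_eq0 mVu V0 pE; have H2 := ae_off_poles a N0.
apply: filterS2 H1 H2 => x /eqP + ox.
by rewrite mulf_eq0 expf_eq0/= (gt_eqF (V_gt0 ox))/= => /eqP.
Qed.

Lemma rayleigh_fin u g : D22 u g -> ~ ae_zero u -> exists i p : R,
  [/\ integral_sqr g = i%:E, potential_energy V u = p%:E, 0 < p,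
      lambda * p <= i & rayleigh V u g = (i / p)%:E].
Proof.
move=> Dug nz; have [ifin H] := hardy_D22 a N5 n2 Dug.
have [mu' _ _] := Dug; have p0 := potential_energy_gt0 mu' nz.
have fi : integral_sqr g \is a fin_num by rewrite ge0_fin_numE// integral_sqr_ge0.
have l0 : 0 < lambda by exact: lambdaV_gt0.
have fp : potential_energy V u \is a fin_num.
  rewrite ge0_fin_numE ?ltW// ltey; apply/eqP => pE; move: H.
  by rewrite pE gt0_muley ?lte_fin// leye_eq => /eqP iE; rewrite iE in ifin.
exists (fine (integral_sqr g)), (fine (potential_energy V u)).
have fp0 : 0 < fine (potential_energy V u) by rewrite fine_gt0// p0 -ge0_fin_numE// ltW.
rewrite !fineK//; split=> //.
- by rewrite -lee_fin EFinM !fineK.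
- by rewrite /rayleigh -[in LHS](fineK fi) -[in LHS](fineK fp) inver gt_eqF.
Qed.

(** If the infimum were larger than [lambda], a positive multiple of [V] would
    satisfy the assumption of [ground_null], although [V] is positive off the
    poles. *)
Lemma sharp_constant_V : lambda%:E = sharp_constant V.
Proof.
apply/eqP; rewrite eq_le; apply/andP; split.
  apply/ereal_infP => _ [u [g [Dug nz ->]]].
  have [i [p [_ _ p0 Hip ->]]] := rayleigh_fin Dug nz.
  by rewrite lee_fin ler_pdivlMr.
rewrite leNgt; apply/negP => lt_l.
have [s ls sS] : exists2 s : R, lambda < s & (s%:E <= sharp_constant V)%E.
  case: (sharp_constant V) lt_l => [s|_|//].
    by rewrite lte_fin => ls; exists s.
  by exists (lambda + 1); [rewrite ltrDl|rewrite leey].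
have sl0 : 0 < s - lambda by rewrite subr_gt0.
have Vzero : {ae mu, forall x, (s - lambda) * V x = 0}.
  apply: ground_null.
  - by apply: measurable_funM; [exact: measurable_cst|exact: measurable_V].
  - by move=> x; apply: mulr_ge0; [exact: ltW|exact: V_ge0].
  move=> u Cu; have [mu' _ _] := Cc_D22 Cu.
  have mVu : measurable_fun setT (fun x => V x * u x ^+ 2).
    by apply: measurable_funM; [exact: measurable_V|exact: measurable_funX].
  have -> : potential_energy (fun x => (s - lambda) * V x) u =
      ((s - lambda)%:E * potential_energy V u)%E.
    rewrite /potential_energy -ge0_integral_scale ?(ltW sl0)//.
      by apply: eq_integral => x _; rewrite mulrA.
    by move=> x; rewrite mulr_ge0 ?sqr_ge0//; exact: V_ge0.
  have [uz|unz] := pselect (ae_zero u).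
    have p0 : potential_energy V u = 0%E.
      rewrite /potential_energy -[RHS](integral0 mu setT); apply: ae_eq_integral => //.
      - exact: (measurable_EFinP _ _).2 mVu.
      - by apply: filterS uz => x ux _; rewrite ux expr0n mulr0.
    by rewrite /quad_form p0 !mule0 oppe0 adde0 integral_sqr_ge0.
  have [i [p [iE pE p0 _ rE]]] := rayleigh_fin (Cc_D22 Cu) unz.
  have : (s%:E <= rayleigh V u (laplacian u))%E.
    by apply: le_trans sS _; apply: ereal_inf_lbound; exists u, (laplacian u); split=> //; exact: Cc_D22.
  rewrite rE lee_fin ler_pdivlMr// => sp.
  by rewrite /quad_form iE pE -!EFinM -EFinB lee_fin mulrBl; lra.
have : {ae mu, forall x, False}.
  apply: filterS2 Vzero (ae_off_poles a N0) => x /eqP + ox.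
  by rewrite mulf_eq0 (gt_eqF sl0) (gt_eqF (V_gt0 ox)).
by move=> H; have [] := ae_dense 0 H ltr01.
Qed.

End critical.

(** * Three poles or more: the ground state is a minimiser *)

Section achieved.
Context {R : realType} {N n : nat}.
Variable a : 'I_n -> 'rV[R]_N.
Hypotheses (N5 : (5 <= N)%N) (n2 : (2 <= n)%N) (a_inj : injective a).
Implicit Types (x : 'rV[R]_N) (k : nat) (u g W : 'rV[R]_N -> R).
Notation mu := (@lebesgue_rV R N).
Notation P := (dprod a).
Notation off := (off_poles a).
Notation Phi := (ground a).
Notation L := (log_dprod a).
Notation g := (@gexp R N n).
Notation lambda := (@lambdaV R N n).
Notation V := (V_ a).
Notation K k := (k.+1%:R : R).

Let N0 : (0 < N)%N. Proof. exact: leq_trans N5. Qed.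

Lemma lapl_ground_norm x : off x ->
  `|lapl_ground a x| <= (4 * `|g| + 4 * n%:R * g ^+ 2) * (Phi x * rho a x).
Proof.
move=> ox; have D0 := dform1_ge0 a x; have D1 := dform1_le ox.
have r0 := rho_ge0 a x; have P0 := ground_gt0 a x.
rewrite /lapl_ground normrM (gtr0_norm P0) [leRHS]mulrCA.
apply: ler_wpM2l; first exact: ltW.
apply: le_trans (ler_normB _ _) _.
have -> : `|4 * g * rho a x| = 4 * `|g| * rho a x.
  by rewrite !normrM (ger0_norm r0) [`|4|]ger0_norm.
rewrite [`|2 * _ * _|]ger0_norm; last first.
  by apply: mulr_ge0 => //; apply: mulr_ge0 => //; exact: sqr_ge0.
rewrite [leRHS]mulrDl lerD2l.
have -> : 4 * n%:R * g ^+ 2 * rho a x = 2 * g ^+ 2 * (2 * n%:R * rho a x) by ring.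
by apply: ler_wpM2l => //; rewrite mulr_ge0 ?sqr_ge0.
Qed.

Lemma laplacian_approx k x : expR (- 3 * K k) < P x ->
  laplacian (approx a k) x = Phi x * laplacian (cutoff a k) x +
    cutoff a k x * lapl_ground a x +
    2 * \sum_m Phi x * (g * grad_ell a (fun=> 1) m x) * partial m (cutoff a k) x.
Proof.
move=> Px; have c0 : (0 : R) < expR (- 3 * K k) by exact: expR_gt0.
rewrite /approx laplacian_mul; [|exact: smooth_gground|exact: smooth_cutoff].
rewrite laplacian_gground// ggroundE// ?ltW//; congr (_ + 2 * _).
by apply: eq_bigr => m _; rewrite partial_gground.
Qed.

Lemma laplacian_approx0 k x : P x <= expR (- 3 * K k) -> laplacian (approx a k) x = 0.
Proof.
move=> Px; have Pd : P x < expR (- 2 * K k).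
  have K0 : (0 : R) < K k by rewrite ltr0n.
  by apply: le_lt_trans Px _; rewrite ltr_expR; lra.
have /near_eq_laplacian -> : \near x, approx a k x = 0.
  by apply: filterS (near_dprod_lt Pd) => y Py; rewrite /approx cutoff_eq0 ?mulr0// ltW.
rewrite /laplacian big1// => m _.
have z f : partial m (fun=> f : R) = fun=> 0.
  by apply/funext => y; apply: partialE; exact: is_derive_cst.
by rewrite !z.
Qed.

(** Each term carries two derivatives, distributed between the ground state
    and the cutoff, whose gradients are of the order of the square root of
    [rho]. *)
Lemma laplacian_approx_bound : exists2 C : R, 0 < C & forall k x, off x ->
  `|laplacian (approx a k) x - lapl_ground a x| <= C * (Phi x * rho a x) /\
  (`|L x| < K k -> laplacian (approx a k) x - lapl_ground a x = 0).
Proof.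
have [C C0 HC] := cutoff_laplacian_bounds a N5 n2.
pose D := 4 * `|g| + 4 * n%:R * g ^+ 2; pose E := `|g| * (4 * n%:R + C).
have D0 : 0 <= D.
  by apply: addr_ge0; [exact: mulr_ge0|apply: mulr_ge0; [exact: mulr_ge0|exact: sqr_ge0]].
have E0 : 0 <= E by rewrite mulr_ge0// addr_ge0 ?mulr_ge0// ltW.
exists (C + D + E); first by rewrite ltr_wpDr// ltr_wpDr.
move=> k x ox; have [t1 t2 t3] := HC k x ox.
have r0 := rho_ge0 a x; have P0 := ground_gt0 a x.
have t0 := cutoff_ge0 a k x; have tt := cutoff_le1 a k x.
have ln := lapl_ground_norm ox; rewrite -/D in ln.
have Pr0 : 0 <= Phi x * rho a x by rewrite mulr_ge0// ltW.
have [Px|Px] := leP (P x) (expR (- 3 * K k)).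
  split.
    rewrite laplacian_approx0// sub0r normrN; apply: le_trans ln _.
    by apply: ler_wpM2r => //; rewrite addrAC lerDr addr_ge0// ltW.
  move=> Lk; exfalso; move: Px; rewrite leNgt => /negP; apply.
  rewrite -(expR_log_dprod ox) ltr_expR; move: Lk; rewrite ltr_norml => /andP[+ _].
  have K0 : (0 : R) < K k by rewrite ltr0n.
  lra.
rewrite laplacian_approx//; split; last first.
  move=> Lk; have [-> z] := t3 Lk; rewrite cutoff_eq1// big1 => [|m _].
    by rewrite !mulr0 mul1r add0r addr0 subrr.
  by rewrite z mulr0.
have s1 : `|2 * \sum_m Phi x * (g * grad_ell a (fun=> 1) m x) * partial m (cutoff a k) x| <=
    E * (Phi x * rho a x).
  have -> : \sum_m Phi x * (g * grad_ell a (fun=> 1) m x) * partial m (cutoff a k) x =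
      Phi x * g * \sum_m grad_ell a (fun=> 1) m x * partial m (cutoff a k) x.
    by rewrite [RHS]mulr_sumr; apply: eq_bigr => m _; rewrite !mulrA.
  have s2 : `|2 * \sum_m grad_ell a (fun=> 1) m x * partial m (cutoff a k) x| <=
      (4 * n%:R + C) * rho a x.
    rewrite mulr_sumr; apply: le_trans (ler_norm_sum _ _ _) _.
    apply: (@le_trans _ _ (\sum_m grad_ell a (fun=> 1) m x ^+ 2 +
                           \sum_m partial m (cutoff a k) x ^+ 2)).
      by rewrite -big_split/=; apply: ler_sum => m _; exact: norm_mul2_le.
    by rewrite mulrDl; apply: lerD t2; rewrite gradL2E//; exact: gradL2_le.
  rewrite mulrCA normrM normrM (gtr0_norm P0) -mulrA [E * _]mulrCA.
  by apply: ler_wpM2l; [exact: ltW|rewrite /E -mulrA; apply: ler_wpM2l].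
have s3 : `|Phi x * laplacian (cutoff a k) x| <= C * (Phi x * rho a x).
  by rewrite normrM (gtr0_norm P0) mulrCA; apply: ler_wpM2l => //; exact: ltW.
have s4 : `|(cutoff a k x - 1) * lapl_ground a x| <= D * (Phi x * rho a x).
  rewrite normrM -[leRHS]mul1r; apply: ler_pM => //.
  by rewrite ler_norml; apply/andP; split; lra.
have -> : forall p q l t : R, p + t * l + q - l = p + (t - 1) * l + q.
  by move=> *; ring.
have -> : forall y : R, (C + D + E) * y = C * y + D * y + E * y by move=> y; ring.
apply: le_trans (ler_normD _ _) _; apply: lerD s1.
by apply: le_trans (ler_normD _ _) _; apply: lerD.
Qed.

Hypothesis n3 : (3 <= n)%N.

(** The assumption [n >= 3] is used here: it makes [Phi rho] square
    integrable. *)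
Lemma approx_cvg : (fun k => integral_sqr (laplacian (approx a k) \- lapl_ground a)) @ \oo
  --> 0%E.
Proof.
have [C C0 HC] := laplacian_approx_bound.
have [D D0 HD] := ground_rho_le_radials N5 n2 a_inj n3.
apply: (@dominated_cvg_to0 _ _ _
  (fun x => 0 * \1_[set x : 'rV[R]_N | `|x| <= 1] x + C ^+ 2 * D * radials a x)).
- move=> k; apply: measurable_funX; apply: measurable_funB.
    by apply: measurable_smooth; apply: smooth_laplacian; exact: smooth_approx.
  exact: measurable_lapl_ground.
- exact: integrable_ball0_radials.
- apply: filterS (ae_off_poles a N0) => x ox k; rewrite sqr_ge0/= mul0r add0r.
  have [H _] := HC k x ox.
  rewrite -real_normK ?num_real// -[leRHS]mulrA.
  apply: (@le_trans _ _ ((C * (Phi x * rho a x)) ^+ 2)).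
    rewrite lerXn2r// nnegrE; exact: le_trans H.
  rewrite !exprMn; apply: ler_wpM2l; [exact: sqr_ge0|exact: HD].
- apply: filterS (ae_off_poles a N0) => x ox; apply: cvg_eventually.
  have [k0 Hk0] := cutoff_cvg ox; exists k0 => // k /= /Hk0 Lk.
  by rewrite (HC k x ox).2// expr0n.
Qed.

Lemma ground_D22 : D22 Phi (lapl_ground a).
Proof.
split; [exact: measurable_ground|exact: measurable_lapl_ground|].
exists (approx a); split.
- by move=> k; apply/Cc_inftyP; split; [exact: smooth_approx|exact: approx_vanishes].
- by apply/L2_cvg0P; exact: approx_cvg.
- apply: filterS (ae_off_poles a N0) => x /near_approx ox.
  by apply: cvg_eventually.
Qed.

(** The truncated ground states have less potential energy than the ground
    state, and a defect which tends to zero. *)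
Lemma ground_energy_le :
  (integral_sqr (lapl_ground a) <= lambda%:E * potential_energy V Phi)%E.
Proof.
have mlp k : measurable_fun setT (laplacian (approx a k)).
  by apply: measurable_smooth; apply: smooth_laplacian; exact: smooth_approx.
have fl k : (integral_sqr (laplacian (approx a k)) < +oo)%E.
  apply: continuous_integral_sqr_fin.
    by apply: smooth_continuous; apply: smooth_laplacian; exact: smooth_approx.
  by apply: laplacian_vanishes; exact: approx_vanishes.
have [_ H] := integral_sqr_lim mlp (measurable_lapl_ground a) fl approx_cvg.
have d0 k : (0 <= defect a k)%E by exact: defect_ge0.
apply/lee_addgt0Pr => e e0; have e2 : 0 < e / 2 by rewrite divr_gt0.
have [k _ [/(_ k (leqnn k)) dk /(_ k (leqnn k)) Hk]] :
    exists2 k, True & (forall j, (k <= j)%N -> (defect a j <= (e / 2)%:E)%E) /\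
     (forall j, (k <= j)%N -> (integral_sqr (lapl_ground a) <=
        integral_sqr (laplacian (approx a j)) + (e / 2)%:E)%E).
  have /(ge0_cvg0P d0) /(_ _ e2) := defect_cvg0 N5 n2 a_inj.
  move=> /filterI /(_ (H _ e2)) [k _ Hk]; exists k => //.
  by split=> j /Hk [] // _ [].
apply: (le_trans Hk); rewrite approx_energy// -addeA; apply: leeD.
  have m1 : measurable_fun setT (approx a k) by apply: measurable_smooth; exact: smooth_approx.
  rewrite !potential_energyE//; last exact: measurable_ground.
  apply: ge0_integral_mono.
  - exact: measurable_potential.
  - by apply: measurable_potential; exact: measurable_ground.
  - by move=> x; exact: potential_ge0.
  - move=> x; apply: ler_wpM2l; first exact: ltW (lambdaV_gt0 _ _).
    apply: ler_wpM2l; first exact: V_ge0.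
    rewrite approxE exprMn -[leRHS]mul1r; apply: ler_wpM2r; first exact: sqr_ge0.
    by rewrite expr_le1// ?cutoff_le1// cutoff_ge0.
rewrite [X in (_ <= X%:E)%E](splitr e) EFinD; exact: leeD.
Qed.

Lemma achieved_ground : sharp_constant_achieved V.
Proof.
have nz : ~ ae_zero Phi.
  by move=> H; have [x _] := ae_dense 0 H ltr01; apply/eqP; rewrite gt_eqF// ground_gt0.
exists Phi, (lapl_ground a); split=> //; first exact: ground_D22.
have [i [p [iE pE p0 Hip ->]]] := rayleigh_fin N5 n2 a_inj ground_D22 nz.
rewrite -(sharp_constant_V N5 n2 a_inj); congr EFin.
have := ground_energy_le; rewrite iE pE -EFinM lee_fin => Hpi.
have -> : i = lambda * p by apply/eqP; rewrite eq_le Hip Hpi.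
by rewrite mulfK// gt_eqF.
Qed.

End achieved.

(** * Finite differences and gradients *)

Section difference.
Context {R : realType} {N : nat}.
Implicit Types (x h : 'rV[R]_N) (w : 'rV[R]_N -> R).
Notation mu := (@lebesgue_rV R N).
Notation ball0 r := [set x : 'rV[R]_N | `|x| <= r].

Lemma sqr_sum_le m (c : 'I_m -> R) : (\sum_i c i) ^+ 2 <= m%:R * \sum_i c i ^+ 2.
Proof.
elim: m c => [|m IH] c; first by rewrite !big_ord0 expr0n mulr0.
rewrite !big_ord_recr/=; have := IH (fun i => c (widen_ord (leqnSn m) i)).
have : 0 <= \sum_(i < m) c (widen_ord (leqnSn m) i) ^+ 2.
  by apply: sumr_ge0 => i _; exact: sqr_ge0.
move: (\sum_(i < m) c _) (\sum_(i < m) c _ ^+ 2) (c ord_max) => S T d T0 ST.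
have [m0|m0] := posnP m.
  have S0 : S = 0.
    by apply/eqP; rewrite -sqrf_eq0 eq_le sqr_ge0 andbT (le_trans ST)// m0 mul0r.
  by rewrite S0 m0 add0r mul1r lerDr.
have k0 : (0 : R) < m%:R by rewrite ltr0n.
rewrite -[m.+1%:R]natr1; move: (m%:R : R) k0 ST => k k0 ST.
have H : 2 * (S * d) <= T + k * d ^+ 2.
  rewrite -(ler_pM2l k0).
  have : k * (T + k * d ^+ 2) - k * (2 * (S * d)) = (S - k * d) ^+ 2 + (k * T - S ^+ 2) by ring.
  by have := sqr_ge0 (S - k * d); lra.
have -> : (S + d) ^+ 2 = S ^+ 2 + 2 * (S * d) + d ^+ 2 by ring.
have -> : (k + 1) * (T + d ^+ 2) = k * T + (T + k * d ^+ 2) + d ^+ 2 by ring.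
by rewrite lerD2r; exact: lerD.
Qed.

Definition directional h w x : R := \sum_m h ord0 m * partial m w x.

Lemma directionalE h w x : smooth w -> 'D_h w x = directional h w x.
Proof.
move=> /smooth_differentiable /(_ x) dw; rewrite deriveE//.
rewrite [h in LHS]row_sum_delta linear_sum/=; apply: eq_bigr => m _.
by rewrite linearZ/= /partial deriveE.
Qed.

Lemma smooth_directional h w : smooth w -> smooth (directional h w).
Proof.
move=> sw; apply: smooth_sum => m _; apply: smooth_mul; first exact: smooth_cst.
exact: smooth_partial.
Qed.

Lemma directional_sqr_le h w x :
  directional h w x ^+ 2 <= N%:R * `|h| ^+ 2 * \sum_m partial m w x ^+ 2.
Proof.
apply: le_trans (sqr_sum_le _) _; rewrite -mulrA; apply: ler_wpM2l => //.
rewrite mulr_sumr; apply: ler_sum => m _; rewrite exprMn; apply: ler_wpM2r.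
  exact: sqr_ge0.
by rewrite -[X in X <= _]real_normK ?num_real// lerXn2r ?nnegrE//; exact: rV_coord_le_norm.
Qed.

Lemma sqrB_le (p q C : R) : `|p| <= C -> `|q| <= C -> (p - q) ^+ 2 <= 4 * C ^+ 2.
Proof.
move=> pC qC; have -> : 4 * C ^+ 2 = (C + C) ^+ 2 by ring.
rewrite -real_normK ?num_real// lerXn2r ?nnegrE//.
  by apply: addr_ge0; apply: le_trans (normr_ge0 _) pC.
by apply: le_trans (ler_normB _ _) _; exact: lerD.
Qed.

Definition on_ball r w x : R := \1_(ball0 r) x * w x.

Lemma measurable_on_ball r w : measurable_fun setT w -> measurable_fun setT (on_ball r w).
Proof.
move=> mw; apply: measurable_funM => //.
by apply: measurable_indic; exact: measurable_ball0.
Qed.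

Lemma on_ball_in r w x : `|x| <= r -> on_ball r w x = w x.
Proof. by move=> xr; rewrite /on_ball indicE mem_set// mul1r. Qed.

Lemma on_ball_out r w x : r < `|x| -> on_ball r w x = 0.
Proof.
move=> xr; rewrite /on_ball indicE memNset ?mul0r//=; apply/negP; by rewrite -ltNge.
Qed.

(** The step [h / (m + 1)] is the one of [telescope]. *)
Definition quot (m : nat) h w x : R := m.+1%:R * (w (x + m.+1%:R^-1 *: h) - w x).

Lemma measurable_increment h w : smooth w ->
  measurable_fun setT (fun x => w (x + h) - w x).
Proof.
move=> sw; have mw := measurable_smooth sw; apply: measurable_funB => //.
by apply: measurableT_comp => //; exact: measurable_shift.
Qed.

Lemma quot_bounded r h w : 0 <= r -> smooth w -> exists2 C : R, 0 <= C &
  forall m x, `|x| <= r -> `|quot m h w x| <= C /\ `|directional h w x| <= C.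
Proof.
move=> r0 sw.
have [C C0 HC] := continuous_bounded_on_ball (r + `|h|) (smooth_continuous (smooth_directional h sw)).
exists C => // m x xr; split; last by apply: HC; rewrite ler_wpDr.
have m0 : (0 : R) < m.+1%:R by [].
rewrite /quot normrM ger0_norm// -ler_pdivlMl// mulrC [x + _]addrC.
apply: lipschitz_along => //; first exact: smooth_differentiable.
move=> t /andP[t0 tm]; rewrite directionalE//; apply: HC.
rewrite addrC (le_trans (ler_normD _ _))// lerD// normrZ ger0_norm// ler_piMl//.
by rewrite (le_trans tm)// invf_le1// ler1n.
Qed.

Lemma quot_cvg h w x : smooth w -> quot m h w x @[m --> \oo] --> directional h w x.
Proof.
move=> sw; have dw := smooth_differentiable sw x.
have := diff_derivable (v := h) dw; rewrite /derivable => /cvg_ex [l Hl].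
have El : l = directional h w x by rewrite -directionalE// /derive; apply/esym/cvg_lim.
rewrite -El; have cv : m.+1%:R^-1 @[m --> \oo] --> (0 : R)^'.
  move=> A A0; have : \forall m \near \oo, (m.+1%:R^-1 : R) != 0 -> A m.+1%:R^-1.
    exact: (cvg_harmonic A0).
  by apply: filterS => m H; apply: H; rewrite invr_neq0// pnatr_eq0.
have := cvg_comp _ _ cv Hl; apply: cvg_trans.
apply: near_eq_cvg; apply: nearW => m /=.
by rewrite /quot/= invrK [_ *: h + x]addrC.
Qed.

Lemma quot_energy_cvg r h w (e : R) : 0 <= r -> smooth w -> 0 < e -> exists m,
  (integral_sqr (on_ball r (quot m h w)) <= integral_sqr (on_ball r (directional h w)) + e%:E)%E.
Proof.
move=> r0 sw e0; have [C C0 HC] := quot_bounded h r0 sw.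
have mq m : measurable_fun setT (quot m h w).
  by apply: measurable_funM; [exact: measurable_cst|exact: measurable_increment].
have md : measurable_fun setT (directional h w) by apply: measurable_smooth; exact: smooth_directional.
have i1 := integrableZl measurableT (4 * C ^+ 2) (integrable_ball0 (N := N) r0).
have bound m x : 0 <= (on_ball r (quot m h w) x - on_ball r (directional h w) x) ^+ 2 <=
    (4 * C ^+ 2) * \1_(ball0 r) x.
  rewrite sqr_ge0/=; have [xr|xr] := leP `|x| r.
    rewrite !on_ball_in// indicE mem_set// mulr1; have [q1 q2] := HC m x xr.
    exact: sqrB_le.
  rewrite !on_ball_out// subrr expr0n/= mulr_ge0// ?indicE ?ler0n//.
  by rewrite mulr_ge0// sqr_ge0.
have i0 x : 0 <= \1_(ball0 r) x :> R by rewrite indicE ler0n.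
have fin m : (integral_sqr (on_ball r (quot m h w)) < +oo)%E.
  apply: le_lt_trans (_ : _ <= \int[mu]_x ((C ^+ 2) * \1_(ball0 r) x)%:E)%E _.
    apply: ge0_integral_mono.
    - by apply: measurable_funX; exact: measurable_on_ball.
    - by apply: measurable_funM => //; apply: measurable_indic; exact: measurable_ball0.
    - by move=> x; exact: sqr_ge0.
    move=> x; have [xr|xr] := leP `|x| r.
      rewrite on_ball_in// indicE mem_set// mulr1; have [q1 _] := HC m x xr.
      by rewrite -real_normK ?num_real// lerXn2r// nnegrE.
    by rewrite on_ball_out// expr0n/= mulr_ge0 ?sqr_ge0// indicE ler0n.
  have /integrableP[_] := integrableZl measurableT (C ^+ 2) (integrable_ball0 (N := N) r0).
  apply: le_lt_trans; rewrite le_eqVlt; apply/orP; left; apply/eqP.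
  apply: eq_integral => x _; rewrite -EFinM abse_EFin ger0_norm//.
  by apply: mulr_ge0; [exact: sqr_ge0|exact: i0].
have [||||_ H] := @integral_sqr_lim _ _ (fun m => on_ball r (quot m h w)) (on_ball r (directional h w)).
- by move=> m; exact: measurable_on_ball.
- exact: measurable_on_ball.
- exact: fin.
- apply: (@dominated_cvg_to0 _ _ _ (fun x => (4 * C ^+ 2) * \1_(ball0 r) x)).
  + by move=> m; apply: measurable_funX; apply: measurable_funB; exact: measurable_on_ball.
  + exact: i1.
  + by apply: aeW => x m; exact: bound.
  + apply: aeW => x; have -> : (0 : R) = 0 ^+ 2 by rewrite expr0n.
    apply: cvg_sqr; rewrite -(subrr (on_ball r (directional h w) x)).
    apply: cvgB; last exact: cvg_cst.
    by apply: cvgM; [exact: cvg_cst|exact: quot_cvg].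
have [m _ Hm] := H e e0; exists m; exact: (Hm m (leqnn m)).1.
Qed.

Lemma telescope h w x m : w (x + h) - w x =
  \sum_(i < m.+1) (w (x + (i%:R / m.+1%:R) *: h + m.+1%:R^-1 *: h) -
                   w (x + (i%:R / m.+1%:R) *: h)).
Proof.
pose f i := w (x + (i%:R / m.+1%:R) *: h).
rewrite (eq_bigr (fun i : 'I_m.+1 => f i.+1 - f i)); last first.
  move=> i _; rewrite /f -addrA -scalerDl; congr (w (_ + _ *: _) - _).
  by rewrite -[i.+1%:R]natr1 mulrDl mul1r.
rewrite -(big_mkord xpredT (fun i => f i.+1 - f i)) telescope_sumr// /f.
by rewrite divff ?pnatr_eq0// mul0r scale0r scale1r addr0.
Qed.

(** The segment from [x] to [x + h] is cut into [m + 1] equal steps. By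
    Cauchy-Schwarz and translation invariance the left hand side is at most
    the energy of the difference quotients of step [h / (m + 1)], which
    converge to the derivative along [h] as [m] tends to infinity. *)
Lemma difference_estimate r h w : 0 <= r -> smooth w ->
  (\int[mu]_x (\1_(ball0 r) x * (w (x + h) - w x) ^+ 2)%:E <=
   \int[mu]_x (N%:R * `|h| ^+ 2 * (\1_(ball0 (r + `|h|)) x * \sum_m partial m w x ^+ 2))%:E)%E.
Proof.
move=> r0 sw; have r1 : 0 <= r + `|h| by rewrite addr_ge0.
have ms (f : 'rV[R]_N -> R) (v : 'rV[R]_N) : measurable_fun setT f ->
    measurable_fun setT (fun x => f (x + v)).
  by move=> mf; apply: measurableT_comp => //; exact: measurable_shift.
have i0 (s : R) x : 0 <= \1_(ball0 s) x :> R by rewrite indicE ler0n.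
have mi s : measurable_fun setT (fun x => \1_(ball0 s) x : R).
  by apply: measurable_indic; exact: measurable_ball0.
apply/lee_addgt0Pr => e e0.
have [m Hm] := quot_energy_cvg h r1 sw e0.
pose inc x := w (x + m.+1%:R^-1 *: h) - w x.
have minc : measurable_fun setT inc by exact: measurable_increment.
pose F x := m.+1%:R * (\1_(ball0 (r + `|h|)) x * inc x ^+ 2).
have mF : measurable_fun setT F.
  apply: measurable_funM => //; apply: measurable_funM => //; exact: measurable_funX.
have F0 x : 0 <= F x.
  by apply: mulr_ge0 => //; apply: mulr_ge0 => //; exact: sqr_ge0.
pose s (i : 'I_m.+1) : R := i%:R / m.+1%:R.
(* The translates of the smaller ball by multiples of [h] of length at most
   that of [h] stay in the larger ball. *)
have step1 x : \1_(ball0 r) x * (w (x + h) - w x) ^+ 2 <= \sum_i F (x + s i *: h).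
  have [xr|xr] := leP `|x| r; last first.
    rewrite indicE memNset ?mul0r ?sumr_ge0//=; apply/negP; by rewrite -ltNge.
  rewrite indicE mem_set// mul1r (telescope h w x m) -mulr_sumr.
  apply: le_trans (sqr_sum_le _) _; apply: ler_wpM2l => //.
  apply: ler_sum => i _; rewrite indicE mem_set ?mul1r//=.
  apply: le_trans (ler_normD _ _) _; apply: lerD => //.
  rewrite normrZ ler_piMl// ger0_norm ?divr_ge0// ler_pdivrMr// mul1r.
  by rewrite ler_nat ltnW.
have step2 : (\int[mu]_x (\sum_i F (x + s i *: h))%:E = \int[mu]_x (\sum_(i < m.+1) F x)%:E)%E.
  under eq_integral do rewrite -sumEFin.
  under [in RHS]eq_integral do rewrite -sumEFin.
  rewrite !ge0_integral_sum//.
  - apply: eq_bigr => i _; apply: ge0_integral_shift => [|x]; last by rewrite lee_fin.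
    exact: (measurable_EFinP _ _).2.
  - by move=> i; apply: (measurable_EFinP _ _).2.
  - by move=> i x _; rewrite lee_fin.
  - by move=> i; apply: (measurable_EFinP _ _).2; exact: ms.
  - by move=> i x _; rewrite lee_fin.
apply: le_trans (_ : _ <= \int[mu]_x (\sum_i F (x + s i *: h))%:E)%E _.
  apply: ge0_integral_mono => //.
  - apply: measurable_funM => //; apply: measurable_funX; exact: measurable_increment.
  - by apply: measurable_sum => i; exact: ms.
  - by move=> x; rewrite mulr_ge0 ?sqr_ge0.
rewrite step2.
have -> : (\int[mu]_x (\sum_(i < m.+1) F x)%:E =
    integral_sqr (on_ball (r + `|h|)%R (quot m h w)))%E.
  apply: eq_integral => x _; congr EFin; rewrite sumr_const card_ord -mulr_natl /F /on_ball /quot -/(inc x).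
  have E : \1_(ball0 (r + `|h|)) x = \1_(ball0 (r + `|h|)) x ^+ 2 :> R.
    by rewrite indicE; case: (_ \in _); rewrite ?expr1n ?expr0n.
  by rewrite [in LHS]E !exprMn; ring.
apply: (le_trans Hm); apply: leeD => //; apply: ge0_integral_mono.
- apply: measurable_funX; apply: measurable_on_ball; apply: measurable_smooth; exact: smooth_directional.
- apply: measurable_funM => //; apply: measurable_funM => //; apply: measurable_sum => i.
  by apply: measurable_funX; apply: measurable_smooth; exact: smooth_partial.
- by move=> x; exact: sqr_ge0.
move=> x; rewrite /on_ball exprMn [leRHS]mulrCA.
have -> : \1_(ball0 (r + `|h|)) x ^+ 2 = \1_(ball0 (r + `|h|)) x :> R.
  by rewrite indicE; case: (_ \in _); rewrite ?expr1n ?expr0n.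
by apply: ler_wpM2l => //; exact: directional_sqr_le.
Qed.

End difference.

(** * Translation invariant functions *)

Section translation_invariant.
Context {R : realType} {N : nat}.
Notation mu := (@lebesgue_rV R N).

Lemma ae_shift (p : 'rV[R]_N -> Prop) (h : 'rV[R]_N) : {ae mu, forall x, p x} ->
  {ae mu, forall x, p (x + h)}.
Proof.
move=> [A [mA A0 sA]]; exists ((fun x => x + h) @^-1` A); split.
- by rewrite -[X in measurable X]setTI; apply: measurable_shift.
- by rewrite lebesgue_rV_shift.
- by move=> x /= px; exact: sA.
Qed.

Lemma measurable_add_rV :
  measurable_fun setT (fun z : 'rV[R]_N * 'rV[R]_N => z.1 + z.2).
Proof.
apply: measurable_fun_rV => i; under eq_fun do rewrite mxE.
apply: measurable_funD.
  exact: (measurableT_comp (measurable_coord i) measurable_fst).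
exact: (measurableT_comp (measurable_coord i) measurable_snd).
Qed.

(** By Tonelli's theorem, for almost every [x] the equality [v (x + h) = v x]
    holds for almost every [h]; one such [x] is enough. *)
Lemma translation_invariant_cst (v : 'rV[R]_N -> R) : measurable_fun setT v ->
  (forall h, {ae mu, forall x, v (x + h) = v x}) -> exists c, {ae mu, forall x, v x = c}.
Proof.
move=> mv Hv.
pose f (z : 'rV[R]_N * 'rV[R]_N) : \bar R := (`|v (z.1 + z.2) - v z.1|)%:E.
have mf : measurable_fun setT f.
  apply/measurable_EFinP; apply: measurableT_comp; first exact: normr_measurable.
  apply: measurable_funB.
    exact: (measurableT_comp mv measurable_add_rV).
  exact: (measurableT_comp mv measurable_fst).
have f0 z : (0 <= f z)%E by rewrite lee_fin.
have mF := @measurable_fun_fubini_tonelli_F _ _ _ _ _ mu f mf f0.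
have I0 : (\int[mu]_x fubini_F mu f x = 0)%E.
  rewrite (@fubini_tonelli _ _ _ _ _ mu mu f mf f0).
  rewrite -[RHS](integral0 mu setT); apply: eq_integral => h _.
  rewrite -[RHS](integral0 mu setT); apply: ae_eq_integral => //.
    apply/measurable_EFinP; apply: measurableT_comp; first exact: normr_measurable.
    apply: measurable_funB => //.
    by apply: measurableT_comp => //; exact: measurable_shift.
  by apply: filterS (Hv h) => x Hx _; rewrite /f/= Hx subrr normr0.
have F0 x : (0 <= fubini_F mu f x)%E by apply: integral_ge0 => h _; exact: f0.
have aeF : {ae mu, forall x, fubini_F mu f x = 0%E}.
  have : (\int[mu]_x `|fubini_F mu f x| = 0)%E.
    by rewrite -[RHS]I0; apply: eq_integral => x _; rewrite gee0_abs.
  by move/(ae_eq_integral_abs mu measurableT mF); apply: filterS => x; apply.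
have [x _ Fx] := ae_dense 0 aeF ltr01.
exists (v x).
have mfx : measurable_fun setT (fun h => v (x + h) - v x).
  apply: measurable_funB => //; apply: measurableT_comp => //.
  rewrite (_ : +%R x = fun h => h + x); first exact: measurable_shift.
  by apply/funext => h; rewrite addrC.
have H : {ae mu, forall h, `|v (x + h) - v x| = 0}.
  apply: ae_all_eq0 => //.
  by apply: measurableT_comp; first exact: normr_measurable.
have := ae_shift (- x) H; apply: filterS => y /normr0_eq0 /eqP.
by rewrite subr_eq0 addrCA subrr addr0 => /eqP.
Qed.

End translation_invariant.

(** * Two poles: the ground state has infinite energy *)

Section dyadic.
Context {R : realType}.

(** The terms are part of a geometric sequence of ratio at least [2], so their
    sum is at most twice the last one. *)
Lemma dyadic_sum_le (r X : R) (p : nat -> bool) (J : nat) : 2 <= r -> 0 <= X ->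
  (forall j, p j -> r ^+ j <= X) ->
  \sum_(j < J) r ^+ j * (p j)%:R <= 2 * X.
Proof.
move=> r2 X0 pX; suff : \sum_(j < J) r ^+ j * (p j)%:R <= 2 * X /\
    \sum_(j < J) r ^+ j * (p j)%:R <= r ^+ J by case.
elim: J => [|J [IH1 IH2]].
  by rewrite big_ord0 expr0 mulr_ge0.
have rJ : 0 <= r ^+ J by rewrite exprn_ge0// (le_trans _ r2).
have rS : 2 * r ^+ J <= r ^+ J.+1 by rewrite exprS ler_wpM2r.
rewrite big_ord_recr/=; have := pX J; case: (p J) => [/(_ isT) rX|_].
  by rewrite mulr1; split; lra.
by rewrite mulr0 addr0; split; lra.
Qed.

End dyadic.

Section two_poles.
Context {R : realType} {N n : nat}.
Variable a : 'I_n -> 'rV[R]_N.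
Hypotheses (N5 : (5 <= N)%N) (n2 : (2 <= n)%N) (a_inj : injective a) (n_eq2 : n = 2%N).
Implicit Types (x : 'rV[R]_N) (k : nat).
Notation mu := (@lebesgue_rV R N).
Notation P := (dprod a).
Notation off := (off_poles a).
Notation Phi := (ground a).
Notation L := (log_dprod a).
Notation g := (@gexp R N n).
Notation V := (V_ a).
Notation ball0 r := [set x : 'rV[R]_N | `|x| <= r].

Let N0 : (0 < N)%N. Proof. exact: leq_trans N5. Qed.
Let i0 : 'I_n := Ordinal (ltnW n2).
Let i1 : 'I_n := Ordinal n2.

Let dprod2 x : P x = dist2 a i0 x * dist2 a i1 x.
Proof.
rewrite /dprod (bigD1 i0)//= (bigD1 i1)//= big1 ?mulr1// => i /andP[ii0 ii1].
have := leq_trans (ltn_ord i) (eq_leq n_eq2).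
by move: ii0 ii1; rewrite -!val_eqE/=; case: (nat_of_ord i) => [|[|m]].
Qed.

(** The term of [V] kept in [V_ge] is of the order of [P^-2], and [Phi^2 =
    P^(- (N - 4) / 2)] for two poles. *)
Let VPhi_ge : exists2 C : R, 0 < C & forall x, off x ->
  C * expR (- (N%:R / 2 * L x)) <= V x * Phi x ^+ 2.
Proof.
have n5 : (5 : R) <= N%:R by rewrite (ler_nat R 5 N).
have nn : (0 : R) <= n%:R by [].
pose d := sqnorm (a i0 - a i1); pose nu0 : R := (N%:R + 2 * n%:R - 4) / N%:R.
have d0 : 0 < d.
  apply: lt_le_trans (sqnorm_ge_norm _); rewrite exprn_gt0// normr_gt0 subr_eq0.
  by apply/eqP => /a_inj.
have nu1 : 0 < nu0 by rewrite divr_gt0//; lra.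
exists ((nu0 * d) ^+ 2); first by rewrite exprn_gt0// mulr_gt0.
move=> x ox; have := V_ge a N5 x (i := i0) (j := i1) isT.
rewrite -dprod2 -(expR_log_dprod ox) -/d -/nu0 => H.
apply: le_trans (ler_wpM2r (sqr_ge0 _) H).
have -> : expR (- (N%:R / 2 * L x)) = (expR (L x))^-1 ^+ 2 * Phi x ^+ 2.
  rewrite groundE -expRN -!expRM_natl -expRD; congr expR.
  by move: (L x) => l; rewrite /gexp n_eq2; field.
by rewrite le_eqVlt; apply/orP; left; apply/eqP; ring.
Qed.

(** Near the first pole the right hand side is at least of the order of [|x -
    a_0|^-N], which dominates a dyadic sum of indicators of balls. *)
Let VPhi_lower : exists2 C : R, 0 < C & forall x, off x -> `|x - a i0| <= 1 ->
  forall J, C * \sum_(j < J) (2 ^+ N) ^+ j * (`|x - a i0| <= 2^-1 ^+ j)%R%:R <= V x * Phi x ^+ 2.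
Proof.
have n5 : (5 : R) <= N%:R by rewrite (ler_nat R 5 N).
have [C C0 HC] := VPhi_ge.
have [Q Q0 HQ] := continuous_bounded_on_ball (`|a i0| + 1)
  (smooth_continuous (smooth_dist2 a i1)).
pose E := N%:R * (Q + 1); have E0 : 0 < E by rewrite mulr_gt0//; lra.
exists (C * expR (- (N%:R / 2 * ln E)) / 2).
  by rewrite divr_gt0// mulr_gt0// expR_gt0.
move=> x ox x1 J.
have y0 : 0 < `|x - a i0|.
  by rewrite normr_gt0 subr_eq0; have /off_polesP := ox; apply.
set y := `|x - a i0| in x1 y0 *.
have Px : L x <= ln E + 2 * ln y.
  have -> : 2 * ln y = ln (y ^+ 2) by rewrite lnXn// mulr_natl.
  rewrite -(ln_dprod ox) -lnM ?posrE ?exprn_gt0//.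
  rewrite ler_ln ?posrE//; last by rewrite mulr_gt0// exprn_gt0.
  rewrite dprod2 /E mulrAC; apply: ler_pM; rewrite ?dist2_ge0//.
    exact: sqnorm_le_norm.
  apply: le_trans (ler_norm _) _; apply: le_trans (HQ x _) _; last by rewrite lerDl.
  by rewrite -[x](subrK (a i0)) (le_trans (ler_normD _ _))// addrC lerD2l.
pose X := expR (- (N%:R * ln y)).
have S : \sum_(j < J) (2 ^+ N) ^+ j * (y <= 2^-1 ^+ j)%R%:R <= 2 * X.
  apply: (dyadic_sum_le (p := fun j => y <= 2^-1 ^+ j)).
  - rewrite -[X in X <= _]expr1; apply: ler_weXn2l => //; rewrite ?ler1n//.
  - exact: expR_ge0.
  move=> j yj; rewrite -exprM -[2 in leLHS]lnK ?posrE// -expRM_natl ler_expR.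
  rewrite natrM -mulrA -mulrN ler_pM2l ?ltr0n//.
  rewrite lerNr -mulrN -lnV ?posrE// mulr_natl -lnXn ?posrE ?invr_gt0//.
  by rewrite ler_ln ?posrE// exprn_gt0// invr_gt0.
apply: le_trans (HC x ox).
set T := \sum_(j < J) _ in S *; set e := expR _.
have -> : C * e / 2 * T = C * (e * (T / 2)) by field.
rewrite ler_pM2l//; apply: (@le_trans _ _ (e * X)).
  by rewrite ler_pM2l ?expR_gt0// ler_pdivrMr// mulrC.
rewrite -expRD ler_expR -opprD lerN2 -[N%:R * ln y](_ : N%:R / 2 * (2 * ln y) = _); last by field.
by rewrite -mulrDr ler_wpM2l// divr_ge0.
Qed.

(** The dyadic balls around a pole all contribute the same amount to the
    integral. *)
Lemma ground_potential_infinite : potential_energy V Phi = +oo%E.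
Proof.
have [C C0 HC] := VPhi_lower.
have mVP : measurable_fun setT (fun x => V x * Phi x ^+ 2).
  apply: measurable_funM; first exact: measurable_V.
  by apply: measurable_funX; exact: measurable_ground.
have VP0 x : 0 <= V x * Phi x ^+ 2 by rewrite mulr_ge0 ?sqr_ge0//; exact: V_ge0.
have mi s : measurable_fun setT (fun x => \1_(ball0 s) x : R).
  by apply: measurable_indic; exact: measurable_ball0.
have H J : ((C * (J%:R * 2 ^+ N))%:E <= potential_energy V Phi)%E.
  pose F j x : R := (2 ^+ N) ^+ j * \1_(ball0 (2^-1 ^+ j)) x.
  have F0 j x : 0 <= F j x by rewrite mulr_ge0 ?exprn_ge0// indicE.
  have mF j : measurable_fun setT (F j) by apply: measurable_funM.
  have msF j : measurable_fun setT (fun x => F j (x - a i0)).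
    by apply: measurableT_comp => //; exact: measurable_shift.
  have IF j : (\int[mu]_x (F j (x - a i0))%:E = (2 ^+ N)%:E)%E.
    rewrite (ge0_integral_shift (f := fun x => (F j x)%:E)); last 2 first.
    - exact: (measurable_EFinP _ _).2.
    - by move=> x; rewrite lee_fin.
    rewrite ge0_integral_scale ?exprn_ge0//.
    rewrite integral_indic//; last exact: measurable_ball0.
    rewrite setIT [X in (_ * X)%E](_ : _ = ((2 * 2^-1 ^+ j) ^+ N)%:E); last first.
      by apply: lebesgue_rV_ball0; rewrite exprn_ge0// invr_ge0.
    rewrite -EFinM exprMn mulrCA -exprM.
    by rewrite -[X in _ * (_ * X)]exprM [(j * N)%N]mulnC exprVn mulfV ?mulr1.
  have -> : ((C * (J%:R * 2 ^+ N))%:E = \int[mu]_x (C * \sum_(j < J) F j (x - a i0))%:E)%E.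
    rewrite ge0_integral_scale ?(ltW C0)//; last 2 first.
    - by apply: measurable_sum.
    - by move=> x; apply: sumr_ge0.
    under eq_integral do rewrite -sumEFin.
    rewrite ge0_integral_sum//; last 2 first.
    - by move=> j; exact: (measurable_EFinP _ _).2.
    - by move=> j x _; rewrite lee_fin.
    under eq_bigr do rewrite IF.
    rewrite sumEFin sumr_const card_ord -EFinM; congr (C * _)%:E.
    by rewrite [LHS]mulr_natl.
  apply: ae_ge0_le_integral => //.
  - by move=> x _; rewrite lee_fin mulr_ge0 ?(ltW C0)//; apply: sumr_ge0.
  - by apply/measurable_EFinP; apply: measurable_funM => //; exact: measurable_sum.
  - by move=> x _; rewrite lee_fin.
  - exact: (measurable_EFinP _ _).2.
  apply: filterS (ae_off_poles a N0) => x ox _; rewrite lee_fin.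
  have [x1|x1] := leP `|x - a i0| 1.
    apply: le_trans (HC x ox x1 J); apply: ler_wpM2l; first exact: ltW.
    by apply: ler_sum => j _; rewrite /F indicE mem_setE.
  rewrite big1 ?mulr0// => j _; rewrite /F indicE memNset ?mulr0//=.
  apply/negP; rewrite -ltNge; apply: le_lt_trans x1.
  by rewrite exprn_ile1 ?invr_ge0// invf_le1// ler1n.
apply/eqP; rewrite -leye_eq leNgt; apply/negP => fin.
have ge0 : (0 <= potential_energy V Phi)%E by apply: integral_ge0 => x _; rewrite lee_fin.
have pf : potential_energy V Phi \is a fin_num by rewrite ge0_fin_numE.
set p := fine (potential_energy V Phi).
have D0 : 0 < C * 2 ^+ N by rewrite mulr_gt0// exprn_gt0.
have p0 : 0 <= p / (C * 2 ^+ N) by rewrite divr_ge0 ?fine_ge0// ltW.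
have := H (Num.Def.archi_bound (p / (C * 2 ^+ N))).
rewrite -(fineK pf) lee_fin leNgt => /negP; apply.
rewrite mulrCA -ltr_pdivrMr//; exact: archi_boundP.
Qed.

End two_poles.

(** * Two poles: there is no minimiser *)

Section minimiser.
Context {R : realType} {N n : nat}.
Variable a : 'I_n -> 'rV[R]_N.
Hypotheses (N5 : (5 <= N)%N) (n2 : (2 <= n)%N) (a_inj : injective a).
Implicit Types (x h : 'rV[R]_N) (k : nat) (u : 'rV[R]_N -> R).
Notation mu := (@lebesgue_rV R N).
Notation P := (dprod a).
Notation off := (off_poles a).
Notation Phi := (ground a).
Notation L := (log_dprod a).
Notation g := (@gexp R N n).
Notation lambda := (@lambdaV R N n).
Notation V := (V_ a).
Notation K k := (k.+1%:R : R).
Notation ball0 r := [set x : 'rV[R]_N | `|x| <= r].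

Let N0 : (0 < N)%N. Proof. exact: leq_trans N5. Qed.

Lemma weight_lower (M : R) : exists2 c : R, 0 < c &
  forall x, off x -> `|x| <= M -> c <= weight a x.
Proof.
pose i0 : 'I_n := Ordinal (ltnW n2).
have g0 : g < 0 by exact: gexp_lt0.
have [Q Q0 HQ] := continuous_bounded_on_ball M (smooth_continuous (smooth_dist2 a i0)).
have [B B0 HB] := continuous_bounded_on_ball M (smooth_continuous (smooth_dprod a)).
have B1 : 0 < B + 1 by lra.
have Q1 : 0 < Q + 1 by lra.
exists (- (8 * g) * expR (g * ln (B + 1)) ^+ 2 / (Q + 1)).
  by rewrite divr_gt0// mulr_gt0 ?exprn_gt0 ?expR_gt0//; lra.
move=> x ox xM; have P0 := ground_gt0 a x; have D0 := dform1_ge0 a x.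
have wE : weight a x = Phi x ^+ 2 * (- (8 * g) * rho a x) + 4 * (Phi x ^+ 2 * (g ^+ 2 * dform1 a x)).
  by rewrite /weight /lapl_ground; ring.
have Pge : expR (g * ln (B + 1)) <= Phi x.
  rewrite groundE ler_expR ler_nM2l// -(ln_dprod ox) ler_ln ?posrE//.
  by apply: le_trans (ler_norm _) _; apply: le_trans (HB x xM) _; rewrite lerDl.
have rge : (Q + 1)^-1 <= rho a x.
  have q0 := dist2_gt0 i0 ox.
  apply: (@le_trans _ _ (1 / dist2 a i0 x)).
    rewrite div1r lef_pV2 ?posrE//.
    by apply: le_trans (ler_norm _) _; apply: le_trans (HQ x xM) _; rewrite lerDl.
  rewrite /rho /winv (bigD1 i0)//= lerDl; apply: sumr_ge0 => i _.
  by rewrite divr_ge0// dist2_ge0.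
rewrite wE; apply: (@le_trans _ _ (Phi x ^+ 2 * (- (8 * g) * rho a x))); last first.
  rewrite lerDl; apply: mulr_ge0 => //; apply: mulr_ge0; first exact: sqr_ge0.
  by apply: mulr_ge0 => //; exact: sqr_ge0.
rewrite mulrAC [leRHS]mulrC; apply: ler_pM; rewrite ?exprn_ge0 ?expR_ge0//.
- by rewrite mulr_ge0 ?invr_ge0 ?ltW//; lra.
- by apply: ler_wpM2l => //; lra.
- by rewrite lerXn2r// nnegrE ?expR_ge0// ltW.
Qed.

Lemma quotientE k u x :
  quotient a (expR (- 3 * K k)) (fun x => cutoff a k x * u x) x = cutoff a k x * u x / Phi x.
Proof.
rewrite /quotient; have K0 : (0 : R) < K k by rewrite ltr0n.
have cd : expR (- 3 * K k) < expR (- 2 * K k) by rewrite ltr_expR; lra.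
have [Px|Px] := leP (P x) (expR (- 2 * K k)); first by rewrite cutoff_eq0// !mul0r.
by rewrite ggroundE ?expR_gt0// ltW// (lt_trans cd).
Qed.

Lemma cutoff_diagonal (phi : nat -> 'rV[R]_N -> R) : (forall k, Cc_infty (phi k)) ->
  exists m : nat -> nat, forall k, (k <= m k)%N /\
    (integral_sqr (laplacian (fun x => cutoff a (m k) x * phi k x)%R \- laplacian (phi k))%R
     <= (k.+1%:R^-1)%:E)%E.
Proof.
move=> Cphi.
suff H k : exists j, (k <= j)%N /\
    (integral_sqr (laplacian (fun x => cutoff a j x * phi k x)%R \- laplacian (phi k))%R
     <= (k.+1%:R^-1)%:E)%E.
  by have [m Hm] := choice H; exists m.
have /Cc_inftyP[sp vp] := Cphi k.
have k1 : 0 < k.+1%:R^-1 :> R by rewrite invr_gt0.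
have /(ge0_cvg0P (fun=> integral_sqr_ge0 _)) /(_ _ k1) [m0 _ Hm0] := cutoff_dense a N5 n2 sp vp.
by exists (maxn k m0); split; [exact: leq_maxl|apply: Hm0; exact: leq_maxr].
Qed.

(** On bounded sets the weight is bounded below, so the remainder controls the
    gradient of the quotient, hence its finite differences. *)
Lemma gradient_energy_le (r : R) h : 0 <= r -> exists2 A : R, 0 < A & forall k u v, smooth u ->
  v = quotient a (expR (- 3 * K k)) (fun x => cutoff a k x * u x) ->
  (\int[mu]_x (A * (\1_(ball0 r) x * (v (x + h) - v x) ^+ 2))%:E +
   \int[mu]_x (lambda * (V x * (cutoff a k x * u x) ^+ 2))%:E <=
   integral_sqr (laplacian (fun x => cutoff a k x * u x)%R))%E.
Proof.
move=> r0; have [c c0 Hc] := weight_lower (r + `|h|).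
have hh : 0 <= N%:R * `|h| ^+ 2 by rewrite mulr_ge0// exprn_ge0.
pose B := N%:R * `|h| ^+ 2 + 1; have B0 : 0 < B by rewrite ltr_wpDl.
exists (c / B); first by rewrite divr_gt0.
move=> k u v su vE; have cB : 0 <= c / B by rewrite divr_ge0// ltW.
have K0 : (0 : R) < K k by rewrite ltr0n.
have cd : 0 < expR (- 3 * K k) < expR (- 2 * K k) by rewrite expR_gt0 ltr_expR; lra.
have scu : smooth (fun x => cutoff a k x * u x).
  by apply: smooth_mul => //; exact: smooth_cutoff.
have sv : smooth v by rewrite vE; apply: quotient_smooth => //; exact: expR_gt0.
have zv : vanishes_where_lt a (expR (- 2 * K k)) v by rewrite vE; exact: quotient_vanishes_where.
have mi s : measurable_fun setT (fun x => \1_(ball0 s) x : R).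
  by apply: measurable_indic; exact: measurable_ball0.
have i0 s x : 0 <= \1_(ball0 s) x :> R by rewrite indicE ler0n.
rewrite (cutoff_energy _ N5 n2 k su) addeC potential_energyE; [|by []|by []|]; last first.
  exact: measurable_smooth.
apply: leeD => //; rewrite -vE.
have m1 : measurable_fun setT (fun x => \1_(ball0 r) x * (v (x + h) - v x) ^+ 2).
  by apply: measurable_funM => //; apply: measurable_funX; exact: measurable_increment.
have ms : measurable_fun setT (fun x => \sum_m partial m v x ^+ 2).
  apply: measurable_sum => m; apply: measurable_funX; apply: measurable_smooth.
  exact: smooth_partial.
have s0 x : 0 <= \sum_m partial m v x ^+ 2 by apply: sumr_ge0 => m _; exact: sqr_ge0.
have m2 : measurable_fun setT (fun x => N%:R * `|h| ^+ 2 *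
    (\1_(ball0 (r + `|h|)) x * \sum_m partial m v x ^+ 2)).
  by apply: measurable_funM => //; exact: measurable_funM.
rewrite ge0_integral_scale//; last by move=> x; rewrite mulr_ge0 ?sqr_ge0.
apply: (le_trans (lee_wpmul2l _ (difference_estimate h r0 sv))); first by rewrite lee_fin.
rewrite -ge0_integral_scale//; last by move=> x; rewrite !mulr_ge0.
have mr : measurable_fun setT (remainder (gground a (expR (- 3 * K k))) v).
  have sg : smooth (gground a (expR (- 3 * K k))) by apply: smooth_gground; exact: expR_gt0.
  exact: measurable_remainder.
apply: ae_ge0_le_integral => //.
- by move=> x _; rewrite lee_fin mulr_ge0// mulr_ge0// mulr_ge0.
- by apply/measurable_EFinP; apply: measurable_funM.
- by move=> x _; rewrite lee_fin; exact: (@remainder_ge0 _ _ _ a N5 n2 _ _ v x cd sv zv).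
- exact: (measurable_EFinP _ _).2.
apply: filterS (ae_off_poles a N0) => x ox _; rewrite lee_fin.
have [xr|xr] := leP `|x| (r + `|h|); last first.
  rewrite indicE memNset ?mul0r ?mulr0 ?mulr0//=; last by apply/negP; rewrite -ltNge.
  exact: (@remainder_ge0 _ _ _ a N5 n2 _ _ v x cd sv zv).
apply: le_trans (remainder_ge n2 cd sv zv ox); rewrite indicE mem_set// mul1r mulrA.
apply: ler_wpM2r => //; apply: le_trans (Hc x ox xr).
by rewrite mulrAC ler_pdivrMr// ler_pM2l// /B lerDl.
Qed.

(** Along an approximating sequence vanishing near the poles, the energy is at
    least the potential energy plus the energy of finite differences of the
    quotients. Finite differences pass to almost everywhere limits, so Fatou's
    lemma applies to this sum. For a minimiser the potential energy already
    exhausts the limit, and the finite differences of [u / Phi] vanish. *)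
Lemma minimiser_invariant u g0 h : D22 u g0 ->
  (integral_sqr g0 <= lambda%:E * potential_energy V u)%E ->
  {ae mu, forall x, u (x + h) / Phi (x + h) = u x / Phi x}.
Proof.
move=> Dug Hle; have [fg0 Hge] := hardy_D22 a N5 n2 Dug.
have [mu' mg [phi [Cphi /L2_cvg0P cphi aephi]]] := Dug.
(* The approximating sequence is truncated, at a rate fast enough not to
   change the limit of the Laplacians. *)
have [m Hm] := cutoff_diagonal Cphi.
pose psi k x := cutoff a (m k) x * phi k x.
have sphi k : smooth (phi k) by have /Cc_inftyP[] := Cphi k.
have spsi k : smooth (psi k) by apply: smooth_mul => //; exact: smooth_cutoff.
have mlpsi k : measurable_fun setT (laplacian (psi k)).
  by apply: measurable_smooth; exact: smooth_laplacian.
have mlphi k : measurable_fun setT (laplacian (phi k)).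
  by apply: measurable_smooth; exact: smooth_laplacian.
have fpsi k : (integral_sqr (laplacian (psi k)) < +oo)%E.
  apply: continuous_integral_sqr_fin.
    by apply: smooth_continuous; exact: smooth_laplacian.
  by apply: laplacian_vanishes; apply: vanishes_mull; exact: cutoff_vanishes.
have cpsi : (fun k => integral_sqr (laplacian (psi k) \- g0)) @ \oo --> 0%E.
  apply/(ge0_cvg0P (fun=> integral_sqr_ge0 _)) => e e0.
  have e4 : 0 < e / 4 by rewrite divr_gt0.
  have /(ge0_cvg0P (fun=> integral_sqr_ge0 _)) /(_ _ e4) H1 := cphi.
  have H2 : \forall k \near \oo, k.+1%:R^-1 < e / 4.
    by apply: (@cvgr_lt R _ _ _ (fun k => k.+1%:R^-1) 0) e4; exact: cvg_harmonic.
  apply: filterS2 H1 H2 => k Hk1 Hk2.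
  apply: (le_trans (sqr_triangle ltr01 (measurable_funB (mlpsi k) mg) (measurable_funB (mlphi k) mg))).
  rewrite [X in (_ + _ * X)%E](_ : _ = integral_sqr (laplacian (psi k) \- laplacian (phi k))); last first.
    by apply: eq_integral => x _; congr (_ ^+ 2)%:E; rewrite /= opprB addrA subrK.
  rewrite invr1.
  apply: (@le_trans _ _ ((1 + 1)%:E * (e / 4)%:E + (1 + 1)%:E * (e / 4)%:E)%E).
    apply: leeD; apply: lee_wpmul2l => //.
    by apply: le_trans (Hm k).2 _; rewrite lee_fin ltW.
  by rewrite -!EFinM -EFinD lee_fin; lra.
have [_ H] := integral_sqr_lim mlpsi mg fpsi cpsi.
have aepsi : {ae mu, forall x, psi k x @[k --> \oo] --> u x}.
  apply: filterS2 (ae_off_poles a N0) aephi => x ox px.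
  apply: cvg_trans px; apply: near_eq_cvg.
  have [k0 _ Hk0] := near_cutoff_eq1 ox; exists k0 => // k /= k0k.
  by rewrite /psi Hk0 ?mul1r//=; exact: leq_trans (Hm k).1.
pose v x := u x / Phi x.
have mv : measurable_fun setT v.
  by apply: measurable_funM => //; apply: measurable_invr; exact: measurable_ground.
pose vk k := quotient a (expR (- 3 * K (m k))) (psi k).
have vkE k x : vk k x = psi k x / Phi x by exact: quotientE.
have svk k : smooth (vk k) by apply: quotient_smooth => //; exact: expR_gt0.
have aevk : {ae mu, forall x, vk k x @[k --> \oo] --> v x}.
  apply: filterS aepsi => x px; under eq_fun do rewrite vkE.
  by apply: cvgM => //; exact: cvg_cst.
suff Hr (r : nat) : {ae mu, forall x, `|x| <= r%:R -> v (x + h) = v x}.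
  have /ae_foralln : forall r : nat, {ae mu, forall x, `|x| <= r%:R -> v (x + h) = v x}.
    exact: Hr.
  apply: filterS => x Hx; apply: (Hx (Num.Def.archi_bound `|x|)).
  by rewrite ltW// archi_boundP.
have [A A0 HA] := gradient_energy_le h (ler0n R r).
have mi : measurable_fun setT (fun x => \1_(ball0 (r%:R : R)) x : R).
  by apply: measurable_indic; exact: measurable_ball0.
have i0 x : 0 <= \1_(ball0 (r%:R : R)) x :> R by rewrite indicE ler0n.
pose F (w : 'rV[R]_N -> R) x := A * (\1_(ball0 (r%:R : R)) x * (w (x + h) - w x) ^+ 2).
have mF w : measurable_fun setT w -> measurable_fun setT (F w).
  move=> mw; apply: measurable_funM => //; apply: measurable_funM => //.
  apply: measurable_funX; apply: measurable_funB => //.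
  by apply: measurableT_comp => //; exact: measurable_shift.
have F0 w x : 0 <= F w x.
  apply: mulr_ge0; first exact: ltW.
  by apply: mulr_ge0; [exact: i0|exact: sqr_ge0].
have l0 u' x : 0 <= lambda * (V x * u' x ^+ 2) by exact: potential_ge0.
have ml u' : measurable_fun setT u' -> measurable_fun setT (fun x => lambda * (V x * u' x ^+ 2)).
  exact: measurable_potential.
have bound : (\int[mu]_x (F v x + lambda * (V x * u x ^+ 2))%:E <= integral_sqr g0)%E.
  apply/lee_addgt0Pr => e e0.
  apply: (fatou_bound (f_ := fun k x => F (vk k) x + lambda * (V x * psi k x ^+ 2))).
  - move=> k; apply: measurable_funD; first by apply: mF; exact: measurable_smooth.
    by apply: ml; exact: measurable_smooth.
  - by apply: measurable_funD; [exact: mF|exact: ml].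
  - by move=> k x; rewrite addr_ge0.
  - apply: filterS2 (filterI aevk (ae_shift h aevk)) aepsi => x [vx vxh] px.
    apply: cvgD; (apply: cvgM; first exact: cvg_cst); (apply: cvgM; first exact: cvg_cst).
      apply: cvg_sqr; exact: (cvgB vxh vx).
    exact: (cvg_sqr px).
  - apply: filterS (H e e0) => k [Hk _]; apply: le_trans Hk.
    rewrite ge0_integral_add//; last 2 first.
    + by apply: mF; exact: measurable_smooth.
    + by apply: ml; exact: measurable_smooth.
    exact: (HA (m k) (phi k) (vk k) (sphi k) erefl).
have pfin : (lambda%:E * potential_energy V u)%E \is a fin_num.
  rewrite ge0_fin_numE; first exact: le_lt_trans Hge _.
  rewrite potential_energyE//.
  by apply: integral_ge0 => x _; rewrite lee_fin.
have IF : (\int[mu]_x (F v x)%:E = 0)%E.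
  apply/eqP; rewrite eq_le; apply/andP; split; last first.
    by apply: integral_ge0 => x _; rewrite lee_fin.
  move: bound; rewrite ge0_integral_add//; [|exact: mF|exact: ml].
  rewrite -potential_energyE// => bound; have := le_trans bound Hle.
  by rewrite -leeBrDr// subee.
have := ae_all_eq0 (mF _ mv) (F0 _) IF; apply: filterS => x + xr.
have -> : F v x = A * (v (x + h) - v x) ^+ 2.
  have E : \1_(ball0 (r%:R : R)) x = 1 :> R by rewrite indicE mem_set.
  by rewrite /F E mul1r.
by move=> /eqP; rewrite mulf_eq0 (gt_eqF A0)/= expf_eq0/= subr_eq0 => /eqP.
Qed.

Lemma minimiser_is_ground u g0 : D22 u g0 ->
  (integral_sqr g0 <= lambda%:E * potential_energy V u)%E ->
  exists c, {ae mu, forall x, u x = c * Phi x}.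
Proof.
move=> Dug Hle; have [mu' _ _] := Dug.
have mv : measurable_fun setT (fun x => u x / Phi x).
  by apply: measurable_funM => //; apply: measurable_invr; exact: measurable_ground.
have [c Hc] := translation_invariant_cst mv (fun h => minimiser_invariant h Dug Hle).
exists c; apply: filterS Hc => x <-.
by rewrite divfK// gt_eqF// ground_gt0.
Qed.

(** A minimiser would be a nonzero multiple of the ground state, whose
    potential energy is infinite. *)
Lemma not_achieved : n = 2%N -> ~ sharp_constant_achieved V.
Proof.
move=> n_eq2 [u [g0 [Dug nz rE]]]; have [mu' _ _] := Dug.
have [i [p [iE pE p0 Hip rE']]] := rayleigh_fin N5 n2 a_inj Dug nz.
have ipl : i = lambda * p.
  move: rE; rewrite rE' -(sharp_constant_V N5 n2 a_inj) => -[<-].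
  by rewrite divfK// gt_eqF.
have [c Hc] : exists c, {ae mu, forall x, u x = c * Phi x}.
  by apply: (minimiser_is_ground Dug); rewrite iE pE -EFinM ipl.
have c0 : c != 0.
  apply/eqP => cz; apply: nz; apply: filterS Hc => x ->.
  by rewrite cz mul0r.
have mVP (w : 'rV[R]_N -> R) : measurable_fun setT w -> measurable_fun setT (fun x => V x * w x ^+ 2).
  by move=> mw; apply: measurable_funM; [exact: measurable_V|exact: measurable_funX].
have mP := measurable_ground a.
have VP0 x : 0 <= V x * Phi x ^+ 2 by rewrite mulr_ge0 ?sqr_ge0//; exact: V_ge0.
have : potential_energy V u = ((c ^+ 2)%:E * potential_energy V Phi)%E.
  rewrite /potential_energy -ge0_integral_scale ?sqr_ge0//; last exact: mVP.
  apply: ae_eq_integral => //.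
  - by apply: (measurable_EFinP _ _).2; exact: mVP.
  - by apply: (measurable_EFinP _ _).2; apply: measurable_funM => //; exact: mVP.
  - by apply: filterS Hc => x -> _; congr EFin; ring.
rewrite pE ground_potential_infinite// gt0_muley// lte_fin.
by rewrite lt_def sqr_ge0 sqrf_eq0 c0.
Qed.

End minimiser.

Theorem proposition1p6 (R : realType) (N n : nat)
    (hN : (5 <= N)%N) (hn : (2 <= n)%N)
    (a : 'I_n -> 'rV[R]_N) (ha : injective a) :
  let lambda : R := N%:R ^+ 2 * (N%:R - 4) ^+ 2 / n%:R ^+ 4 in
  [/\ critical lambda (V_ a),
      (3 <= n)%N -> positive_critical lambda (V_ a) &
      n = 2%N -> null_critical lambda (V_ a)].
Proof.
move=> lambda; have crit : critical lambda (V_ a) by exact: critical_V.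
have sharp : (lambda%:E)%E = sharp_constant (V_ a) by exact: sharp_constant_V.
split=> // [n3|n_eq2]; split=> //; first exact: achieved_ground.
exact: not_achieved.
Qed.
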